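(* Let $Q$ be a finite quiver with a finite set $\mathcal{R}$ of relations, $\mathbf{v}$ a dimension vector with a vertex $\infty$ at which $v_\infty=1$, and let $\alpha=\alpha(Q,\mathbf{v})$ be the canonical stability parameter. Let $k\neq\infty$ be a vertex, and let $\mathbf{v}_1^\ell<\mathbf{v}$ be a dimension vector with value $1$ at $\infty$ and positive value at $k$, and put $\mathbf{v}_1^u=\mathbf{v}_1^\ell-\mathbf{e}_k$. Let $\mathcal{M}_{\mathbf{v}_1^u,\mathbf{v}_1^\ell}\subset\mathcal{M}(Q,\mathbf{v}_1^u,\mathcal{R})\times\mathcal{M}(Q,\mathbf{v}_1^\ell,\mathcal{R})$ be the image, under $(x_u,x_\ell)\mapsto([x_1^u],[x_1^\ell])$, of the set $\mathcal{P}_{\mathbf{v}_1^u,\mathbf{v}_1^\ell}\subset C_{\mathbf{v}_1^u}\times C_{\mathbf{v}_1^\ell}$ of pairs of critical points of $\|\mu-\alpha\|^2$ on $\nu^{-1}(0)\subset\mathrm{Rep}(Q,\mathbf{v})$ connected by a gradient flow line. Then $\mathcal{M}_{\mathbf{v}_1^u,\mathbf{v}_1^\ell}$ is the Hecke correspondence, i.e. $\mathcal{M}_{\mathbf{v}_1^u,\mathbf{v}_1^\ell}=\mathcal{B}_k(Q,\mathbf{v}_1^\ell,\mathcal{R})$.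
   Context: A finite quiver $Q$ has vertex set $\mathcal{I}$, edge set $\mathcal{E}$ and head/tail maps $h,t$. For a dimension vector $\mathbf{w}=(w_i)$ fix Hermitian vector spaces $V_i$ with $\dim_{\mathbb{C}}V_i=w_i$; $\mathrm{Rep}(Q,\mathbf{w})=\bigoplus_{a\in\mathcal{E}}\mathrm{Hom}(V_{t(a)},V_{h(a)})$. $G_{\mathbf{w}}=\prod_i\mathrm{GL}(V_i,\mathbb{C})$ and $K_{\mathbf{w}}=\prod_i\mathrm{U}(V_i)$ (Lie algebra $\mathfrak{k}_{\mathbf{w}}$) act by $(g\cdot x)_a=g_{h(a)}x_ag_{t(a)}^{-1}$, with infinitesimal action $\rho_x^{\mathbb{C}}(u)_a=u_{h(a)}x_a-x_au_{t(a)}$. A relation is a linear combination of paths of length at least $2$ with common head and common tail; $\nu_{\mathbf{w}}^{-1}(0)\subset\mathrm{Rep}(Q,\mathbf{w})$ is the set of representations on which all relations in $\mathcal{R}$ vanish, and $\nu^{-1}(0)=\nu_{\mathbf{v}}^{-1}(0)$. $\mathbf{e}_k$ is the dimension vector equal to $1$ at $k$ and $0$ elsewhere. For a dimension vector $\mathbf{w}$ with $w_\infty=1$ the canonical stability parameter $\alpha(Q,\mathbf{w})$ is $\alpha_\infty=-\sum_{j\ne\infty}w_j$ and $\alpha_i=1$ for $i\neq\infty$. Put $\mathrm{slope}_\alpha(\mathbf{w}')=\sum_i\alpha_iw_i'/\sum_iw_i'$. A representation in $\mathrm{Rep}(Q,\mathbf{w})$ is stable if every proper non-zero subrepresentation has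 negative $\alpha(Q,\mathbf{w})$-slope (equivalently, every non-zero subrepresentation contains the vertex $\infty$). $\mathcal{M}(Q,\mathbf{w},\mathcal{R})$ is the moduli space of stable representations in $\nu_{\mathbf{w}}^{-1}(0)$ modulo $G_{\mathbf{w}}$; its points are isomorphism classes $[x]$. The moment map is $\mu(x)=\frac1{2i}\sum_a[x_a,x_a^*]\in\mathfrak{k}_{\mathbf{v}}$ ($x_a$ viewed in $\mathrm{End}(\bigoplus_iV_i)$), and $\alpha=\alpha(Q,\mathbf{v})$ is identified with $(i\alpha_j\mathrm{id}_{V_j})_j\in\mathfrak{k}_{\mathbf{v}}$. $x\in\nu^{-1}(0)$ is critical for $\|\mu-\alpha\|^2$ iff $\rho_x^{\mathbb{C}}(\mu(x)-\alpha)=0$. Every critical $x$ splits orthogonally as $x=x_1\oplus x_2$, where $x_1$ contains the vertex $\infty$, is an eigenspace summand of $i(\mu(x)-\alpha)$ and is stable, and $\mu(x_2)=0$ (with $x_2$ possibly zero-dimensional). $C_{\mathbf{v}_1}$ denotes the set of critical points in $\nu^{-1}(0)$ for which $x_1$ has dimension vector $\mathbf{v}_1$; for $x_u\in C_{\mathbf{v}_1^u}$, $x_\ell\in C_{\mathbf{v}_1^\ell}$ write $x_u=x_1^u\oplus x_2^u$, $x_\ell=x_1^\ell\oplus x_2^\ell$. The gradient flow $\phi(y,t)$ solves $\frac d{dt}\phi=-i\rho_\phi^{\mathbb{C}}(\mu(\phi)-\alpha)$, $\phi(y,0)=y$. The pair $(x_u,x_\ell)$ is connected by a flow line if there is $y\in\nu^{-1}(0)$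 with $\lim_{t\to-\infty}\phi(y,t)=x_u$ and $\lim_{t\to\infty}\phi(y,t)=x_\ell$. Hecke correspondence: $\mathcal{B}_k(Q,\mathbf{v}_1^\ell,\mathcal{R})\subset\mathcal{M}(Q,\mathbf{v}_1^\ell-\mathbf{e}_k,\mathcal{R})\times\mathcal{M}(Q,\mathbf{v}_1^\ell,\mathcal{R})$ is the set of pairs $([x_1],[x_2])$ of classes of stable representations such that $x_1$ is isomorphic to a subrepresentation of $x_2$. *)

(* Defs.v *)
From HB Require Import structures.
From mathcomp Require Import all_boot all_order all_algebra.
From mathcomp Require Import complex.
From mathcomp Require Import all_classical all_reals all_analysis.

Set Implicit Arguments.
Unset Strict Implicit.
Unset Printing Implicit Defensive.

Import Order.TTheory GRing.Theory Num.Theory.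
Import numFieldNormedType.Exports.

Local Open Scope classical_set_scope.
Local Open Scope ring_scope.

Record quiver := Quiver {
  vertex :> finType;
  edge : finType;
  qhead : edge -> vertex;
  qtail : edge -> vertex }.

Definition dimvec (Q : quiver) := Q -> nat.

Definition dim_lt (Q : quiver) (w w' : dimvec Q) : Prop :=
  (forall i, (w i <= w' i)%N) /\ (exists i, (w i < w' i)%N).

Definition dim_sub_basis (Q : quiver) (w : dimvec Q) (k : Q) : dimvec Q :=
  fun i => (w i - (i == k))%N.

(* [qpath s d]: paths from [s] to [d]; [Pcons a p] is the path [p] followed by
   the edge [a]. *)
Inductive qpath (Q : quiver) (s : Q) : Q -> Type :=
| Pnil : qpath s s
| Pcons (a : edge Q) (p : qpath s (qtail a)) : qpath s (qhead a).

Fixpoint plength (Q : quiver) (s d : Q) (p : qpath s d) : nat :=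
  match p with
  | Pnil => 0
  | Pcons _ p' => (plength p').+1
  end.

(* The term [(c, p)] of [rel_terms] stands for the summand [c p]. *)
Record relation (R : realType) (Q : quiver) := Relation {
  rel_tail : Q;
  rel_head : Q;
  rel_terms : seq (R[i] * qpath rel_tail rel_head);
  rel_length : all (fun t => 2 <= plength t.2)%N rel_terms }.

(* The Hermitian space V_i is C^(w i) with its standard Hermitian form, seen as
   column vectors. *)
Definition rep (R : realType) (Q : quiver) (w : dimvec Q) :=
  forall a : edge Q, 'M[R[i]]_(w (qhead a), w (qtail a)).

Definition adj (R : realType) (m n : nat) (A : 'M[R[i]]_(m, n)) :
    'M[R[i]]_(n, m) :=
  map_mx (@conjc R) A^T.

Fixpoint path_eval (R : realType) (Q : quiver) (w : dimvec Q) (x : rep R w)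
    (s d : Q) (p : qpath s d) : 'M[R[i]]_(w d, w s) :=
  match p in qpath _ d' return 'M[R[i]]_(w d', w s) with
  | Pnil => 1%:M
  | Pcons a p' => x a *m path_eval x p'
  end.

Definition rel_eval (R : realType) (Q : quiver) (w : dimvec Q) (x : rep R w)
    (r : relation R Q) : 'M[R[i]]_(w (rel_head r), w (rel_tail r)) :=
  \sum_(t <- rel_terms r) t.1 *: path_eval x t.2.

Definition nu_zero (R : realType) (Q : quiver) (rels : seq (relation R Q))
    (w : dimvec Q) : set (rep R w) :=
  [set x | all (fun r => rel_eval x r == 0) rels].

Definition act (R : realType) (Q : quiver) (w : dimvec Q)
    (g : forall i : Q, 'M[R[i]]_(w i)) (x : rep R w) : rep R w :=
  fun a => g (qhead a) *m x a *m invmx (g (qtail a)).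

Definition iso_class (R : realType) (Q : quiver) (w : dimvec Q)
    (x : rep R w) : set (rep R w) :=
  [set y | exists g : forall i : Q, 'M[R[i]]_(w i),
     (forall i, g i \in unitmx) /\ y = act g x].

Definition inf_act (R : realType) (Q : quiver) (w : dimvec Q) (x : rep R w)
    (u : forall i : Q, 'M[R[i]]_(w i)) : rep R w :=
  fun a => u (qhead a) *m x a - x a *m u (qtail a).

Definition subfamily (R : realType) (Q : quiver) (w : dimvec Q) :=
  forall i : Q, {vspace 'cV[R[i]]_(w i)}.

Definition is_subrep (R : realType) (Q : quiver) (w : dimvec Q) (x : rep R w)
    (U : subfamily R w) : Prop :=
  forall (a : edge Q) (c : 'cV[R[i]]_(w (qtail a))),
    c \in U (qtail a) -> x a *m c \in U (qhead a).

Definition can_stab (Q : quiver) (inf : Q) (w : dimvec Q) (i : Q) : int :=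
  if i == inf then - (\sum_(j | j != inf) w j)%N%:Z else 1.

Definition slope (Q : quiver) (alpha : Q -> int) (w : dimvec Q) : rat :=
  (\sum_i alpha i * (w i)%:Z)%:~R / (\sum_i w i)%N%:R.

Definition stable (R : realType) (Q : quiver) (inf : Q) (w : dimvec Q)
    (x : rep R w) : Prop :=
  forall U : subfamily R w, is_subrep x U ->
    (exists i, U i != 0%VS) -> (exists i, U i != fullv) ->
    slope (can_stab inf w) (fun i => \dim (U i)) < 0.

(* Points of the moduli space are the isomorphism classes themselves. *)
Definition moduli (R : realType) (Q : quiver) (inf : Q)
    (rels : seq (relation R Q)) (w : dimvec Q) : set (set (rep R w)) :=
  [set iso_class x | x in [set x | nu_zero rels x /\ stable inf x]].
Arguments moduli {R Q} inf rels w _.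

(* [J] is an isomorphism of [x1] onto the restriction of [x2] to [U]. *)
Definition iso_to_subrep (R : realType) (Q : quiver) (w1 w2 : dimvec Q)
    (x1 : rep R w1) (x2 : rep R w2) : Prop :=
  exists (U : subfamily R w2) (J : forall i : Q, 'M[R[i]]_(w2 i, w1 i)),
    [/\ is_subrep x2 U,
        forall i (c : 'cV[R[i]]_(w2 i)),
          c \in U i <-> exists b : 'cV[R[i]]_(w1 i), c = J i *m b,
        forall i, injective (fun b : 'cV[R[i]]_(w1 i) => J i *m b) &
        forall a, J (qhead a) *m x1 a = x2 a *m J (qtail a)].

Definition hecke (R : realType) (Q : quiver) (inf k : Q)
    (rels : seq (relation R Q)) (w : dimvec Q) :
    set (set (rep R (dim_sub_basis w k)) * set (rep R w)) :=
  (moduli inf rels (dim_sub_basis w k) `*` moduli inf rels w) `&`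
  [set c | exists (x1 : rep R (dim_sub_basis w k)) (x2 : rep R w),
     c = (iso_class x1, iso_class x2) /\ iso_to_subrep x1 x2].
Arguments hecke {R Q} inf k rels w _.

(* End(\bigoplus_i V_i) as families of blocks, the (i, j) block being the
   component V_j -> V_i. *)
Definition endo (R : realType) (Q : quiver) (w : dimvec Q) :=
  forall i j : Q, 'M[R[i]]_(w i, w j).

Definition endo_mul (R : realType) (Q : quiver) (w : dimvec Q)
    (A B : endo R w) : endo R w :=
  fun i j => \sum_l A i l *m B l j.

Definition endo_adj (R : realType) (Q : quiver) (w : dimvec Q)
    (A : endo R w) : endo R w :=
  fun i j => adj (A j i).

(* [conform_mx] only casts here: the dimensions agree under the test. *)
Definition endo_of_edge (R : realType) (Q : quiver) (w : dimvec Q)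
    (x : rep R w) (a : edge Q) : endo R w :=
  fun i j => if (qhead a == i) && (qtail a == j) then conform_mx 0 (x a) else 0.

(* [x_a, x_a^*] preserves every V_i, so only diagonal blocks are kept. *)
Definition moment (R : realType) (Q : quiver) (w : dimvec Q) (x : rep R w) :
    forall i : Q, 'M[R[i]]_(w i) :=
  fun i => (2%:R * 'i%C)^-1 *:
    \sum_a (let X := endo_of_edge x a in
            endo_mul X (endo_adj X) i i - endo_mul (endo_adj X) X i i).

Definition stab_elt (R : realType) (Q : quiver) (alpha : Q -> int)
    (w : dimvec Q) : forall i : Q, 'M[R[i]]_(w i) :=
  fun i => ('i%C * (alpha i)%:~R)%:M.

Definition shifted_moment (R : realType) (Q : quiver) (alpha : Q -> int)
    (w : dimvec Q) (x : rep R w) : forall i : Q, 'M[R[i]]_(w i) :=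
  fun i => moment x i - stab_elt R alpha w i.

Definition critical (R : realType) (Q : quiver) (rels : seq (relation R Q))
    (alpha : Q -> int) (w : dimvec Q) : set (rep R w) :=
  [set x | nu_zero rels x /\
     forall a, inf_act x (shifted_moment alpha x) a = 0].

(* x = x1 (+) x2 orthogonally: [J1 i] and [J2 i] are isometries of C^(v1 i) and
   C^(v2 i) onto orthogonal complements in C^(v i) carrying x1 (+) x2 to x. *)
Definition orth_sum (R : realType) (Q : quiver) (v v1 v2 : dimvec Q)
    (J1 : forall i : Q, 'M[R[i]]_(v i, v1 i))
    (J2 : forall i : Q, 'M[R[i]]_(v i, v2 i))
    (x : rep R v) (x1 : rep R v1) (x2 : rep R v2) : Prop :=
  [/\ forall i, adj (J1 i) *m J1 i = 1%:M,
      forall i, adj (J2 i) *m J2 i = 1%:M,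
      forall i, adj (J1 i) *m J2 i = 0,
      forall i, J1 i *m adj (J1 i) + J2 i *m adj (J2 i) = 1%:M &
      forall a, x a = J1 (qhead a) *m x1 a *m adj (J1 (qtail a))
                    + J2 (qhead a) *m x2 a *m adj (J2 (qtail a))].

(* The splitting x = x1 (+) x2 of a critical point; the third clause says that
   the summand x1 is a full eigenspace of i(mu(x) - alpha). *)
Definition crit_splitting (R : realType) (Q : quiver) (inf : Q)
    (alpha : Q -> int) (v v1 v2 : dimvec Q)
    (x : rep R v) (x1 : rep R v1) (x2 : rep R v2) : Prop :=
  exists (J1 : forall i : Q, 'M[R[i]]_(v i, v1 i))
         (J2 : forall i : Q, 'M[R[i]]_(v i, v2 i)),
    [/\ orth_sum J1 J2 x x1 x2,
        v1 inf = 1%N,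
        exists lambda : R[i], forall i (c : 'cV[R[i]]_(v i)),
          (exists b : 'cV[R[i]]_(v1 i), c = J1 i *m b) <->
          ('i%C *: shifted_moment alpha x i) *m c = lambda *: c,
        stable inf x1 &
        forall i, moment x2 i = 0].

Definition crit_stratum (R : realType) (Q : quiver) (inf : Q)
    (rels : seq (relation R Q)) (alpha : Q -> int) (v v1 : dimvec Q) :
    set (rep R v) :=
  [set x | critical rels alpha x /\
     exists (v2 : dimvec Q) (x1 : rep R v1) (x2 : rep R v2),
       crit_splitting inf alpha x x1 x2].
Arguments crit_stratum {R Q} inf rels alpha {v} v1 _.

Definition rep_cvg (R : realType) (Q : quiver) (w : dimvec Q)
    (F : set_system R) (phi : R -> rep R w) (x : rep R w) : Prop :=
  forall a p q,
    (fun t => complex.Re (phi t a p q)) @ F --> complex.Re (x a p q) /\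
    (fun t => complex.Im (phi t a p q)) @ F --> complex.Im (x a p q).

Definition rep_is_derive (R : realType) (Q : quiver) (w : dimvec Q)
    (phi : R -> rep R w) (t : R) (x : rep R w) : Prop :=
  forall a p q,
    is_derive t (1 : R) (fun s => complex.Re (phi s a p q))
              (complex.Re (x a p q)) /\
    is_derive t (1 : R) (fun s => complex.Im (phi s a p q))
              (complex.Im (x a p q)).

Definition flow_field (R : realType) (Q : quiver) (alpha : Q -> int)
    (w : dimvec Q) (x : rep R w) : rep R w :=
  fun a => - 'i%C *: inf_act x (shifted_moment alpha x) a.

Definition gradient_flow (R : realType) (Q : quiver) (alpha : Q -> int)
    (w : dimvec Q) (y : rep R w) (phi : R -> rep R w) : Prop :=
  phi 0 = y /\ forall t, rep_is_derive phi t (flow_field alpha (phi t)).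

Definition flow_connected (R : realType) (Q : quiver)
    (rels : seq (relation R Q)) (alpha : Q -> int) (v : dimvec Q)
    (xu xl : rep R v) : Prop :=
  exists2 y : rep R v, nu_zero rels y &
    exists phi : R -> rep R v,
      [/\ gradient_flow alpha y phi,
          rep_cvg (-oo_ R) phi xu & rep_cvg (+oo_ R) phi xl].

Definition flow_pairs (R : realType) (Q : quiver) (inf : Q)
    (rels : seq (relation R Q)) (v v1u v1l : dimvec Q) :
    set (rep R v * rep R v) :=
  let alpha := can_stab inf v in
  (crit_stratum inf rels alpha v1u `*` crit_stratum inf rels alpha v1l) `&`
  [set p | flow_connected rels alpha p.1 p.2].
Arguments flow_pairs {R Q} inf rels v v1u v1l _.

(* The image of [flow_pairs] under (xu, xl) |-> ([x1u], [x1l]). *)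
Definition flow_moduli (R : realType) (Q : quiver) (inf : Q)
    (rels : seq (relation R Q)) (v v1u v1l : dimvec Q) :
    set (set (rep R v1u) * set (rep R v1l)) :=
  let alpha := can_stab inf v in
  [set c | exists2 p : rep R v * rep R v, flow_pairs inf rels v v1u v1l p &
     exists (v2u v2l : dimvec Q)
            (x1u : rep R v1u) (x2u : rep R v2u)
            (x1l : rep R v1l) (x2l : rep R v2l),
       [/\ crit_splitting inf alpha p.1 x1u x2u,
           crit_splitting inf alpha p.2 x1l x2l &
           c = (iso_class x1u, iso_class x1l)]].
Arguments flow_moduli {R Q} inf rels v v1u v1l _.

(* Main.v *)
(** Stability means that no vector is killed by all paths ending at [inf], so a
    stable representation is determined by the linear relations among its
    functionals [path_eval x p], [p] ending at [inf]; inclusion of relations is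
    the same as an embedding.  Along a flow line these functionals solve a linear
    equation, so their relations are constant.

    Given a flow line, its relations pass to the limit x_u.  Near the limit x_l
    the functionals grow faster on x_2^l than on x_1^l, so a combination that
    vanishes on x_1^l stays in a cone where it must be zero: the flow line
    satisfies the relations of x_1^l.  Hence x_1^u embeds in x_1^l.

    Conversely, flow x_1 to a solution of the moment map equation and write x_2 in
    block triangular form over it, with off-diagonal part b.  A gauge
    transformation makes b harmonic, hence an eigenvector of the linearised flow
    at the diagonal part x_u.  The power series in exp(gamma t) tangent to b is an
    orbit emanating from x_u, and rescaling it as t tends to -oo recovers x_2, so
    the orbit lies in the class of x_2.  Its forward limit is again in that class:
    the exponential of a multiple of |x|^2 times |det|^2 of a basis of functionals
    is monotone, which keeps the orbit in a compact set of stable points, where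
    the traceless moment map decays exponentially. *)

Require Import Defs.
From HB Require Import structures.
From mathcomp Require Import all_boot all_order all_algebra.
From mathcomp Require Import perm complex.
From mathcomp Require Import all_classical all_reals all_analysis.
From mathcomp Require Import ring lra zify.

Set Implicit Arguments.
Unset Strict Implicit.
Unset Printing Implicit Defensive.

Import Order.TTheory GRing.Theory Num.Theory.
Import numFieldNormedType.Exports.

Local Open Scope classical_set_scope.
Local Open Scope ring_scope.

(** * Polynomial differential equations *)

(** In real coordinates the flow is a polynomial differential equation, so solutions are built as
    power series with majorants [rho ^ n / (n + 1) ^ 2], and no theory of unstable manifolds is
    needed: the one orbit required is tangent to an eigenvector for the largest eigenvalue gamma of
    the linearisation, so that n gamma with n >= 2 is never an eigenvalue and every further
    coefficient can be solved for.

    Write |w| for the total dimension. As alpha is 1 - |v| at [inf] and 1 elsewhere, and the traces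
    of the moment map of each summand add up to 0, the eigenvalue of i (mu - alpha) at a critical
    point is 1 - |v| / |v_1| on x_1 and 1 on x_2. This gap is gamma. The field depends on alpha only
    up to a constant, so i (mu - alpha) may be made traceless on each Rep(Q, w).

    The connecting orbit is built in Rep(Q, v_1^l), where its forward limit is stable, and then
    extended by zero to v; this preserves the relations because they contain no trivial path. Its
    source is x_1 plus the quotient x_2 / x_1, which is one-dimensional and so has zero moment map,
    even with loops at k: this is where the difference e_k enters. *)

Ltac eqle := match goal with
  |- is_true (?a <= ?b) => have -> : a = b by ring
  end; exact: lexx.

Section PolynomialExpressions.
Variables (R : realType) (d : nat).
Implicit Types (x : 'I_d -> R) (c : 'I_d -> nat -> R) (M rho eps : R).

Inductive pexp : Type :=
| PC of R
| PX of 'I_d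
| PD of pexp & pexp
| PM of pexp & pexp.

Fixpoint peval (p : pexp) x : R :=
  match p with
  | PC a => a
  | PX i => x i
  | PD p q => peval p x + peval q x
  | PM p q => peval p x * peval q x
  end.

Fixpoint pgrad (p : pexp) x (j : 'I_d) : R :=
  match p with
  | PC a => 0
  | PX i => (i == j)%:R
  | PD p q => pgrad p x j + pgrad q x j
  | PM p q => pgrad p x j * peval q x + peval p x * pgrad q x j
  end.

Definition conv (a b : nat -> R) n : R := \sum_(j < n.+1) a j * b (n - j)%N.

(* [pcoef p c n] is the coefficient of [t ^ n] in [p] evaluated at the power
   series whose coefficients are [c]. *)
Fixpoint pcoef (p : pexp) c n : R :=
  match p with
  | PC a => if n == 0%N then a else 0
  | PX i => c i n
  | PD p q => pcoef p c n + pcoef q c n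
  | PM p q => conv (pcoef p c) (pcoef q c) n
  end.

Definition trunc_coef n c : 'I_d -> nat -> R :=
  fun i m => if (m < n)%N then c i m else 0.

Lemma conv0 a b : conv a b 0%N = a 0%N * b 0%N.
Proof. by rewrite /conv big_ord1 subnn. Qed.

Lemma eq_conv a b a' b' n :
  (forall m, (m <= n)%N -> a m = a' m) -> (forall m, (m <= n)%N -> b m = b' m) ->
  conv a b n = conv a' b' n.
Proof.
move=> ha hb; apply: eq_bigr => j _; rewrite ha ?hb //; first exact: leq_subr.
by rewrite -ltnS.
Qed.

Lemma eq_pcoef p c c' n :
  (forall i m, (m <= n)%N -> c i m = c' i m) -> pcoef p c n = pcoef p c' n.
Proof.
elim: p n => [a|i|p ihp q ihq|p ihp q ihq] n h //=.
- exact: h.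
- by rewrite (ihp n) ?(ihq n).
- by apply: eq_conv => m mn; [apply: ihp|apply: ihq] => i k km; apply: h;
    apply: leq_trans mn.
Qed.

Lemma pcoef0 p c : pcoef p c 0%N = peval p (fun i => c i 0%N).
Proof. by elim: p => [a|i|p ihp q ihq|p ihp q ihq] //=; rewrite ?conv0 ihp ihq. Qed.

(* The only place where the top coefficients enter. *)
Lemma conv_ends (a b : nat -> R) n : (0 < n)%N ->
  conv a b n = a 0%N * b n + a n * b 0%N +
    \sum_(j < n.+1 | (0 < j < n)%N) a j * b (n - j)%N.
Proof.
case: n => // n _; rewrite /conv (bigD1 ord0) //= subn0.
rewrite (bigD1 ord_max) //= subnn addrA; congr (_ + _).
apply: eq_bigl => j; rewrite -!val_eqE /=; have := ltn_ord j.
by rewrite !ltnS leq_eqVlt lt0n ltnS; case: (j : nat) => //= m;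
  case: eqP => //= ->; rewrite ltnn.
Qed.

(** The coefficients of degree [n] enter the degree [n] part only linearly, through the gradient at
    the constant terms. In the recursion for an orbit leaving a zero of the field they are therefore
    the unknowns of a linear equation. *)
Lemma pcoef_trunc p c n : (0 < n)%N ->
  pcoef p c n = (\sum_j pgrad p (fun i => c i 0%N) j * c j n)
                + pcoef p (trunc_coef n c) n.
Proof.
move=> n0.
have lt p' m : (m < n)%N -> pcoef p' (trunc_coef n c) m = pcoef p' c m.
  by move=> mn; apply: eq_pcoef => i k km; rewrite /trunc_coef (leq_ltn_trans km mn).
elim: p => [a|i|p ihp q ihq|p ihp q ihq] /=.
- by rewrite big1 ?add0r // => j _; rewrite mul0r.
- rewrite /trunc_coef ltnn addr0 (bigD1 i) //= eqxx mul1r big1 ?addr0 // => j.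
  by rewrite eq_sym => /negPf ->; rewrite mul0r.
- rewrite ihp ihq addrACA; congr (_ + _); rewrite -big_split /=.
  by apply: eq_bigr => j _; rewrite mulrDl.
- rewrite !conv_ends // ihp ihq !(lt _ 0%N) //.
  rewrite (eq_bigr (fun j : 'I_n.+1 => pcoef p (trunc_coef n c) j *
                                     pcoef q (trunc_coef n c) (n - j)%N)); last first.
    move=> j /andP[j0 jn]; rewrite !lt //.
    by rewrite ltn_subrL j0.
  rewrite !pcoef0 !addrA; congr (_ + _).
  under [in RHS]eq_bigr do rewrite mulrDl mulrAC -(mulrA (peval p _)).
  rewrite big_split /= -mulr_suml -mulr_sumr; ring.
Qed.

(** The factor [(n + 1)^-2] makes these majorants stable under the Cauchy product up to a constant
    independent of [rho]; a purely geometric majorant would lose a factor [n + 1] at each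
    product. *)
Definition weight (rho : R) n : R := rho ^+ n / (n.+1)%:R ^+ 2.

Lemma weight_ge0 rho n : 0 <= rho -> 0 <= weight rho n.
Proof. by move=> h; rewrite divr_ge0 ?exprn_ge0. Qed.

Ltac nonneg := repeat first
  [ assumption | exact: normr_ge0 | exact: ler0n | exact: ler01
  | apply: weight_ge0 | apply: mulr_ge0 | apply: addr_ge0 | apply: exprn_ge0 | apply: sumr_ge0 => ? _ ].

Lemma sum_inv_sqr n : \sum_(j < n.+1) ((j.+1)%:R ^+ 2)^-1 <= 2 - (n.+1)%:R^-1 :> R.
Proof.
elim: n => [|n ih]; first by rewrite big_ord1 expr1n invr1; lra.
rewrite big_ord_recr /=.
apply: (@le_trans _ _ (2 - n.+1%:R^-1 + (n.+2%:R ^+ 2)^-1)); first by rewrite lerD2r.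
have -> : n.+2%:R = n.+1%:R + 1 :> R by rewrite -natr1.
have : 0 < n.+1%:R :> R by [].
move: (n.+1%:R : R) => a a0.
rewrite -addrA lerD2l -subr_ge0.
have -> : - (a + 1)^-1 - (- a^-1 + ((a + 1) ^+ 2)^-1) = (a * (a + 1) ^+ 2)^-1.
  by field; rewrite !lt0r_neq0 //; lra.
by rewrite invr_ge0 mulr_ge0 ?sqr_ge0 // ltW.
Qed.

(** With a = j + 1 and b = n - j + 1 one has a + b - 1 = n + 1 and (a b)^-2 <= 2 (a^-2 + b^-2) / (a
    + b - 1)^2. Each of the two resulting sums is at most 2, whence 8 = 2 (2 + 2). *)
Lemma conv_weight rho n : 0 <= rho -> conv (weight rho) (weight rho) n <= 8 * weight rho n.
Proof.
move=> r0.
have -> : conv (weight rho) (weight rho) n =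
    rho ^+ n * \sum_(j < n.+1) ((j.+1)%:R ^+ 2)^-1 * ((n - j).+1%:R ^+ 2)^-1.
  rewrite mulr_sumr; apply: eq_bigr => j _; rewrite /weight mulrACA -exprD.
  by rewrite subnKC // -ltnS.
rewrite /weight mulrCA; apply: ler_wpM2l; first exact: exprn_ge0.
have hj (j : 'I_n.+1) : ((j.+1)%:R ^+ 2)^-1 * ((n - j).+1%:R ^+ 2)^-1 <=
   2 / (n.+1%:R ^+ 2) * (((j.+1)%:R ^+ 2)^-1 + ((n - j).+1%:R ^+ 2)^-1) :> R.
  have a0 : 0 < j.+1%:R :> R by [].
  have b0 : 0 < (n - j).+1%:R :> R by [].
  have -> : n.+1%:R = j.+1%:R + (n - j).+1%:R - 1 :> R.
    apply/eqP; rewrite eq_sym subr_eq -natrD natr1; apply/eqP; congr (_%:R).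
    by have := ltn_ord j; lia.
  have a1 : 1 <= j.+1%:R :> R by rewrite ler1n.
  have b1 : 1 <= (n - j).+1%:R :> R by rewrite ler1n.
  move: a0 b0 a1 b1; move: (j.+1%:R : R) ((n - j).+1%:R : R) => a b a0 b0 a1 b1.
  have -> : (a ^+ 2)^-1 * (b ^+ 2)^-1 = (a ^+ 2 * b ^+ 2)^-1 by rewrite [RHS]invfM.
  have -> : 2 / (a + b - 1) ^+ 2 * ((a ^+ 2)^-1 + (b ^+ 2)^-1) =
    (2 * (a ^+ 2 + b ^+ 2) / (a + b - 1) ^+ 2) * (a ^+ 2 * b ^+ 2)^-1.
    by field; rewrite !lt0r_neq0 //; lra.
  rewrite ler_peMl ?invr_ge0 ?mulr_ge0 ?(ltW a0) ?(ltW b0) //.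
  rewrite ler_pdivlMr ?mul1r; last by rewrite exprn_gt0 //; lra.
  have := sqr_ge0 (a - b); nra.
apply: (le_trans (ler_sum _ (fun j _ => hj j))).
rewrite -mulr_sumr big_split /=.
have -> : \sum_(j < n.+1) ((n - j).+1%:R ^+ 2)^-1 = \sum_(j < n.+1) ((j.+1)%:R ^+ 2)^-1 :> R.
  rewrite (reindex_inj rev_ord_inj) /=; apply: eq_bigr => j _.
  by rewrite subSS subKn // -ltnS.
have := sum_inv_sqr n.
have : 0 <= n.+1%:R^-1 :> R by rewrite invr_ge0.
have : 0 <= (n.+1%:R ^+ 2)^-1 :> R by rewrite invr_ge0 sqr_ge0.
move: (\sum_(j < n.+1) _) (n.+1%:R^-1) ((n.+1%:R ^+ 2)^-1) => s u w; nra.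
Qed.

Lemma conv_weight_bound (a b : nat -> R) A B rho n : 0 <= rho -> 0 <= A -> 0 <= B ->
  (forall m, (m <= n)%N -> `|a m| <= A * weight rho m) ->
  (forall m, (m <= n)%N -> `|b m| <= B * weight rho m) ->
  `|conv a b n| <= 8 * (A * B) * weight rho n.
Proof.
move=> r0 A0 B0 ha hb.
apply: (le_trans (ler_norm_sum _ _ _)).
apply: (@le_trans _ _ (\sum_(j < n.+1) (A * B) * (weight rho j * weight rho (n - j)))).
  apply: ler_sum => j _; rewrite normrM mulrACA ler_pM ?ha ?hb ?leq_subr //.
  by rewrite -ltnS.
have -> : 8 * (A * B) * weight rho n = (A * B) * (8 * weight rho n) by ring.
by rewrite -mulr_sumr ler_wpM2l ?mulr_ge0 //; exact: conv_weight.
Qed.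

(** The constant depends on [p] and [M] only, so [rho] can be chosen after it. *)
Lemma pcoef_bound p M : 0 <= M -> exists2 C, 0 <= C & forall rho c n, 0 <= rho ->
  (forall i m, (m <= n)%N -> `|c i m| <= M * weight rho m) ->
  forall m, (m <= n)%N -> `|pcoef p c m| <= C * weight rho m.
Proof.
move=> M0; elim: p => [a|i|p [C1 C10 h1] q [C2 C20 h2]|p [C1 C10 h1] q [C2 C20 h2]].
- exists `|a| => // rho c n r0 h m mn /=; case: eqP => [->|_].
    by rewrite /weight expr0 expr1n divr1 mulr1.
  by rewrite normr0; nonneg.
- by exists M => // rho c n r0 h m mn /=; apply: h.
- exists (C1 + C2); first exact: addr_ge0.
  move=> rho c n r0 h m mn /=; rewrite mulrDl.
  apply: (le_trans (ler_normD _ _)); apply: lerD; first exact: (h1 _ _ _ r0 h).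
  exact: (h2 _ _ _ r0 h).
- exists (8 * (C1 * C2)); first by rewrite !mulr_ge0.
  move=> rho c n r0 h m mn /=; apply: conv_weight_bound => // k km.
    by apply: (h1 _ _ _ r0 h); apply: leq_trans mn.
  by apply: (h2 _ _ _ r0 h); apply: leq_trans mn.
Qed.

(* Coefficients of size [eps] and no coefficient of degree [n] in [c] leave a
   contribution of size [eps ^ 2] in degree [n]. *)
Lemma pcoef_small_bound p M : 0 <= M -> exists2 C, 0 <= C & forall rho eps c n,
  0 <= rho -> 0 <= eps <= 1 -> (0 < n)%N -> (forall i, `|c i 0%N| <= M) ->
  (forall i m, (0 < m < n)%N -> `|c i m| <= eps * weight rho m) ->
  (forall i, c i n = 0) ->
  [/\ `|pcoef p c 0%N| <= C,
      forall m, (0 < m < n)%N -> `|pcoef p c m| <= C * eps * weight rho m &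
      `|pcoef p c n| <= C * eps ^+ 2 * weight rho n].
Proof.
move=> M0; elim: p => [a|i|p [C1 C10 h1] q [C2 C20 h2]|p [C1 C10 h1] q [C2 C20 h2]].
- exists `|a| => // rho eps c n r0 /andP[e0 e1] n0 _ _ _ /=; split => //.
    move=> [|m] //= _; rewrite normr0; nonneg.
  case: n n0 => //= n _.
  by rewrite normr0; nonneg.
- exists (M + 1); first exact: addr_ge0.
  move=> rho eps c n r0 /andP[e0 e1] n0 hM h hn /=; split.
  + by apply: (le_trans (hM i)); rewrite lerDl.
  + move=> m mn; apply: (le_trans (h i m mn)).
    by rewrite ler_wpM2r ?weight_ge0 // ler_peMl // lerDr.
  + by rewrite hn normr0 !mulr_ge0 ?weight_ge0 ?exprn_ge0 // addr_ge0.
- exists (C1 + C2); first exact: addr_ge0.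
  move=> rho eps c n r0 he n0 hM h hn /=.
  have [a1 a2 a3] := h1 rho eps c n r0 he n0 hM h hn.
  have [b1 b2 b3] := h2 rho eps c n r0 he n0 hM h hn.
  by split => [|m mn|]; rewrite ?mulrDl; apply: (le_trans (ler_normD _ _));
    apply: lerD; rewrite ?a2 ?b2.
(* 10 = 1 + 1 + 8: the two end terms of the convolution, and its interior bounded by
   [conv_weight]. *)
- exists (10 * (C1 * C2)); first by rewrite !mulr_ge0.
  move=> rho eps c n r0 he n0 hM h hn /=.
  have [a1 a2 a3] := h1 rho eps c n r0 he n0 hM h hn.
  have [b1 b2 b3] := h2 rho eps c n r0 he n0 hM h hn.
  have /andP[e0 e1] := he.
  have mid m : (m <= n)%N ->
      `|\sum_(j < m.+1 | (0 < j < m)%N) pcoef p c j * pcoef q c (m - j)%N| <=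
      8 * (C1 * C2) * eps ^+ 2 * weight rho m.
    move=> mn; apply: (le_trans (ler_norm_sum _ _ _)).
    apply: (@le_trans _ _ (\sum_(j < m.+1 | (0 < j < m)%N)
        (C1 * C2 * eps ^+ 2) * (weight rho j * weight rho (m - j)))).
      apply: ler_sum => j /andP[j0 jm]; rewrite normrM.
      apply: (@le_trans _ _ ((C1 * eps * weight rho j) * (C2 * eps * weight rho (m - j)))).
        apply: ler_pM => //; [apply: a2|apply: b2].
          by rewrite j0 (leq_trans jm).
        by rewrite subn_gt0 jm (leq_trans _ mn) // ltn_subrL j0 (leq_trans j0) // ltnW.
      by eqle.
    rewrite -mulr_sumr.
    apply: (@le_trans _ _ ((C1 * C2 * eps ^+ 2) * (8 * weight rho m))).
      rewrite ler_wpM2l ?mulr_ge0 ?exprn_ge0 //.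
      apply: le_trans (conv_weight m r0); rewrite /conv [leRHS](bigID (fun j : 'I_m.+1 => (0 < j < m)%N)) /=.
      by rewrite lerDl sumr_ge0 // => j _; rewrite mulr_ge0 ?weight_ge0.
    by eqle.
  split.
  + rewrite conv0 normrM (le_trans (ler_pM _ _ a1 b1)) //.
    by rewrite ler_peMl ?mulr_ge0 // ler1n.
  + move=> m mn; rewrite conv_ends; last by case/andP: mn.
    apply: (@le_trans _ _ (C1 * (C2 * eps * weight rho m) + (C1 * eps * weight rho m) * C2
              + 8 * (C1 * C2) * eps ^+ 2 * weight rho m)).
      apply: (le_trans (ler_normD _ _)); apply: lerD; last first.
        by apply: mid; case/andP: mn => _ /ltnW.
      apply: (le_trans (ler_normD _ _)).
      by apply: lerD; rewrite normrM ler_pM // ?a2 ?b2.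
    have : 0 <= C1 * C2 * weight rho m by nonneg.
    move: (weight rho m) => w w0.
    have : (C1 * C2 * w) * eps ^+ 2 <= (C1 * C2 * w) * eps.
      by rewrite ler_wpM2l // expr2 ler_piMl.
    lra.
  + rewrite conv_ends //.
    apply: (@le_trans _ _ (C1 * (C2 * eps ^+ 2 * weight rho n) + (C1 * eps ^+ 2 * weight rho n) * C2
              + 8 * (C1 * C2) * eps ^+ 2 * weight rho n)).
      apply: (le_trans (ler_normD _ _)); apply: lerD; last exact: mid.
      apply: (le_trans (ler_normD _ _)).
      by apply: lerD; rewrite normrM ler_pM.
    by eqle.
Qed.

Lemma coef_recursion (G : nat -> ('I_d -> nat -> R) -> 'I_d -> R) (y : 'I_d -> R) :
  (forall n c c', (forall i m, (m <= n)%N -> c i m = c' i m) -> G n c =1 G n c') ->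
  exists c, (forall i, c i 0%N = y i) /\ forall n i, c i n.+1 = G n c i.
Proof.
move=> hG.
(* [cs n] is correct in degrees at most [n] and meaningless above; the sequence sought is the
   diagonal, which later stages leave unchanged by [st]. *)
pose cs := fix cs n := if n is n'.+1 then
   (fun i m => if m == n then G n' (cs n') i else cs n' i m)
   else (fun i m => y i).
have st n m i : (m <= n)%N -> cs n i m = cs m i m.
  elim: n => [|n ih]; first by rewrite leqn0 => /eqP ->.
  rewrite leq_eqVlt => /orP[/eqP -> //|]; rewrite ltnS => mn /=.
  by rewrite ifN ?ih // neq_ltn ltnS mn.
exists (fun i m => cs m i m); split=> // n i /=; rewrite eqxx.
by apply: hG => j m mn; apply: st.
Qed.

End PolynomialExpressions.

Lemma cvg0_le (R : realType) (T : Type) (F : set_system T) {FF : Filter F} (f g : T -> R) :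
  (\near F, `|f F| <= g F) -> g x @[x --> F] --> 0 -> f x @[x --> F] --> 0.
Proof.
move=> h /cvgr0Pnorm_le hg; apply/cvgr0Pnorm_le => e e0.
by apply: filterS2 h (hg e e0) => x h1 h2; apply: le_trans h1 (le_trans (ler_norm _) h2).
Qed.

(** * Convergence, derivation and products of power series with geometric majorants *)

Section PowerSeries.
Variable R : realType.
Implicit Types (a b c : nat -> R) (M rho t : R).

Definition geo_bound M rho c := forall n, `|c n| <= M * rho ^+ n.

Lemma geo_bound_ge0 M rho c : geo_bound M rho c -> 0 <= M.
Proof. by move=> /(_ 0%N); rewrite expr0 mulr1; apply: le_trans. Qed.

(** Derivation introduces the factor n + 1 <= 2^n, which doubling the rate absorbs. *)
Lemma geo_bound_diffs M rho c : 0 <= rho -> geo_bound M rho c ->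
  geo_bound (M * rho) (2 * rho) (pseries_diffs c).
Proof.
move=> r0 h n; rewrite /pseries_diffs normrM normr_nat.
have M0 := geo_bound_ge0 h.
apply: (@le_trans _ _ (2 ^+ n * (M * rho ^+ n.+1))).
  by apply: ler_pM => //; rewrite -natrX ler_nat ltn_expl.
by rewrite exprMn exprS; eqle.
Qed.

Lemma geo_bound_shift M rho c : geo_bound M rho c ->
  geo_bound (M * rho) rho (fun n => c n.+1).
Proof. by move=> h n; rewrite -mulrA -exprS; apply: h. Qed.

Lemma weight_le rho n : 0 <= rho -> weight rho n <= rho ^+ n.
Proof.
move=> r0; rewrite /weight ler_pdivrMr ?exprn_gt0 //.
by rewrite ler_peMr ?exprn_ge0 // exprn_ege1 // ler1n.
Qed.

Lemma weight_geo_bound M rho c : 0 <= rho -> 0 <= M ->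
  (forall n, `|c n| <= M * weight rho n) -> geo_bound M rho c.
Proof. by move=> r0 M0 h n; apply: (le_trans (h n)); rewrite ler_wpM2l ?weight_le. Qed.

Lemma half_sum_le M n : 0 <= M -> \sum_(0 <= k < n) M * (2^-1) ^+ k <= 2 * M.
Proof.
move=> M0.
have -> : \sum_(0 <= k < n) M * (2^-1) ^+ k = 2 * M - 2 * M * (2^-1) ^+ n.
  elim: n => [|n ih]; first by rewrite big_nil expr0 mulr1 subrr.
  by rewrite big_nat_recr //= ih exprS; field.
by rewrite gerBl !mulr_ge0 // exprn_ge0.
Qed.

Lemma geo_bound_term M rho c t n : 0 <= rho -> rho * `|t| <= 2^-1 -> geo_bound M rho c ->
  `|c n * t ^+ n| <= M * (2^-1) ^+ n.
Proof.
move=> r0 rt h; rewrite normrM normrX.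
apply: (@le_trans _ _ (M * rho ^+ n * `|t| ^+ n)); first by rewrite ler_wpM2r ?exprn_ge0.
rewrite -mulrA -exprMn ler_wpM2l ?(geo_bound_ge0 h) //.
by rewrite lerXn2r // nnegrE ?mulr_ge0.
Qed.

Lemma cvg_pseries_geo M rho c t : 0 <= rho -> rho * `|t| <= 2^-1 -> geo_bound M rho c ->
  cvgn (pseries c t).
Proof.
move=> r0 rt h; apply: normed_cvg.
apply: (@series_le_cvg _ _ (geometric M 2^-1)) => [n|n|n|] //=.
- by rewrite mulr_ge0 ?exprn_ge0 ?(geo_bound_ge0 h).
- exact: (geo_bound_term n r0 rt h).
- by apply: is_cvg_geometric_series; rewrite ger0_norm // invf_lt1 // ltr1n.
Qed.

Definition psum c t : R := limn (pseries c t).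

Lemma psum_bound M rho c t : 0 <= rho -> rho * `|t| <= 2^-1 -> geo_bound M rho c ->
  `|psum c t| <= 2 * M.
Proof.
move=> r0 rt h; have cv := cvg_pseries_geo r0 rt h.
rewrite /psum -lim_norm //; apply: limr_le; first exact: is_cvg_norm.
near=> n; apply: (le_trans (ler_norm_sum _ _ _)).
apply: le_trans (half_sum_le n (geo_bound_ge0 h)).
by apply: ler_sum => i _; apply: geo_bound_term h.
Unshelve. all: by end_near. Qed.

Lemma psum_shift M rho c t : 0 <= rho -> rho * `|t| <= 2^-1 -> geo_bound M rho c ->
  psum c t = c 0%N + t * psum (fun n => c n.+1) t.
Proof.
move=> r0 rt h; have cv := cvg_pseries_geo r0 rt h.
have cv' := cvg_pseries_geo r0 rt (geo_bound_shift h).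
rewrite {1}/psum; apply/cvg_lim => //; rewrite -cvg_shiftS.
have -> : [sequence pseries c t n.+1]_n =
    (fun n => c 0%N + t * pseries (fun n => c n.+1) t n).
  apply/funext => n; rewrite /pseries /series /= big_nat_recl // expr0 mulr1.
  congr (_ + _); rewrite mulr_sumr; apply: eq_bigr => i _.
  by rewrite exprS mulrCA.
by apply: cvgD; [exact: cvg_cst|apply: cvgM => //; exact: cvg_cst].
Qed.

Lemma psum_at0 c : psum c 0 = c 0%N.
Proof.
apply/cvg_lim => //; rewrite -cvg_shiftS; apply: (@cvg_near_cst _ _ (c 0%N)).
apply: nearW => n; rewrite /pseries /series /= big_nat_recl // expr0 mulr1 big1 ?addr0 // => i _.
by rewrite expr0n mulr0.
Qed.

(** Termwise derivation asks for convergence of the twice derived series at some [K] beyond [|t|].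
    Two derivations multiply the rate by 4, and [K = 1 / (8 rho)] leaves the ratio 1/2. *)
Lemma psum_is_derive M rho c t : 0 < rho -> rho * `|t| < 8^-1 -> geo_bound M rho c ->
  is_derive t (1 : R) (psum c) (psum (pseries_diffs c) t).
Proof.
move=> r0 rt h; have r0' := ltW r0.
have b1 := geo_bound_diffs r0' h.
have b2 := geo_bound_diffs (mulr_ge0 (ler0n _ 2) r0') b1.
pose K := (8 * rho)^-1.
have K0 : 0 < K by rewrite invr_gt0 mulr_gt0.
apply: (@pseries_snd_diffs _ c K) => //.
- apply: cvg_pseries_geo h => //; rewrite (gtr0_norm K0) /K invfM mulrCA divff ?gt_eqF //; lra.
- apply: cvg_pseries_geo b1; first by rewrite mulr_ge0.
  by rewrite (gtr0_norm K0) /K invfM mulrCA -mulrA divff ?gt_eqF //; lra.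
- apply: cvg_pseries_geo b2; first by rewrite !mulr_ge0.
  by rewrite (gtr0_norm K0) /K invfM mulrCA -!mulrA divff ?gt_eqF //; lra.
- by rewrite (gtr0_norm K0) /K invfM ltr_pdivlMr // mulrC.
Qed.

(** Viewing partial sums as values at 1 of polynomials, the difference collects the coefficients of
    degrees from n to 2n - 1 of their product. These are n terms of size at most 8 A B / (n +
    1)^2. *)
Lemma series_conv a b A B r : 0 <= r <= 1 ->
  (forall n, `|a n| <= A * weight r n) -> (forall n, `|b n| <= B * weight r n) ->
  (fun n => series a n * series b n - series (conv a b) n) @ \oo --> 0.
Proof.
move=> /andP[r0 r1] ha hb.
have w0 : weight r 0 = 1 by rewrite /weight expr0 expr1n divr1.
have A0 : 0 <= A by have := ha 0%N; rewrite w0 mulr1; apply: le_trans.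
have B0 : 0 <= B by have := hb 0%N; rewrite w0 mulr1; apply: le_trans.
suff bd n : `|series a n * series b n - series (conv a b) n| <= 8 * (A * B) * harmonic n.
  apply: (@cvg0_le _ _ _ _ _ (fun n => 8 * (A * B) * harmonic n)); first exact: nearW.
  rewrite -[X in _ --> X](mulr0 (8 * (A * B))).
  by apply: cvgM; [exact: cvg_cst|exact: cvg_harmonic].
pose P := \poly_(i < n) a i; pose Q := \poly_(i < n) b i.
have ev (u : nat -> R) : series u n = (\poly_(i < n) u i).[1].
  rewrite horner_poly /series /= big_mkord; apply: eq_bigr => i _.
  by rewrite expr1n mulr1.
have PQ m : (P * Q)`_m = conv (fun i => P`_i) (fun i => Q`_i) m by rewrite coefM.
have -> : series a n * series b n = \sum_(0 <= m < n + n) (P * Q)`_m.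
  rewrite !ev -hornerM (@horner_coef_wide _ (n + n)).
    by rewrite big_mkord; apply: eq_bigr => i _; rewrite expr1n mulr1.
  apply: (leq_trans (size_polyMleq _ _)); apply: (leq_trans (leq_pred _)).
  by apply: leq_add; apply: size_poly.
rewrite (big_cat_nat (leq0n n) (leq_addr n n)) /=.
have -> : \sum_(0 <= m < n) (P * Q)`_m = series (conv a b) n.
  apply: eq_big_nat => m /= mn; rewrite PQ; apply: eq_conv => k km;
    by rewrite coef_poly (leq_ltn_trans km mn).
rewrite addrAC subrr add0r.
apply: (le_trans (ler_norm_sum _ _ _)).
apply: (@le_trans _ _ (\sum_(n <= m < n + n) 8 * (A * B) * (n.+1%:R ^+ 2)^-1)).
  apply: ler_sum_nat => m /andP[nm _]; rewrite PQ.
  have tr (u : nat -> R) U k : 0 <= U -> (forall n, `|u n| <= U * weight r n) ->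
      `|(\poly_(i < n) u i)`_k| <= U * weight r k.
    move=> U0 hu; rewrite coef_poly; case: ifP => // _.
    by rewrite normr0 mulr_ge0 // weight_ge0.
  apply: (le_trans (conv_weight_bound r0 A0 B0 (fun k _ => tr _ _ _ A0 ha)
     (fun k _ => tr _ _ _ B0 hb))).
  rewrite ler_wpM2l ?mulr_ge0 // /weight.
  apply: (@le_trans _ _ ((m.+1%:R ^+ 2)^-1)).
    by rewrite ler_piMl ?invr_ge0 ?exprn_ge0 ?exprn_ile1.
  by rewrite lef_pV2 ?posrE ?exprn_gt0 // lerXn2r ?nnegrE // ler_nat.
rewrite sumr_const_nat addnK -mulrnAr ler_wpM2l ?mulr_ge0 // -mulr_natr.
rewrite /harmonic /= expr2 invfM -mulrA ler_piMr ?invr_ge0 //.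
by rewrite ler_pdivrMl // mulr1 ler_nat.
Qed.

Lemma psum_conv A B a b rho t : 0 <= rho -> rho * `|t| <= 2^-1 ->
  0 <= A -> 0 <= B ->
  (forall n, `|a n| <= A * weight rho n) -> (forall n, `|b n| <= B * weight rho n) ->
  psum (conv a b) t = psum a t * psum b t.
Proof.
move=> r0 rt A0 B0 ha hb.
have ca := cvg_pseries_geo r0 rt (weight_geo_bound r0 A0 ha).
have cb := cvg_pseries_geo r0 rt (weight_geo_bound r0 B0 hb).
have wt (u : nat -> R) U n : (forall n, `|u n| <= U * weight rho n) ->
    `|u n * t ^+ n| <= U * weight (rho * `|t|) n.
  move=> hu; rewrite normrM normrX /weight exprMn mulrAC mulrA ler_wpM2r ?exprn_ge0 //.
have e : pseries (conv a b) t = series (conv (fun i => a i * t ^+ i) (fun i => b i * t ^+ i)).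
  apply/funext => n; apply: eq_bigr => m _ /=; rewrite /conv mulr_suml.
  apply: eq_bigr => j _; rewrite mulrACA -exprD subnKC // -ltnS.
  exact: ltn_ord.
have r1 : 0 <= rho * `|t| <= 1 by rewrite mulr_ge0 //=; lra.
have d := series_conv r1 (fun n => wt _ _ n ha) (fun n => wt _ _ n hb).
apply/cvg_lim => //; rewrite e.
have -> : series (conv (fun i => a i * t ^+ i) (fun i => b i * t ^+ i)) =
  (fun n => pseries a t n * pseries b t n - (pseries a t n * pseries b t n -
   series (conv (fun i => a i * t ^+ i) (fun i => b i * t ^+ i)) n)).
  by apply/funext => n; rewrite opprB addrC subrK.
rewrite -[X in _ --> X]subr0; apply: cvgB => //.
by apply: cvgM.
Qed.

Variable d : nat.

Lemma peval_psum (p : pexp R d) (c : 'I_d -> nat -> R) M rho t :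
  0 <= rho -> rho * `|t| <= 2^-1 -> 0 <= M ->
  (forall i n, `|c i n| <= M * weight rho n) ->
  psum (pcoef p c) t = peval p (fun i => psum (c i) t).
Proof.
move=> r0 rt M0 h.
have bd (q : pexp R d) : exists2 C, 0 <= C & forall n, `|pcoef q c n| <= C * weight rho n.
  have [C C0 hC] := pcoef_bound q M0; exists C => // n.
  by apply: (hC rho c n) => // i m _; apply: h.
elim: p => [a|i|p ihp q ihq|p ihp q ihq] //=.
- transitivity (psum (fun n => if n == 0%N then a else 0) 0); last exact: psum_at0.
  rewrite /psum; congr (lim (_ @ \oo)); apply/funext => n.
  apply: eq_bigr => m _ /=; case: eqP => [->|_]; first by rewrite !expr0.
  by rewrite !mul0r.
- have [C C0 hC] := bd p; have [D D0 hD] := bd q.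
  have cp := cvg_pseries_geo r0 rt (weight_geo_bound r0 C0 hC).
  have cq := cvg_pseries_geo r0 rt (weight_geo_bound r0 D0 hD).
  rewrite -ihp -ihq; apply/cvg_lim => //.
  have -> : pseries (fun n => pcoef p c n + pcoef q c n) t =
            (fun n => pseries (pcoef p c) t n + pseries (pcoef q c) t n).
    apply/funext => n; rewrite /pseries /series /= -big_split.
    by apply: eq_bigr => m _ /=; rewrite mulrDl.
  exact: cvgD.
- have [C C0 hC] := bd p; have [D D0 hD] := bd q.
  by rewrite -ihp -ihq (psum_conv r0 rt C0 D0 hC hD).
Qed.

End PowerSeries.

(** * Local solutions and orbits leaving an equilibrium of a polynomial field *)

Section PolynomialFlows.
Variables (R : realType) (d : nat) (f : 'I_d -> pexp R d).
Implicit Types (y : 'I_d -> R) (phi : R -> 'I_d -> R) (M : R).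

Definition solves_at phi t := forall i,
  is_derive t (1 : R) (fun s => phi s i) (peval (f i) (phi t)).

Lemma is_derive_ext (g h : R -> R) t (l l' : R) :
  (forall s, g s = h s) -> l = l' -> is_derive t (1 : R) g l -> is_derive t (1 : R) h l'.
Proof. by move=> gh -> dg; have -> : h = g by apply/funext => s. Qed.

(** The time [h] is uniform over initial values bounded by [M], so that solutions can be continued
    by steps of fixed length. *)
Lemma poly_ode_local M : 0 < M -> exists2 h, 0 < h & forall y, (forall i, `|y i| <= M) ->
  exists phi, phi 0 = y /\ forall t, `|t| < h -> solves_at phi t.
Proof.
move=> M0.
have /fin_all_exists [C hC] i : exists C, 0 <= C /\ forall rho c n, 0 <= rho ->
  (forall i m, (m <= n)%N -> `|c i m| <= M * weight rho m) ->
  forall m, (m <= n)%N -> `|pcoef (f i) c m| <= C * weight rho m.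
  by have [C C0 hC] := pcoef_bound (f i) (ltW M0); exists C.
pose D := \sum_i C i.
have D0 : 0 <= D by apply: sumr_ge0 => i _; case: (hC i).
have CD i : C i <= D.
  by rewrite /D (bigD1 i) //= lerDl sumr_ge0 // => j _; case: (hC j).
(* This gives [rho * M = 4 * D + M]. The 4 pays for passing from the weight of degree n to that of
   degree n + 1, as (u + 1)^2 <= 4 u^3 for u = n + 1. *)
pose rho := 4 * D / M + 1.
have rM : rho * M = 4 * D + M by rewrite mulrDl mul1r divfK // gt_eqF.
have r0 : 0 < rho by rewrite ltr_wpDl // divr_ge0 ?mulr_ge0 // ltW.
exists (8 * rho)^-1; first by rewrite invr_gt0 mulr_gt0.
move=> y hy.
have [|c [c0 cS]] := @coef_recursion R d (fun n c i => pcoef (f i) c n / n.+1%:R) y.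
  by move=> n c c' h i; congr (_ / _); apply: eq_pcoef.
have bd n i m : (m <= n)%N -> `|c i m| <= M * weight rho m.
  elim: n i m => [|n ih] i m.
    by rewrite leqn0 => /eqP ->; rewrite c0 /weight expr0 expr1n divr1 mulr1.
  rewrite leq_eqVlt ltnS => /orP[/eqP ->|]; last exact: ih.
  have /(_ n (leqnn n)) b := (hC i).2 rho c n (ltW r0) ih.
  rewrite cS normrM normfV normr_nat ler_pdivrMr //.
  apply: (le_trans b); apply: (@le_trans _ _ (D * weight rho n)).
    by rewrite ler_wpM2r // weight_ge0 // ltW.
  have w0 : 0 <= rho ^+ n by rewrite exprn_ge0 // ltW.
  have -> : M * weight rho n.+1 * n.+1%:R =
    (4 * D + M) * rho ^+ n * (n.+1%:R / n.+2%:R ^+ 2).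
    by rewrite -rM /weight exprS; ring.
  rewrite /weight mulrA.
  have u0 : 0 < n.+1%:R :> R by [].
  have u1 : 1 <= n.+1%:R :> R by rewrite ler1n.
  have -> : n.+2%:R = n.+1%:R + 1 :> R by rewrite natr1.
  move: u0 u1; move: (n.+1%:R : R) => u u0 u1.
  apply: (@le_trans _ _ (4 * D * rho ^+ n * (u / (u + 1) ^+ 2))); last first.
    rewrite ler_wpM2r ?divr_ge0 ?exprn_ge0 ?addr_ge0 ?(ltW u0) // ler_wpM2r //.
    by rewrite lerDl ltW.
  have key : (u ^+ 2)^-1 <= 4 * (u / (u + 1) ^+ 2).
    rewrite mulrA ler_pdivlMr ?exprn_gt0 ?addr_gt0 // mulrC ler_pdivrMr ?exprn_gt0 //.
    have : 0 <= u ^+ 2 * (u - 1) by rewrite mulr_ge0 ?sqr_ge0 // subr_ge0.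
    have : 0 <= u * (u - 1) by rewrite mulr_ge0 ?subr_ge0 // ltW.
    nra.
  have -> : 4 * D * rho ^+ n * (u / (u + 1) ^+ 2) = D * rho ^+ n * (4 * (u / (u + 1) ^+ 2)) by ring.
  by rewrite ler_wpM2l ?mulr_ge0.
have hc i n : `|c i n| <= M * weight rho n by apply: (bd n).
have gb i : geo_bound M rho (c i) := weight_geo_bound (ltW r0) (ltW M0) (hc i).
exists (fun t i => psum (c i) t); split.
  by apply/funext => i; rewrite psum_at0.
move=> t ht i.
have rt : rho * `|t| < 8^-1 by move: ht; rewrite invfM ltr_pdivlMr // mulrC.
have rt2 : rho * `|t| <= 2^-1 by lra.
apply: is_derive_ext (psum_is_derive r0 rt (gb i)) => //.
rewrite -(peval_psum _ (ltW r0) rt2 (ltW M0) hc); congr (psum _ t).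
apply/funext => n; rewrite /pseries_diffs cS mulrC divfK //.
Qed.

(* A power series in [expR (nu * t)], whose coefficients solve linear equations
   with operators [n * nu - L], L being the linearisation. *)
Lemma poly_ode_unstable (x b : 'I_d -> R) (nu K : R) : 0 < nu -> 0 <= K ->
  (forall i, peval (f i) x = 0) ->
  (forall i, \sum_j pgrad (f i) x j * b j = nu * b i) ->
  (forall n (g : 'I_d -> R) B, (2 <= n)%N -> (forall i, `|g i| <= B) ->
    exists u : 'I_d -> R, forall i,
      n%:R * nu * u i - \sum_j pgrad (f i) x j * u j = g i /\ `|u i| <= K * B) ->
  exists phi T M, (forall t, t < T -> solves_at phi t) /\
    forall t i, t < T -> `|phi t i - x i - expR (nu * t) * b i| <= M * expR (nu * t) ^+ 2.
Proof.
move=> nu0 K0 fx Lb inv.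
pose Mx := \sum_i `|x i|.
have Mx0 : 0 <= Mx by apply: sumr_ge0.
have xM i : `|x i| <= Mx by rewrite /Mx (bigD1 i) //= lerDl sumr_ge0.
have /fin_all_exists [C hC] i : exists C, 0 <= C /\ forall rho eps (c : 'I_d -> nat -> R) n,
  0 <= rho -> 0 <= eps <= 1 -> (0 < n)%N -> (forall i, `|c i 0%N| <= Mx) ->
  (forall i m, (0 < m < n)%N -> `|c i m| <= eps * weight rho m) ->
  (forall i, c i n = 0) -> `|pcoef (f i) c n| <= C * eps ^+ 2 * weight rho n.
  have [C C0 hC] := pcoef_small_bound (f i) Mx0; exists C; split=> // rho eps c n h1 h2 h3 h4 h5 h6.
  by have [] := hC rho eps c n h1 h2 h3 h4 h5 h6.
pose D := \sum_i C i.
have D0 : 0 <= D by apply: sumr_ge0 => i _; case: (hC i).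
have CD i : C i <= D.
  by rewrite /D (bigD1 i) //= lerDl sumr_ge0 // => j _; case: (hC j).
(* Small enough for [K * D * eps <= 1]: a solution operator of norm [K] applied to a quadratic
   remainder [D * eps ^+ 2] then returns at most [eps], which closes the induction [bd]. *)
pose eps := (K * D + 1)^-1.
have KD0 : 0 <= K * D by rewrite mulr_ge0.
have eps0 : 0 < eps by rewrite invr_gt0; lra.
have eps1 : eps <= 1 by rewrite invf_le1; lra.
have epsE : K * D * eps + eps = 1.
  by rewrite /eps -[X in _ + X]mul1r -mulrDl divff // gt_eqF //; lra.
(* Large enough for the eigenvector [b] to satisfy the bound in degree 1, where the weight is
   [rho / 4]. *)
pose rho := 4 * (\sum_i `|b i|) / eps + 1.
have B0 : 0 <= \sum_i `|b i| by apply: sumr_ge0.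
have r0 : 0 < rho by rewrite ltr_wpDl // divr_ge0 ?mulr_ge0 // ltW.
have bM i : `|b i| <= eps * weight rho 1.
  have rE : eps * rho = 4 * (\sum_i `|b i|) + eps.
    by rewrite /rho mulrDr mulr1 mulrC divfK // gt_eqF.
  rewrite /weight expr1 mulrA rE ler_pdivlMr ?exprn_gt0 //.
  have : `|b i| <= \sum_i `|b i| by rewrite (bigD1 i) //= lerDl sumr_ge0.
  move: (`|b i|) (\sum_i `|b i|) => u v; lra.
(* The solution has to be selected before a bound is known. The one provided for the maximum of the
   [|g i|] satisfies the estimate for every bound. *)
have /choice [U hU] : forall p : nat * ('I_d -> R), exists u : 'I_d -> R,
   (2 <= p.1)%N -> forall B, (forall i, `|p.2 i| <= B) -> forall i,
     p.1%:R * nu * u i - \sum_j pgrad (f i) x j * u j = p.2 i /\ `|u i| <= K * B.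
  move=> [n g] /=; have [n2|] := leqP 2 n; last by exists x.
  pose B := \big[Num.max/0]_i `|g i|.
  have gB i : `|g i| <= B by apply: le_bigmax.
  have [u hu] := inv n g B n2 gB; exists u => _ B' gB' i.
  split; first by case: (hu i).
  have [_ /le_trans] := hu i; apply; rewrite ler_wpM2l // /B.
  by apply: bigmax_le => //; apply: le_trans (gB' i); rewrite normr_ge0.
(* [G n] produces degree [n + 1]: degree 1 is the prescribed eigenvector, and the linear equation is
   solved only from degree 2 on. *)
pose G n c := if n is n'.+1 then U (n'.+2, fun i => pcoef (f i) (trunc_coef n'.+2 c) n'.+2) else b.
have [|c [c0 cS]] := @coef_recursion R d G x.
  move=> [|n] c c' h i //=; congr (U (_, _) _); apply/funext => j; apply: eq_pcoef => k m mn.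
  by rewrite /trunc_coef; case: ifP => // mn'; apply: h.
have c0E : (fun i => c i 0%N) = x by apply/funext => i.
have tr0 n : forall i : 'I_d, trunc_coef n.+1 c i n.+1 = 0 by move=> i; rewrite /trunc_coef ltnn.
have trM n : forall i : 'I_d, `|trunc_coef n.+1 c i 0%N| <= Mx by move=> i; rewrite /trunc_coef c0; exact: xM.
have epsb : 0 <= eps <= 1 by rewrite ltW.
have bd n i m : (0 < m <= n)%N -> `|c i m| <= eps * weight rho m.
  elim: n i m => [|n ih] i m; first by case: m.
  rewrite [(m <= _)%N]leq_eqVlt ltnS => /andP[m0 /orP[/eqP e|mn]]; last by apply: ih; rewrite m0.
  rewrite e cS; case: n ih e => [|n] ih e; first exact: bM.
  have gb j : `|pcoef (f j) (trunc_coef n.+2 c) n.+2| <= D * eps ^+ 2 * weight rho n.+2.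
    apply: (le_trans ((hC j).2 rho eps (trunc_coef n.+2 c) n.+2 (ltW r0) epsb isT (trM _) _ (tr0 _))).
      move=> k l /andP[l0 ln]; rewrite /trunc_coef ln; apply: ih; rewrite l0 -ltnS //.
    by rewrite ler_wpM2r ?weight_ge0 ?(ltW r0) // ler_wpM2r ?sqr_ge0.
  have [_ hb] := hU (n.+2, fun i => pcoef (f i) (trunc_coef n.+2 c) n.+2) isT _ gb i.
  apply: (le_trans hb); rewrite mulrA ler_wpM2r ?weight_ge0 ?(ltW r0) //.
  have -> : K * (D * eps ^+ 2) = K * D * eps * eps by ring.
  by rewrite ler_piMl ?(ltW eps0) // -epsE lerDl ltW.
pose M := Mx + 1.
have M0 : 0 <= M by rewrite addr_ge0.
have hc i n : `|c i n| <= M * weight rho n.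
  case: n => [|n].
    by rewrite c0 /weight expr0 expr1n divr1 mulr1 (le_trans (xM i)) // lerDl.
  apply: (le_trans (bd n.+1 i n.+1 _)); first by rewrite leqnn.
  by rewrite ler_wpM2r ?weight_ge0 ?(ltW r0) // (le_trans eps1) // lerDr.
have gb i : geo_bound M rho (c i) := weight_geo_bound (ltW r0) M0 (hc i).
(* The differential equation degree by degree: time derivation multiplies [expR (nu * t) ^+ n] by
   [n * nu]. *)
have coefE i n : pcoef (f i) c n = nu * (n%:R * c i n).
  case: n => [|n]; first by rewrite pcoef0 c0E fx mul0r mulr0.
  rewrite pcoef_trunc // c0E; case: n => [|n].
    rewrite [X in _ + X](_ : _ = 0) ?addr0.
      transitivity (nu * b i); last by rewrite mul1r cS.
      by rewrite -Lb; apply: eq_bigr => j _; rewrite cS.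
    (* Truncated below degree 1 the series is constant, so the quadratic estimate applies with
       [eps = 0] and the remainder vanishes. *)
    apply/eqP; rewrite -normr_le0.
    apply: (le_trans ((hC i).2 rho 0 (trunc_coef 1 c) 1%N (ltW r0) _ isT (trM _) _ (tr0 _))).
    - by rewrite lexx ler01.
    - by move=> k [|l].
    - by rewrite expr0n mulr0 mul0r.
  have gbb j : `|pcoef (f j) (trunc_coef n.+2 c) n.+2| <=
      \sum_j `|pcoef (f j) (trunc_coef n.+2 c) n.+2|.
    by rewrite (bigD1 j) //= lerDl sumr_ge0.
  have [hb _] := hU (n.+2, fun i => pcoef (f i) (trunc_coef n.+2 c) n.+2) isT _ gbb i.
  move: hb => /= <-; rewrite !cS [G n.+1 c]/=.
  under eq_bigr do rewrite cS [G n.+1 c]/=.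
  by rewrite addrC subrK mulrA [_ * nu]mulrC.
pose s t := expR (nu * t).
(* Before time [T] the argument [expR (nu * t)] stays below [1 / (8 * rho)], where [psum_is_derive]
   applies. *)
pose T := ln (8 * rho)^-1 / nu.
have sT t : t < T -> rho * `|s t| < 8^-1.
  rewrite ltr_pdivlMr // mulrC -ltr_expR lnK ?posrE ?invr_gt0 ?mulr_gt0 // -/(s t).
  by rewrite ger0_norm ?expR_ge0 // invfM ltr_pdivlMr // mulrC.
exists (fun t i => psum (c i) (s t)), T, (2 * (M * rho * rho)); split.
  move=> t /sT rt i; have rt2 : rho * `|s t| <= 2^-1 by lra.
  have ds : is_derive t (1 : R) s (nu * s t).
    have d1 : is_derive t (1 : R) ( *%R nu) nu.
      by apply: is_derive_ext (is_deriveZ nu (is_derive_id t (1 : R))) => //; rewrite /= scaler1.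
    by rewrite mulrC; exact: (is_derive1_comp (is_derive_expR (nu * t)) d1).
  apply: is_derive_ext (is_derive1_comp (psum_is_derive r0 rt (gb i)) ds) => //.
  rewrite -(peval_psum _ (ltW r0) rt2 M0 hc).
  have [C' C'0 hC'] := pcoef_bound (f i) M0.
  have pb n : `|pcoef (f i) c n| <= C' * weight rho n.
    by apply: (hC' rho c n (ltW r0)) => // j m _; apply: hc.
  rewrite (psum_shift (ltW r0) rt2 (weight_geo_bound (ltW r0) C'0 pb)).
  rewrite pcoef0 c0E fx add0r.
  suff -> : psum (fun n => pcoef (f i) c n.+1) (s t) = nu * psum (pseries_diffs (c i)) (s t).
    by rewrite mulrA mulrC [_ * nu]mulrC.
  apply/cvg_lim => //.
  have -> : pseries (fun n => pcoef (f i) c n.+1) (s t) =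
     (fun n => nu * pseries (pseries_diffs (c i)) (s t) n).
    apply/funext => n; rewrite /pseries /series /= mulr_sumr.
    by apply: eq_bigr => m _; rewrite coefE /pseries_diffs !mulrA.
  apply: cvgM; first exact: cvg_cst.
  apply: (cvg_pseries_geo _ _ (geo_bound_diffs (ltW r0) (gb i))).
    by rewrite mulr_ge0 // ltW.
  by rewrite -mulrA; lra.
move=> t i /sT rt; have rt2 : rho * `|s t| <= 2^-1 by lra.
rewrite -/(s t) (psum_shift (ltW r0) rt2 (gb i)) (psum_shift (ltW r0) rt2 (geo_bound_shift (gb i))).
rewrite c0 cS /= mulrDr addrA.
set P := psum _ _.
have -> : x i + s t * b i + s t * (s t * P) - x i - s t * b i = s t ^+ 2 * P by ring.
rewrite normrM (ger0_norm (sqr_ge0 _)) [leLHS]mulrC; apply: ler_wpM2r; first exact: sqr_ge0.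
exact: psum_bound (ltW r0) rt2 (geo_bound_shift (geo_bound_shift (gb i))).
Qed.

End PolynomialFlows.

(** * Monotonicity, Gronwall estimates and limits at infinity *)

Section RealDerivatives.
Variable R : realType.
Implicit Types (g h f : R -> R) (a b t s l K : R).

Lemma scale_mul (x y : R) : x *: (y : R^o) = x * y.
Proof. by []. Qed.

Lemma is_derive_cvgE g s l : is_derive s (1 : R) g l <->
  (fun k => k^-1 *: (g (k + s) - g s)) @ 0^' --> l.
Proof.
have e : (fun k => k^-1 *: (g (k + s) - g s)) =
         (fun k => k^-1 *: ((g \o shift s) (k *: (1 : R)) - g s)).
  by apply/funext => k; rewrite /= -[k *: 1]/(k * 1) mulr1.
rewrite e; split => [[dg <-]|h]; first exact: dg.
by constructor; [apply/cvg_ex; exists l|apply/cvg_lim].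
Qed.

Lemma is_derive_glue g h s l : g s = h s ->
  is_derive s (1 : R) g l -> is_derive s (1 : R) h l ->
  is_derive s (1 : R) (fun t => if t <= s then g t else h t) l.
Proof.
move=> gh /is_derive_cvgE dg /is_derive_cvgE dh; apply/is_derive_cvgE => A nA.
apply: (@filterS2 _ (0^' : set_system R) _ _ _ _ _ (dg A nA) (dh A nA)) => k /= Ag Ah.
by rewrite lexx; case: ifP => _ //; rewrite gh.
Qed.

Lemma is_derive_near g h s l : (\near s, g s = h s) -> is_derive s (1 : R) g l ->
  is_derive s (1 : R) h l.
Proof. exact: near_eq_is_derive. Qed.

Lemma is_derive_continuous g s l : is_derive s (1 : R) g l -> {for s, continuous g}.
Proof. by move=> [dg _]; apply/differentiable_continuous/derivable1_diffP. Qed.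

Lemma continuous_segment g a b :
  (forall t, a <= t <= b -> {for t, continuous g}) -> {within `[a, b], continuous g}.
Proof.
move=> h; apply: (@continuous_in_subspaceT _ _ `[a, b]%classic g) => t.
by rewrite inE /= in_itv /=; exact: h.
Qed.

Lemma bounded_segment g a b : (forall t, a <= t <= b -> {for t, continuous g}) ->
  exists K, forall t, a <= t <= b -> `|g t| <= K.
Proof.
have [ab|ba] := leP a b; last first.
  by exists 0 => t /andP[/le_trans h /h]; rewrite leNgt ba.
move=> cg.
have cn : {within `[a, b], continuous (fun t => `|g t|)}.
  by apply: continuous_segment => t /cg; apply: (@cvg_norm _ _ _ (nbhs t) _ g).
have [c _ hc] := EVT_max ab cn.
by exists `|g c| => t; rewrite -[a <= t <= b]/(t \in `[a, b]); exact: hc.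
Qed.

Lemma derive_le0 g g' a b : a <= b ->
  (forall t, a <= t <= b -> is_derive t (1 : R) g (g' t)) ->
  (forall t, a <= t <= b -> g' t <= 0) -> g b <= g a.
Proof.
rewrite le_eqVlt => /orP[/eqP -> //|ab] dg h.
have [||c hc e] := @MVT R g g' a b ab.
- by move=> t; rewrite in_itv /= => /andP[h1 h2]; apply: dg; rewrite !ltW.
- by apply: continuous_segment => t /dg; apply: is_derive_continuous.
rewrite -subr_le0 e mulr_le0_ge0 ?subr_ge0 ?(ltW ab) //; apply: h.
by move: hc; rewrite in_itv /= => /andP[h1 h2]; rewrite !ltW.
Qed.

Lemma derive_ge0 g g' a b : a <= b ->
  (forall t, a <= t <= b -> is_derive t (1 : R) g (g' t)) ->
  (forall t, a <= t <= b -> 0 <= g' t) -> g a <= g b.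
Proof.
move=> ab dg h; rewrite -lerN2.
apply: (@derive_le0 (- g) (- g')) => // t /[dup] /dg d /h; last by rewrite oppr_le0.
by move=> _; apply: is_deriveN.
Qed.

Lemma is_derive_exp K t : is_derive t (1 : R) (fun s => expR (K * s)) (K * expR (K * t)).
Proof.
have d1 : is_derive t (1 : R) ( *%R K) K.
  by apply: is_derive_ext (is_deriveZ K (is_derive_id t (1 : R))) => //; rewrite /= scaler1.
by rewrite mulrC; exact: (is_derive1_comp (is_derive_expR (K * t)) d1).
Qed.

Lemma gronwall_le g g' K a b : a <= b ->
  (forall t, a <= t <= b -> is_derive t (1 : R) g (g' t)) ->
  (forall t, a <= t <= b -> g' t <= K * g t) -> g b <= g a * expR (K * (b - a)).
Proof.
move=> ab dg h.
have /(_ ab) : a <= b -> g b * expR (- K * b) <= g a * expR (- K * a).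
  move=> _; apply: (@derive_le0 (fun t => g t * expR (- K * t))
     (fun t => (g' t - K * g t) * expR (- K * t))) => // t ht.
    apply: is_derive_ext (is_deriveM (dg t ht) (is_derive_exp (- K) t)) => //.
    by rewrite !scale_mul; ring.
  by rewrite mulr_le0_ge0 ?expR_ge0 // subr_le0 h.
rewrite -(ler_pM2r (expR_gt0 (K * b))) -!mulrA -!expRD mulNr addNr expR0 mulr1.
by rewrite mulrBr mulNr addrC.
Qed.

Lemma gronwall_ge g g' K a b : a <= b ->
  (forall t, a <= t <= b -> is_derive t (1 : R) g (g' t)) ->
  (forall t, a <= t <= b -> K * g t <= g' t) -> g a * expR (K * (b - a)) <= g b.
Proof.
move=> ab dg h; rewrite -lerN2 -mulNr.
apply: (@gronwall_le (- g) (- g')) => // t /[dup] /dg d /h; last by rewrite mulrN lerN2.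
by move=> _; apply: is_deriveN.
Qed.

(** The estimate bounds [g'] on both sides, so Gronwall propagates the zero forwards and backwards
    in time. *)
Lemma gronwall_eq0 g g' K a b t0 : a <= t0 <= b ->
  (forall t, a <= t <= b -> is_derive t (1 : R) g (g' t)) ->
  (forall t, a <= t <= b -> `|g' t| <= K * g t) -> (forall t, 0 <= g t) ->
  g t0 = 0 -> forall t, a <= t <= b -> g t = 0.
Proof.
move=> /andP[a0 b0] dg h g0 e t /andP[at' tb]; apply/eqP; rewrite eq_le g0 andbT.
have [le|/ltW le] := leP t0 t.
  have := @gronwall_le g g' K t0 t le; rewrite e mul0r; apply => s /andP[h1 h2].
    by apply: dg; rewrite (le_trans a0) // (le_trans h2).
  by apply: le_trans (ler_norm _) _; apply: h; rewrite (le_trans a0) // (le_trans h2).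
rewrite -(pmulr_lle0 _ (expR_gt0 (- K * (t0 - t)))).
have := @gronwall_ge g g' (- K) t t0 le; rewrite e; apply => s /andP[h1 h2].
  by apply: dg; rewrite (le_trans at') // (le_trans h2).
have := h s; rewrite (le_trans at') // (le_trans h2) // => /(_ isT).
by rewrite mulNr lerNl => /(le_trans _); apply; rewrite -normrN ler_norm.
Qed.

Lemma cvg_mulr_pinfty (c : R) : 0 < c -> c * t @[t --> +oo] --> +oo.
Proof.
move=> c0 A [M [Mr hM]]; exists (M / c); split; first by rewrite num_real.
by move=> x; rewrite /= ltr_pdivrMr // mulrC => /hM.
Qed.

Lemma cvg_expN (c : R) : 0 < c -> expR (- c * t) @[t --> +oo] --> 0.
Proof.
move=> c0; have := cvg_comp _ _ (cvg_mulr_pinfty c0) (@cvgr_expR R).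
by apply: cvg_trans; apply: near_eq_cvg; near=> t; rewrite /= mulNr.
Unshelve. all: by end_near. Qed.

(** For t >= 0 the function f - (C / c) exp(-c t) is nondecreasing and bounded above, and the
    correction tends to 0. *)
Lemma exp_bounded_derive_cvg f f' (C c : R) : 0 < c ->
  (forall t, 0 <= t -> is_derive t (1 : R) f (f' t)) ->
  (forall t, 0 <= t -> `|f' t| <= C * expR (- c * t)) ->
  exists l : R, f @ +oo --> l.
Proof.
move=> c0 df bf.
have C0 : 0 <= C.
  by have := bf 0 (lexx _); rewrite mulr0 expR0 mulr1; apply: le_trans.
pose D := C / c; have D0 : 0 <= D by rewrite divr_ge0 // ltW.
pose F t := f t - D * expR (- c * t).
have dE t k : is_derive t (1 : R) (fun t => k * D * expR (- c * t)) (- k * C * expR (- c * t)).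
  apply: is_derive_ext (is_deriveZ (k * D) (is_derive_exp (- c) t)) => //.
  rewrite scale_mul /D; field; exact: lt0r_neq0.
have mF a b : 0 <= a -> a <= b -> F a <= F b.
  move=> a0 ab; apply: (@derive_ge0 F (fun t => f' t + C * expR (- c * t))) => // t /andP[at' _].
    apply: is_derive_ext (is_deriveD (df t (le_trans a0 at')) (dE t (-1))) => //.
      by move=> s; rewrite /F !fctE mulN1r mulNr.
    by rewrite opprK mul1r.
  by have := bf t (le_trans a0 at'); rewrite ler_norml => /andP[h _]; rewrite -lerBlDr sub0r.
have fb t : 0 <= t -> f t <= f 0 + D.
  move=> t0; apply: (@le_trans _ _ (f t + D * expR (- c * t))).
    by rewrite lerDl mulr_ge0 // expR_ge0.
  have -> : f 0 + D = f 0 + D * expR (- c * 0) by rewrite mulr0 expR0 mulr1.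
  apply: (@derive_le0 (fun t => f t + D * expR (- c * t)) (fun t => f' t - C * expR (- c * t))) => // s /andP[s0 _].
    apply: is_derive_ext (is_deriveD (df s s0) (dE s 1)) => //.
      by move=> u; rewrite !fctE mul1r.
    by rewrite mulN1r mulNr.
  by have := bf s s0; rewrite ler_norml => /andP[_ h]; rewrite subr_le0.
(* Freezing [F] on negative times makes it monotone on the whole line, as the convergence theorem
   requires. *)
pose u t := F (Num.max 0 t).
have m0 t : 0 <= Num.max 0 t by rewrite le_max lexx.
have mu : {homo u : x y / x <= y}.
  by move=> x y xy; apply: mF; rewrite // ge_max !le_max lexx xy orbT.
have bu : has_ubound (range u).
  exists (f 0 + D) => _ [t _ <-]; rewrite /u /F.
  apply: le_trans (fb _ (m0 t)); rewrite gerBl mulr_ge0 // expR_ge0.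
have cu := nondecreasing_cvgr mu bu.
exists (sup (range u) + D * 0).
have cv : u t + D * expR (- c * t) @[t --> +oo] --> sup (range u) + D * 0.
  by apply: cvgD => //; apply: cvgM; [exact: cvg_cst|exact: cvg_expN].
apply: cvg_trans cv; apply: near_eq_cvg; near=> t.
have t0 : 0 <= t by near: t; apply: nbhs_pinfty_ge; rewrite num_real.
by rewrite /u /F max_r // subrK.
Unshelve. all: by end_near. Qed.

End RealDerivatives.

(** * Continuation of solutions under an a priori bound *)

Section GlobalFlow.
Variables (R : realType) (d : nat) (f : 'I_d -> pexp R d).
Implicit Types (phi psi : R -> 'I_d -> R) (t s : R).

Lemma solves_shift phi s t : solves_at f phi (t - s) -> solves_at f (fun u => phi (u - s)) t.
Proof.
move=> h i; have d1 : is_derive t (1 : R) (fun u => u - s) 1.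
  apply: is_derive_ext (is_deriveD (is_derive_id t (1 : R)) (is_derive_cst (- s) t 1)) => //.
  by rewrite addr0.
have := @is_derive1_comp _ (fun v => phi v i) (fun u => u - s) t _ _ (h i) d1.
by rewrite mulr1.
Qed.

Lemma solves_near phi psi t : (\near t, phi t = psi t) -> solves_at f phi t -> solves_at f psi t.
Proof.
move=> e h i; rewrite -(nbhs_singleton e); apply: is_derive_near (h i).
by apply: filterS e => s ->.
Qed.

Lemma solves_glue phi psi s : phi s = psi s ->
  forall t, (t <= s -> solves_at f phi t) -> (s <= t -> solves_at f psi t) ->
  solves_at f (fun t => if t <= s then phi t else psi t) t.
Proof.
move=> e t h1 h2; case: (ltgtP t s) => ts.
- apply: solves_near (h1 (ltW ts)); near=> u.
  by rewrite ifT //; apply/ltW; near: u; exact: lt_nbhsl.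
- apply: solves_near (h2 (ltW ts)); near=> u.
  by rewrite leNgt ifF //; apply/negbF; near: u; exact: lt_nbhsr.
- have tss : t <= s by rewrite ts.
  have sst : s <= t by rewrite ts.
  move=> i; have d1 := h1 tss i; have d2 := h2 sst i.
  rewrite ts in d1 d2 *; rewrite -e in d2.
  apply: is_derive_ext (is_derive_glue (congr1 (@^~ i) e) d1 d2); last by rewrite lexx.
  by move=> u /=; case: ifP.
Unshelve. all: by end_near. Qed.

(** The a priori bound allows restarting with a fixed step. The solution also covers times above
    [- h], so that its derivative at 0 is two-sided and another orbit can be glued to it there. *)
Lemma poly_ode_global (M : R) (y : 'I_d -> R) : 0 < M -> (forall i, `|y i| <= M) ->
  (forall T h phi, 0 < h -> 0 < T -> phi 0 = y ->
     (forall t, - h < t < T -> solves_at f phi t) ->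
     forall t i, 0 <= t < T -> `|phi t i| <= M) ->
  exists phi h, [/\ 0 < h, phi 0 = y & forall t, - h < t -> solves_at f phi t].
Proof.
move=> M0 yM apr; have [h h0 loc] := poly_ode_local f M0.
have /choice [sol hsol] : forall y : 'I_d -> R, exists phi, (forall i, `|y i| <= M) ->
    phi 0 = y /\ forall t, `|t| < h -> solves_at f phi t.
  move=> z; have [zM|nz] := pselect (forall i, `|z i| <= M); last by exists (fun _ => z).
  by have [phi hphi] := loc z zM; exists phi.
pose tau := h / 2; have tau0 : 0 < tau by rewrite divr_gt0.
have htau : h = tau + tau by rewrite /tau; lra.
(* Restarting at multiples of [tau = h / 2] leaves an overlap: [ph n] solves up to time
   [(n + 2) tau], while the next restart happens at [(n + 1) tau]. *)
pose ph := fix ph n := if n is n'.+1 then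
   (fun t => if t <= n%:R * tau then ph n' t else sol (ph n' (n%:R * tau)) (t - n%:R * tau))
   else sol y.
have nS n : n.+1%:R * tau = n%:R * tau + tau by rewrite -natr1 mulrDl mul1r.
have n0 n : 0 <= n%:R * tau by rewrite mulr_ge0 // ltW.
have inv n : ph n 0 = y /\ forall t, - h < t < n.+2%:R * tau -> solves_at f (ph n) t.
  elim: n => [|n [i1 i2]].
    have [s1 s2] := hsol y yM; split => // t /andP[t1 t2]; apply: s2.
    by rewrite ltr_norml t1 /= (lt_le_trans t2) // !nS mul0r add0r htau.
  set s := n.+1%:R * tau.
  have bd : forall i, `|ph n s i| <= M.
    move=> i; apply: (apr (n.+2%:R * tau) h (ph n)) => //.
      by rewrite nS ltr_wpDl.
    by rewrite n0 /= [ltRHS]nS ltrDl.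
  have [s1 s2] := hsol _ bd; split; first by rewrite /= n0.
  move=> t /andP[t1 t2]; apply: solves_glue => //.
  - by rewrite subrr s1.
  - by move=> ts; apply: i2; rewrite t1 (le_lt_trans ts) // [ltRHS]nS ltrDl.
  - move=> ts; apply: solves_shift; apply: s2; rewrite ger0_norm ?subr_ge0 //.
    by rewrite ltrBlDr htau addrC addrA -!nS.
have agree n m t : t <= n.+1%:R * tau -> ph (n + m)%N t = ph n t.
  move=> tn; elim: m => [|m ih]; first by rewrite addn0.
  rewrite addnS -ih /= ifT // (le_trans tn) // ler_wpM2r ?(ltW tau0) // ler_nat.
  by rewrite ltnS leq_addr.
have ag n m t : t <= n.+1%:R * tau -> t <= m.+1%:R * tau -> ph n t = ph m t.
  move=> tn tm; case: (leqP n m) => [nm|/ltnW mn].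
    by rewrite -(agree n (m - n)%N t tn) subnKC.
  by rewrite -(agree m (n - m)%N t tm) subnKC.
have /choice [N hN] : forall t, exists n, t < n.+1%:R * tau.
  move=> t; exists (Num.bound `|t / tau|); rewrite -ltr_pdivrMr //.
  apply: (le_lt_trans (ler_norm _)); apply: (lt_trans (archi_boundP (normr_ge0 _))).
  by rewrite ltr_nat.
exists (fun t => ph (N t) t), h; split => //.
  rewrite (ag (N 0) 0%N 0) ?(ltW (hN 0)) //.
  by case: (inv 0%N).
move=> t ht; apply: solves_near ((inv (N t)).2 t _).
  near=> u; apply: ag; apply: ltW => //; near: u.
  by apply: lt_nbhsl.
by rewrite ht (lt_trans (hN t)) // [ltRHS]nS ltrDl.
Unshelve. all: by end_near. Qed.

End GlobalFlow.

(** * Calculus of complex matrices *)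

Section ComplexCalculus.
Variable R : realType.
Notation C := R[i].
Notation Re := complex.Re.
Notation Im := complex.Im.
Implicit Types (z w : C) (g h : R -> C) (t : R).

Lemma Re_add z w : Re (z + w) = Re z + Re w. Proof. by case: z w => [a b] [c d]. Qed.
Lemma Im_add z w : Im (z + w) = Im z + Im w. Proof. by case: z w => [a b] [c d]. Qed.
Lemma Re_opp z : Re (- z) = - Re z. Proof. by case: z. Qed.
Lemma Im_opp z : Im (- z) = - Im z. Proof. by case: z. Qed.
Lemma Re_mul z w : Re (z * w) = Re z * Re w - Im z * Im w.
Proof. by case: z w => [a b] [c d]. Qed.
Lemma Im_mul z w : Im (z * w) = Re z * Im w + Im z * Re w.
Proof. by case: z w => [a b] [c d]. Qed.
Lemma Re_conjc z : Re (conjc z) = Re z. Proof. by case: z. Qed.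
Lemma Im_conjc z : Im (conjc z) = - Im z. Proof. by case: z. Qed.
Lemma Re_mulrn z n : Re (z *+ n) = Re z *+ n.
Proof. by elim: n => [|n ih] //; rewrite !mulrS Re_add ih. Qed.
Lemma Re_sum I (r : seq I) (P : pred I) (F : I -> C) :
  Re (\sum_(i <- r | P i) F i) = \sum_(i <- r | P i) Re (F i).
Proof. by elim/big_rec2: _ => // i a b _ <-; rewrite Re_add. Qed.
Lemma complex_eqP z w : Re z = Re w -> Im z = Im w -> z = w.
Proof. by case: z w => [a b] [c d] /= -> ->. Qed.

(** Two real-valued sizes: [csq] is multiplicative and differentiable, hence suited to derivatives
    and determinants, while [cabs] is subadditive and serves for estimates. *)
Definition csq z : R := Re z ^+ 2 + Im z ^+ 2.
Definition cabs z : R := `|Re z| + `|Im z|.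

Lemma csq_ge0 z : 0 <= csq z. Proof. by rewrite addr_ge0 ?sqr_ge0. Qed.
Lemma cabs_ge0 z : 0 <= cabs z. Proof. exact: addr_ge0. Qed.
Lemma csq_eq0 z : csq z = 0 -> z = 0.
Proof.
move/eqP; rewrite paddr_eq0 ?sqr_ge0 // !sqrf_eq0 => /andP[/eqP a /eqP b].
exact: complex_eqP.
Qed.
Lemma csqM z w : csq (z * w) = csq z * csq w.
Proof. by rewrite /csq Re_mul Im_mul; ring. Qed.
Lemma cabs0 : cabs 0 = 0. Proof. by rewrite /cabs /= normr0 addr0. Qed.
Lemma cabsD z w : cabs (z + w) <= cabs z + cabs w.
Proof. by rewrite /cabs Re_add Im_add addrACA lerD ?ler_normD. Qed.
Lemma cabsM z w : cabs (z * w) <= cabs z * cabs w.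
Proof.
rewrite /cabs Re_mul Im_mul mulrDl !mulrDr.
have h1 := ler_normB (Re z * Re w) (Im z * Im w).
have h2 := ler_normD (Re z * Im w) (Im z * Re w).
rewrite !normrM in h1 h2; lra.
Qed.
Lemma cabs_conj z : cabs (conjc z) = cabs z.
Proof. by rewrite /cabs Re_conjc Im_conjc normrN. Qed.
Lemma csq_le_cabs z : csq z <= cabs z ^+ 2.
Proof.
rewrite /csq /cabs sqrrD -!normrX !(ger0_norm (sqr_ge0 _)) -addrA lerD2l lerDr.
by rewrite mulrn_wge0 // mulr_ge0.
Qed.
Lemma cabs_le_csq z : cabs z ^+ 2 <= 2 * csq z.
Proof.
rewrite /csq /cabs; have := sqr_ge0 (`|Re z| - `|Im z|).
rewrite sqrrB sqrrD -!normrX !(ger0_norm (sqr_ge0 _)); lra.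
Qed.
Lemma Re_le_cabs z : `|Re z| <= cabs z. Proof. by rewrite lerDl. Qed.

Definition cder g t z := is_derive t (1 : R) (fun s => Re (g s)) (Re z) /\
  is_derive t (1 : R) (fun s => Im (g s)) (Im z).

Lemma cder_ext g h t z w : (forall s, g s = h s) -> z = w -> cder g t z -> cder h t w.
Proof. by move=> gh -> [d1 d2]; split; [apply: is_derive_ext d1|apply: is_derive_ext d2] => // s; rewrite gh. Qed.

Lemma cder_near g h t z : (\near t, g t = h t) -> cder g t z -> cder h t z.
Proof.
by move=> e [d1 d2]; split; [apply: is_derive_near d1|apply: is_derive_near d2];
  apply: filterS e => s ->.
Qed.

Lemma cder_cst z t : cder (fun=> z) t 0.
Proof. by split; apply: is_derive_cst. Qed.

Lemma cderD g h t z w : cder g t z -> cder h t w -> cder (fun s => g s + h s) t (z + w).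
Proof.
move=> [a b] [c d]; split.
  by apply: is_derive_ext (is_deriveD a c) => // *; rewrite !(fctE, Re_add).
by apply: is_derive_ext (is_deriveD b d) => // *; rewrite !(fctE, Im_add).
Qed.

Lemma cderN g t z : cder g t z -> cder (fun s => - g s) t (- z).
Proof.
move=> [a b]; split.
  by apply: is_derive_ext (is_deriveN a) => // *; rewrite !(fctE, Re_opp).
by apply: is_derive_ext (is_deriveN b) => // *; rewrite !(fctE, Im_opp).
Qed.

Lemma cderM g h t z w : cder g t z -> cder h t w ->
  cder (fun s => g s * h s) t (z * h t + g t * w).
Proof.
move=> [a b] [c d]; split.
  apply: is_derive_ext (is_deriveB (is_deriveM a c) (is_deriveM b d)) => [s|].
    by rewrite !(fctE, Re_mul).
  by rewrite !(Re_add, Re_mul) !scale_mul; ring.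
apply: is_derive_ext (is_deriveD (is_deriveM a d) (is_deriveM b c)) => [s|].
  by rewrite !(fctE, Im_mul).
by rewrite !(Im_add, Im_mul) !scale_mul; ring.
Qed.

Lemma cder_conj g t z : cder g t z -> cder (fun s => conjc (g s)) t (conjc z).
Proof.
move=> [a b]; split.
  by apply: is_derive_ext a => // *; rewrite Re_conjc.
by apply: is_derive_ext (is_deriveN b) => // *; rewrite !(fctE, Im_conjc).
Qed.

Lemma cder_sum I (r : seq I) (P : pred I) (g : I -> R -> C) t (z : I -> C) :
  (forall i, P i -> cder (g i) t (z i)) ->
  cder (fun s => \sum_(i <- r | P i) g i s) t (\sum_(i <- r | P i) z i).
Proof.
move=> h; elim: r => [|i r ih].
  by apply: cder_ext (cder_cst 0 t) => *; rewrite big_nil.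
case Pi: (P i).
  by apply: cder_ext (cderD (h i Pi) ih) => *; rewrite big_cons Pi.
by apply: cder_ext ih => *; rewrite big_cons Pi.
Qed.

Lemma cder_csq g t z : cder g t z ->
  is_derive t (1 : R) (fun s => csq (g s)) (2 * Re (z * conjc (g t))).
Proof.
move=> [a b]; apply: is_derive_ext (is_deriveD (is_deriveM a a) (is_deriveM b b)) => [s|].
  by rewrite !fctE /csq !expr2.
by rewrite Re_mul Re_conjc Im_conjc !scale_mul; ring.
Qed.

Lemma cder_prod n (g : 'I_n -> R -> C) t (z : 'I_n -> C) :
  (forall i, cder (g i) t (z i)) ->
  cder (fun s => \prod_i g i s) t (\sum_i z i * \prod_(j | j != i) g j t).
Proof.
elim: n g z => [|n ih] g z h.
  by apply: cder_ext (cder_cst 1 t) => *; rewrite big_ord0.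
apply: cder_ext (cderM (h ord0) (ih _ _ (fun i => h (lift ord0 i)))) => [s|].
  by rewrite big_ord_recl.
rewrite [RHS]big_ord_recl; congr (_ * _ + _).
  by rewrite [RHS]big_mkcond big_ord_recl eqxx /= mul1r.
rewrite mulr_sumr; apply: eq_bigr => i _; rewrite mulrCA; congr (_ * _).
rewrite [RHS]big_mkcond big_ord_recl /=; congr (_ * _).
by rewrite [LHS]big_mkcond; apply: eq_bigr => j _; rewrite (inj_eq lift_inj).
Qed.

Definition clim (F : set_system R) g z :=
  (fun t => Re (g t)) @ F --> Re z /\ (fun t => Im (g t)) @ F --> Im z.

Section Limits.
Variables (F : set_system R) (FF : ProperFilter F).

Lemma clim_ext g h z w : (forall s, g s = h s) -> z = w -> clim F g z -> clim F h w.
Proof. by move=> gh ->; have -> : h = g by apply/funext. Qed.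

Lemma clim_near g h z : (\near F, g F = h F) -> clim F g z -> clim F h z.
Proof.
move=> e [a b]; split.
  by apply: cvg_trans a; apply: near_eq_cvg; apply: filterS e => s ->.
by apply: cvg_trans b; apply: near_eq_cvg; apply: filterS e => s ->.
Qed.

Lemma clim_cst z : clim F (fun=> z) z.
Proof. by split; apply: cvg_cst. Qed.

Lemma climD g h z w : clim F g z -> clim F h w -> clim F (fun s => g s + h s) (z + w).
Proof.
move=> [a b] [c d]; split.
  by rewrite Re_add; under eq_fun do rewrite Re_add; apply: cvgD.
by rewrite Im_add; under eq_fun do rewrite Im_add; apply: cvgD.
Qed.

Lemma climN g z : clim F g z -> clim F (fun s => - g s) (- z).
Proof.
move=> [a b]; split.
  by rewrite Re_opp; under eq_fun do rewrite Re_opp; apply: cvgN.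
by rewrite Im_opp; under eq_fun do rewrite Im_opp; apply: cvgN.
Qed.

Lemma climM g h z w : clim F g z -> clim F h w -> clim F (fun s => g s * h s) (z * w).
Proof.
move=> [a b] [c d]; split.
  by rewrite Re_mul; under eq_fun do rewrite Re_mul; apply: cvgB; apply: cvgM.
by rewrite Im_mul; under eq_fun do rewrite Im_mul; apply: cvgD; apply: cvgM.
Qed.

Lemma clim_conj g z : clim F g z -> clim F (fun s => conjc (g s)) (conjc z).
Proof.
move=> [a b]; split.
  by rewrite Re_conjc; under eq_fun do rewrite Re_conjc.
by rewrite Im_conjc; under eq_fun do rewrite Im_conjc; apply: cvgN.
Qed.

Lemma clim_sum I (r : seq I) (P : pred I) (g : I -> R -> C) (z : I -> C) :
  (forall i, P i -> clim F (g i) (z i)) ->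
  clim F (fun s => \sum_(i <- r | P i) g i s) (\sum_(i <- r | P i) z i).
Proof.
move=> h; elim: r => [|i r ih].
  by apply: clim_ext (clim_cst 0) => *; rewrite big_nil.
case Pi: (P i).
  by apply: clim_ext (climD (h i Pi) ih) => *; rewrite big_cons Pi.
by apply: clim_ext ih => *; rewrite big_cons Pi.
Qed.

Lemma clim_unique g z w : clim F g z -> clim F g w -> z = w.
Proof.
move=> [a b] [c d]; apply: complex_eqP.
  exact: (cvg_unique (@norm_hausdorff _ _) a c).
exact: (cvg_unique (@norm_hausdorff _ _) b d).
Qed.

Lemma clim_csq g z : clim F g z -> (fun s => csq (g s)) @ F --> csq z.
Proof. by move=> [a b]; apply: cvgD; rewrite expr2; under eq_fun do rewrite expr2; apply: cvgM. Qed.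

End Limits.
End ComplexCalculus.

Section MatrixCalculus.
Variable R : realType.
Notation C := R[i].
Notation Re := complex.Re.
Notation Im := complex.Im.
Implicit Types t : R.

Lemma adjE m n (A : 'M[C]_(m, n)) p q : adj A p q = conjc (A q p).
Proof. by rewrite !mxE. Qed.
Lemma adjK m n (A : 'M[C]_(m, n)) : adj (adj A) = A.
Proof. by apply/matrixP => p q; rewrite !adjE conjcK. Qed.
Lemma adjD m n (A B : 'M[C]_(m, n)) : adj (A + B) = adj A + adj B.
Proof. by apply/matrixP => p q; rewrite adjE !mxE rmorphD. Qed.
Lemma adjN m n (A : 'M[C]_(m, n)) : adj (- A) = - adj A.
Proof. by apply/matrixP => p q; rewrite adjE !mxE rmorphN. Qed.
Lemma adjB m n (A B : 'M[C]_(m, n)) : adj (A - B) = adj A - adj B.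
Proof. by rewrite adjD adjN. Qed.
Lemma adj0 (m n : nat) : adj (0 : 'M[C]_(m, n)) = 0.
Proof. by apply/matrixP => p q; rewrite adjE !mxE rmorph0. Qed.
Lemma adjM m n p (A : 'M[C]_(m, n)) (B : 'M[C]_(n, p)) : adj (A *m B) = adj B *m adj A.
Proof.
apply/matrixP => i j; rewrite adjE !mxE rmorph_sum; apply: eq_bigr => k _.
by rewrite rmorphM mulrC !adjE.
Qed.
Lemma adjZ m n (c : C) (A : 'M[C]_(m, n)) : adj (c *: A) = conjc c *: adj A.
Proof. by apply/matrixP => p q; rewrite adjE !mxE rmorphM. Qed.
Lemma adj_sum m n I (r : seq I) (P : pred I) (A : I -> 'M[C]_(m, n)) :
  adj (\sum_(i <- r | P i) A i) = \sum_(i <- r | P i) adj (A i).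
Proof. by elim/big_rec2: _ => [|i a b _ <-]; rewrite ?adj0 ?adjD. Qed.
Lemma adj_inj (m n : nat) : injective (@adj R m n).
Proof. exact: can_inj (@adjK m n). Qed.

Lemma mxtraceD n (A B : 'M[C]_n) : \tr (A + B) = \tr A + \tr B.
Proof. exact: raddfD. Qed.
Lemma mxtraceB n (A B : 'M[C]_n) : \tr (A - B) = \tr A - \tr B.
Proof. exact: raddfB. Qed.

(** The squared Hilbert-Schmidt norm, with [inner] as its real polarisation; the entrywise norm [n1]
    is submultiplicative and stands in for an operator norm. *)
Definition nsq m n (A : 'M[C]_(m, n)) : R := \sum_p \sum_q csq (A p q).
Definition n1 m n (A : 'M[C]_(m, n)) : R := \sum_p \sum_q cabs (A p q).
Definition inner m n (A B : 'M[C]_(m, n)) : R := Re (\tr (A *m adj B)).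

Lemma nsq_ge0 m n (A : 'M[C]_(m, n)) : 0 <= nsq A.
Proof. by apply: sumr_ge0 => p _; apply: sumr_ge0 => q _; apply: csq_ge0. Qed.
Lemma n1_ge0 m n (A : 'M[C]_(m, n)) : 0 <= n1 A.
Proof. by apply: sumr_ge0 => p _; apply: sumr_ge0 => q _; apply: cabs_ge0. Qed.
Lemma csq_le_nsq m n (A : 'M[C]_(m, n)) p q : csq (A p q) <= nsq A.
Proof.
rewrite /nsq (bigD1 p) //= (bigD1 q) //= -addrA lerDl addr_ge0 //.
  by apply: sumr_ge0 => k _; apply: csq_ge0.
by apply: sumr_ge0 => k _; apply: sumr_ge0 => l _; apply: csq_ge0.
Qed.
Lemma cabs_le_n1 m n (A : 'M[C]_(m, n)) p q : cabs (A p q) <= n1 A.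
Proof.
rewrite /n1 (bigD1 p) //= (bigD1 q) //= -addrA lerDl addr_ge0 //.
  by apply: sumr_ge0 => k _; apply: cabs_ge0.
by apply: sumr_ge0 => k _; apply: sumr_ge0 => l _; apply: cabs_ge0.
Qed.
Lemma nsq_eq0 m n (A : 'M[C]_(m, n)) : nsq A = 0 -> A = 0.
Proof.
move=> h; apply/matrixP => p q; rewrite mxE; apply: csq_eq0; apply/eqP.
by rewrite eq_le csq_ge0 andbT -h csq_le_nsq.
Qed.
Lemma nsq0 (m n : nat) : nsq (0 : 'M[C]_(m, n)) = 0.
Proof. by rewrite /nsq big1 // => p _; rewrite big1 // => q _; rewrite mxE /csq /= expr0n addr0. Qed.
Lemma innerE m n (A B : 'M[C]_(m, n)) :
  inner A B = \sum_p \sum_q (Re (A p q) * Re (B p q) + Im (A p q) * Im (B p q)).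
Proof.
rewrite /inner /mxtrace Re_sum; apply: eq_bigr => p _; rewrite mxE Re_sum.
by apply: eq_bigr => q _; rewrite adjE Re_mul Re_conjc Im_conjc mulrN opprK.
Qed.
Lemma inner_nsq m n (A : 'M[C]_(m, n)) : inner A A = nsq A.
Proof. by rewrite innerE; apply: eq_bigr => p _; apply: eq_bigr => q _; rewrite -!expr2. Qed.
Lemma innerC m n (A B : 'M[C]_(m, n)) : inner A B = inner B A.
Proof.
by rewrite !innerE; apply: eq_bigr => p _; apply: eq_bigr => q _; rewrite ![Re (A _ _) * _]mulrC ![Im (A _ _) * _]mulrC.
Qed.
Lemma innerDl m n (A B D : 'M[C]_(m, n)) : inner (A + B) D = inner A D + inner B D.
Proof. by rewrite /inner mulmxDl raddfD Re_add. Qed.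
Lemma innerNl m n (A D : 'M[C]_(m, n)) : inner (- A) D = - inner A D.
Proof. by rewrite /inner mulNmx raddfN Re_opp. Qed.
Lemma innerBl m n (A B D : 'M[C]_(m, n)) : inner (A - B) D = inner A D - inner B D.
Proof. by rewrite innerDl innerNl. Qed.
Lemma inner_adj m n (A B : 'M[C]_(m, n)) : inner (adj A) (adj B) = inner A B.
Proof.
rewrite !innerE exchange_big; apply: eq_bigr => p _; apply: eq_bigr => q _.
by rewrite !adjE !Re_conjc !Im_conjc mulrNN.
Qed.
Lemma nsqN m n (A : 'M[C]_(m, n)) : nsq (- A) = nsq A.
Proof. by rewrite -!inner_nsq innerNl innerC innerNl opprK. Qed.

Lemma n1D m n (A B : 'M[C]_(m, n)) : n1 (A + B) <= n1 A + n1 B.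
Proof.
rewrite /n1 -big_split /=; apply: ler_sum => p _; rewrite -big_split /=.
by apply: ler_sum => q _; rewrite mxE cabsD.
Qed.
Lemma cabs_sum I (r : seq I) (P : pred I) (F : I -> C) :
  cabs (\sum_(i <- r | P i) F i) <= \sum_(i <- r | P i) cabs (F i).
Proof.
elim/big_rec2: _ => [|i a b _ h]; first by rewrite cabs0.
by apply: (le_trans (cabsD _ _)); rewrite lerD2l.
Qed.
Lemma n1M m n p (A : 'M[C]_(m, n)) (B : 'M[C]_(n, p)) : n1 (A *m B) <= n1 A * n1 B.
Proof.
rewrite /n1 mulr_suml; apply: ler_sum => i _.
apply: (@le_trans _ _ (\sum_j \sum_k cabs (A i k) * cabs (B k j))).
  apply: ler_sum => j _; rewrite mxE; apply: (le_trans (cabs_sum _ _ _)).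
  by apply: ler_sum => k _; apply: cabsM.
rewrite exchange_big mulr_suml; apply: ler_sum => k _.
rewrite -mulr_sumr ler_wpM2l ?cabs_ge0 //.
rewrite [leRHS](bigD1 k) //= lerDl; apply: sumr_ge0 => l _.
by apply: sumr_ge0 => j _; apply: cabs_ge0.
Qed.
Lemma nsq_le_n1 m n (A : 'M[C]_(m, n)) : nsq A <= n1 A ^+ 2.
Proof.
rewrite expr2 /nsq {1}/n1 mulr_suml; apply: ler_sum => p _.
rewrite mulr_suml; apply: ler_sum => q _; apply: (le_trans (csq_le_cabs _)).
by rewrite expr2 ler_wpM2l ?cabs_ge0 ?cabs_le_n1.
Qed.

(* Young's inequality for each summand. *)
Lemma inner_mul_le m (r s : 'M[C]_(1, m)) (M : 'M[C]_m) :
  `|inner (r *m M) s| <= n1 M * (nsq r + nsq s).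
Proof.
rewrite /inner /mxtrace big_ord1 mxE.
apply: (le_trans (Re_le_cabs _)); apply: (le_trans (cabs_sum _ _ _)).
rewrite /n1 exchange_big /= mulr_suml; apply: ler_sum => q _.
rewrite mulr_suml.
apply: (@le_trans _ _ (\sum_p cabs (r 0 p * M p q) * cabs (s 0 q))).
  rewrite -mulr_suml mxE; apply: (le_trans (cabsM _ _)).
  by rewrite adjE cabs_conj ler_wpM2r ?cabs_ge0 // cabs_sum.
apply: ler_sum => p _.
apply: (@le_trans _ _ (cabs (M p q) * (cabs (r 0 p) * cabs (s 0 q)))).
  rewrite mulrA ler_wpM2r ?cabs_ge0 //; apply: (le_trans (cabsM _ _)).
  by rewrite mulrC.
rewrite ler_wpM2l ?cabs_ge0 //.
have h1 := cabs_le_csq (r 0 p); have h2 := cabs_le_csq (s 0 q).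
have h3 := csq_le_nsq r 0 p; have h4 := csq_le_nsq s 0 q.
have := sqr_ge0 (cabs (r 0 p) - cabs (s 0 q)); nra.
Qed.

Definition mder m n (A : R -> 'M[C]_(m, n)) t (D : 'M[C]_(m, n)) :=
  forall p q, cder (fun s => A s p q) t (D p q).

Lemma mder_ext m n (A B : R -> 'M[C]_(m, n)) t D E : (forall s, A s = B s) -> D = E ->
  mder A t D -> mder B t E.
Proof. by move=> AB -> h p q; apply: cder_ext (h p q) => // s; rewrite AB. Qed.
Lemma mder_near m n (A B : R -> 'M[C]_(m, n)) t D : (\near t, A t = B t) ->
  mder A t D -> mder B t D.
Proof. by move=> AB h p q; apply: cder_near (h p q); apply: filterS AB => s ->. Qed.
Lemma mder_cst m n (A : 'M[C]_(m, n)) t : mder (fun=> A) t 0.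
Proof. by move=> p q; rewrite mxE; apply: cder_cst. Qed.
Lemma mderD m n (A B : R -> 'M[C]_(m, n)) t D E : mder A t D -> mder B t E ->
  mder (fun s => A s + B s) t (D + E).
Proof. by move=> a b p q; apply: cder_ext (cderD (a p q) (b p q)) => *; rewrite mxE. Qed.
Lemma mderN m n (A : R -> 'M[C]_(m, n)) t D : mder A t D -> mder (fun s => - A s) t (- D).
Proof. by move=> a p q; apply: cder_ext (cderN (a p q)) => *; rewrite mxE. Qed.
Lemma mderB m n (A B : R -> 'M[C]_(m, n)) t D E : mder A t D -> mder B t E ->
  mder (fun s => A s - B s) t (D - E).
Proof. by move=> a b; apply: mderD => //; apply: mderN. Qed.
Lemma mderM m n l (A : R -> 'M[C]_(m, n)) (B : R -> 'M[C]_(n, l)) t D E :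
  mder A t D -> mder B t E -> mder (fun s => A s *m B s) t (D *m B t + A t *m E).
Proof.
move=> a b p q; apply: cder_ext (@cder_sum _ _ (index_enum _) xpredT _ _ _ (fun k _ => cderM (a p k) (b k q))) => [s|].
  by rewrite mxE.
by rewrite !mxE -big_split.
Qed.
Lemma mder_adj m n (A : R -> 'M[C]_(m, n)) t D : mder A t D -> mder (fun s => adj (A s)) t (adj D).
Proof. by move=> a p q; apply: cder_ext (cder_conj (a q p)) => *; rewrite adjE. Qed.
Lemma mderZ m n (c : C) (A : R -> 'M[C]_(m, n)) t D : mder A t D -> mder (fun s => c *: A s) t (c *: D).
Proof.
move=> a p q; apply: cder_ext (cderM (cder_cst c t) (a p q)) => *; rewrite mxE //.
by rewrite mul0r add0r.
Qed.
Lemma mder_sum m n I (r : seq I) (P : pred I) (A : I -> R -> 'M[C]_(m, n)) t D :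
  (forall i, P i -> mder (A i) t (D i)) ->
  mder (fun s => \sum_(i <- r | P i) A i s) t (\sum_(i <- r | P i) D i).
Proof.
move=> h p q; apply: cder_ext (@cder_sum _ _ r P _ _ _ (fun k Pk => h k Pk p q)) => *;
  by rewrite summxE.
Qed.
Lemma mder_nsq m n (A : R -> 'M[C]_(m, n)) t D : mder A t D ->
  is_derive t (1 : R) (fun s => nsq (A s)) (2 * inner D (A t)).
Proof.
move=> h.
have hs (I : Type) (r : seq I) (g : I -> R -> R) (dg : I -> R) :
    (forall i, is_derive t (1 : R) (g i) (dg i)) ->
    is_derive t (1 : R) (fun s => \sum_(i <- r) g i s) (\sum_(i <- r) dg i).
  move=> hg; elim: r => [|i r ih].
    by apply: is_derive_ext (is_derive_cst 0 t (1 : R)) => *; rewrite big_nil.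
  by apply: is_derive_ext (is_deriveD (hg i) ih) => *; rewrite ?fctE big_cons.
apply: is_derive_ext (hs _ _ _ _ (fun p => hs _ (index_enum _) _ _ (fun q => cder_csq (h p q)))) => //.
rewrite innerE mulr_sumr; apply: eq_bigr => p _; rewrite mulr_sumr.
by apply: eq_bigr => q _; rewrite Re_mul Re_conjc Im_conjc mulrN opprK.
Qed.

(** Jacobi's formula: differentiate one row at a time, then expand each determinant along the
    differentiated row. *)
Lemma cder_det n (A : R -> 'M[C]_n) t D : mder A t D ->
  cder (fun s => \det (A s)) t (\tr (D *m \adj (A t))).
Proof.
move=> h.
have := @cder_sum _ _ (index_enum _) xpredT _ t _ (fun (s : 'S_n) _ =>
  cderM (cder_cst ((-1) ^+ s) t) (cder_prod (fun i => h i (s i)))).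
apply: cder_ext => //.
transitivity (\sum_i \det (\matrix_(k, l) if k == i then D k l else A t k l)); last first.
  apply: eq_bigr => i _; rewrite (expand_det_row _ i) mxE; apply: eq_bigr => k _.
  rewrite !mxE eqxx; congr (_ * _); rewrite /cofactor; congr (_ * \det _).
  by apply/matrixP => p q; rewrite !mxE [lift _ _ == _]eq_sym (negPf (neq_lift _ _)).
rewrite /determinant exchange_big; apply: eq_bigr => s _.
rewrite mul0r add0r mulr_sumr; apply: eq_bigr => i _; congr (_ * _).
rewrite [RHS](bigD1 i) //= mxE eqxx; congr (_ * _); apply: eq_bigr => j /negPf ji.
by rewrite mxE ji.
Qed.

Definition mlim (F : set_system R) m n (A : R -> 'M[C]_(m, n)) (L : 'M[C]_(m, n)) :=
  forall p q, clim F (fun s => A s p q) (L p q).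

Section MatrixLimits.
Variables (F : set_system R) (FF : ProperFilter F).

Lemma mlim_ext m n (A B : R -> 'M[C]_(m, n)) D E : (forall s, A s = B s) -> D = E ->
  mlim F A D -> mlim F B E.
Proof. by move=> AB -> h p q; apply: clim_ext (h p q) => // s; rewrite AB. Qed.
Lemma mlim_near m n (A B : R -> 'M[C]_(m, n)) D : (\near F, A F = B F) ->
  mlim F A D -> mlim F B D.
Proof. by move=> AB h p q; apply: clim_near (h p q); apply: filterS AB => s ->. Qed.
Lemma mlim_cst m n (A : 'M[C]_(m, n)) : mlim F (fun=> A) A.
Proof. by move=> p q; apply: clim_cst. Qed.
Lemma mlimD m n (A B : R -> 'M[C]_(m, n)) D E : mlim F A D -> mlim F B E ->
  mlim F (fun s => A s + B s) (D + E).
Proof. by move=> a b p q; apply: clim_ext (climD FF (a p q) (b p q)) => *; rewrite mxE. Qed.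
Lemma mlimN m n (A : R -> 'M[C]_(m, n)) D : mlim F A D -> mlim F (fun s => - A s) (- D).
Proof. by move=> a p q; apply: clim_ext (climN FF (a p q)) => *; rewrite mxE. Qed.
Lemma mlimB m n (A B : R -> 'M[C]_(m, n)) D E : mlim F A D -> mlim F B E ->
  mlim F (fun s => A s - B s) (D - E).
Proof. by move=> a b; apply: mlimD => //; apply: mlimN. Qed.
Lemma mlimM m n l (A : R -> 'M[C]_(m, n)) (B : R -> 'M[C]_(n, l)) D E :
  mlim F A D -> mlim F B E -> mlim F (fun s => A s *m B s) (D *m E).
Proof.
move=> a b p q; apply: (@clim_ext _ F (fun s => \sum_k A s p k * B s k q) _ (\sum_k D p k * E k q)).
- by move=> s; rewrite mxE.
- by rewrite mxE.
- by apply: clim_sum => k _; apply: climM.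
Qed.
Lemma mlim_adj m n (A : R -> 'M[C]_(m, n)) D : mlim F A D -> mlim F (fun s => adj (A s)) (adj D).
Proof. by move=> a p q; apply: clim_ext (clim_conj FF (a q p)) => *; rewrite adjE. Qed.
Lemma mlimZ m n (c : C) (A : R -> 'M[C]_(m, n)) D : mlim F A D -> mlim F (fun s => c *: A s) (c *: D).
Proof. by move=> a p q; apply: clim_ext (climM FF (clim_cst FF c) (a p q)) => *; rewrite mxE. Qed.
Lemma mlim_sum m n I (r : seq I) (P : pred I) (A : I -> R -> 'M[C]_(m, n)) D :
  (forall i, P i -> mlim F (A i) (D i)) ->
  mlim F (fun s => \sum_(i <- r | P i) A i s) (\sum_(i <- r | P i) D i).
Proof.
move=> h p q; apply: (@clim_ext _ F (fun s => \sum_(i <- r | P i) A i s p q) _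
  (\sum_(i <- r | P i) D i p q)); [by move=> s; rewrite summxE|by rewrite summxE|].
by apply: clim_sum => k Pk; apply: h.
Qed.
Lemma mlim_unique m n (A : R -> 'M[C]_(m, n)) D E : mlim F A D -> mlim F A E -> D = E.
Proof. by move=> a b; apply/matrixP => p q; apply: clim_unique (a p q) (b p q). Qed.

Lemma cvg_rsum I (r : seq I) (g : I -> R -> R) (l : I -> R) :
  (forall i, g i @ F --> l i) -> (fun t => \sum_(i <- r) g i t) @ F --> \sum_(i <- r) l i.
Proof.
move=> h; elim: r => [|i r ih].
  by rewrite big_nil; under eq_fun do rewrite big_nil; apply: cvg_cst.
by rewrite big_cons; under eq_fun do rewrite big_cons; apply: cvgD.
Qed.
Lemma mlim_nsq m n (A : R -> 'M[C]_(m, n)) D : mlim F A D -> (fun s => nsq (A s)) @ F --> nsq D.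
Proof. by move=> h; do 2 (apply: cvg_rsum => ?); apply: clim_csq. Qed.
Lemma mlim_n1 m n (A : R -> 'M[C]_(m, n)) D : mlim F A D -> (fun s => n1 (A s)) @ F --> n1 D.
Proof.
move=> h; apply: cvg_rsum => p; apply: cvg_rsum => q; have [a b] := h p q.
by apply: cvgD; [exact: (cvg_norm a)|exact: (cvg_norm b)].
Qed.
End MatrixLimits.
End MatrixCalculus.

(** * Representations and path functionals *)

Section LinearAlgebra.
Variable F : fieldType.

(** Take a subspace of maximal dimension inside [P]: a vector of [P] outside it would enlarge it. *)
Lemma vspace_of_pred (vT : vectType F) (P : vT -> Prop) : P 0 ->
  (forall (c : F) u v, P u -> P v -> P (c *: u + v)) ->
  exists U : {vspace vT}, forall u, u \in U <-> P u.
Proof.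
move=> P0 Plin.
pose Q n := `[< exists U : {vspace vT}, (forall u, u \in U -> P u) /\ \dim U = n >].
have exQ : exists n, Q n.
  exists 0%N; apply/asboolP; exists 0%VS; split; last exact: dimv0.
  by move=> u; rewrite memv0 => /eqP ->.
have ubQ n : Q n -> (n <= \dim {:vT})%N.
  by move=> /asboolP[U [_ <-]]; apply/dimvS/subvf.
case: (ex_maxnP exQ ubQ) => n /asboolP[U [UP dU]] maxn; exists U => u; split; first exact: UP.
move=> Pu; apply: contrapT => /negP uU.
have : (\dim (U + <[u]>) <= n)%N.
  apply: maxn; apply/asboolP; exists (U + <[u]>)%VS; split=> // v.
  move=> /memv_addP[a aU [b /vlineP[k ->] ->]]; rewrite addrC.
  by apply: Plin => //; apply: UP.
rewrite -dU leqNgt => /negP; apply.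
rewrite ltn_neqAle dimvS ?addvSl // andbT.
apply/eqP => e; move/negP: uU; apply.
have /eqP -> : U == (U + <[u]>)%VS by rewrite eqEdim addvSl -e leqnn.
by rewrite memvE addvSr.
Qed.

(** Greedy choice: while the rows found do not span, some column of the cokernel is non-zero, hence
    detected by some [f t], which is then a new independent row. *)
Lemma separating_basis n (T : Type) (f : T -> 'rV[F]_n) :
  (forall c : 'cV[F]_n, (forall t, f t *m c = 0) -> c = 0) ->
  exists ps : 'I_n -> T, (\matrix_j f (ps j)) \in unitmx.
Proof.
move=> sep.
have step k : (k <= n)%N -> exists ps : 'I_k -> T, row_free (\matrix_j f (ps j)).
  elim: k => [|k ih] kn.
    by exists (fun i : 'I_0 => match notF (ltn_ord i) with end); rewrite -row_leq_rank.
  have [ps fr] := ih (ltnW kn); set A := \matrix_j f (ps j) in fr.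
  have [j cj] : exists j, col j (cokermx A) != 0.
    apply: contrapT => h.
    have : cokermx A = 0.
      apply/matrixP => p q; rewrite mxE; apply/eqP; apply: contrapT => /negP hp.
      apply: h; exists q; apply: contra hp => /eqP/matrixP/(_ p 0).
      by rewrite !mxE => ->.
    move/eqP; rewrite -mxrank_eq0 mxrank_coker subn_eq0 => nr.
    by have := leq_trans kn (leq_trans nr (rank_leq_row A)); rewrite ltnn.
  have [t ht] : exists t, f t *m col j (cokermx A) <> 0.
    apply: contrapT => h; move/eqP: cj; apply; apply: sep => t.
    by apply: contrapT => h'; apply: h; exists t.
  exists (fun i => if unlift ord0 i is Some i' then ps i' else t).
  apply/inj_row_free => v.
  rewrite mulmx_sum_row big_ord_recl rowK unlift_none => e.
  have e2 : \sum_(i < k) v 0 (lift ord0 i) *: f (ps i) =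
      (\row_i v 0 (lift ord0 i)) *m A.
    by rewrite mulmx_sum_row; apply: eq_bigr => i _; rewrite mxE rowK.
  have e3 : \sum_(i < k) v 0 (lift ord0 i) *: row (lift ord0 i)
     (\matrix_j f (if unlift ord0 j is Some i' then ps i' else t)) =
      (\row_i v 0 (lift ord0 i)) *m A.
    by rewrite -e2; apply: eq_bigr => i _; rewrite rowK liftK.
  rewrite e3 in e.
  have v0 : v 0 ord0 = 0.
    have := congr1 (mulmx^~ (col j (cokermx A))) e.
    rewrite mulmxDl -scalemxAl -mulmxA mul0mx.
    have -> : A *m col j (cokermx A) = 0 by rewrite colE mulmxA mulmx_coker mul0mx.
    rewrite mulmx0 addr0 => /eqP; rewrite scaler_eq0 => /orP[/eqP //|/eqP h].
    by case: ht.
  rewrite v0 scale0r add0r in e.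
  have : (\row_i v 0 (lift ord0 i)) = 0.
    by apply: (row_free_inj fr); rewrite e mul0mx.
  move=> /matrixP r0; apply/rowP => i; rewrite mxE.
  by case: (unliftP ord0 i) => [i' ->|-> //]; have := r0 0 i'; rewrite !mxE.
have [ps fr] := step n (leqnn n); exists ps.
by rewrite -row_free_unit.
Qed.

Lemma row_inj_mx n m (J : 'M[F]_(n, m)) :
  injective (fun b : 'cV[F]_m => J *m b) -> forall p (A : 'M[F]_(m, p)), J *m A = 0 -> A = 0.
Proof.
move=> inj p A h; apply/matrixP => i j.
have : col j A = 0 by apply: inj; rewrite mulmx0 colE mulmxA h mul0mx.
by move=> /matrixP/(_ i 0); rewrite !mxE.
Qed.

Lemma mx_inj_unit n (J : 'M[F]_n) : injective (fun b : 'cV[F]_n => J *m b) -> J \in unitmx.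
Proof.
move=> inj; rewrite -unitmx_tr -row_free_unit; apply/inj_row_free => v h.
apply: (can_inj (@trmxK _ _ _)); apply: inj; rewrite trmx0 mulmx0.
by apply: (can_inj (@trmxK _ _ _)); rewrite trmx_mul trmxK h trmx0.
Qed.

Lemma invmx_mul n (A B : 'M[F]_n) : A \in unitmx -> B \in unitmx ->
  invmx (A *m B) = invmx B *m invmx A.
Proof.
move=> uA uB; have uAB : A *m B \in unitmx by rewrite unitmx_mul uA.
by apply: (can_inj (mulmxK uAB)); rewrite mulVmx // -mulmxA mulKmx // mulVmx.
Qed.

End LinearAlgebra.

Section Paths.
Variables (R : realType) (Q : quiver) (inf : Q).
Notation C := R[i].

Fixpoint pcat (s d e : Q) (q : qpath d e) (p : qpath s d) : qpath s e :=
  match q in qpath _ e' return qpath s e' with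
  | Pnil => p
  | Pcons a q' => Pcons (pcat q' p)
  end.

Lemma path_eval_cat (w : dimvec Q) (x : rep R w) s d e (q : qpath d e) (p : qpath s d) :
  path_eval x (pcat q p) = path_eval x q *m path_eval x p.
Proof. by elim: q => [|a q ih] /=; rewrite ?mul1mx // ih mulmxA. Qed.

(** A formal combination is a list independent of the representation, so that one [L] can be
    evaluated in different dimension vectors; [rel_eval] is an instance by conversion. *)
Definition comb (w : dimvec Q) (x : rep R w) s d (L : seq (C * qpath s d)) : 'M[C]_(w d, w s) :=
  \sum_(t <- L) t.1 *: path_eval x t.2.

(** Cogeneration by the vertex [inf]: stability freed from slopes ([stable_cogen]), in a form that
    subrepresentations inherit and functionals can test. *)
Definition cogen (w : dimvec Q) (x : rep R w) := forall i (c : 'cV[C]_(w i)),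
  (forall p : qpath i inf, path_eval x p *m c = 0) -> c = 0.

Definition rel_le (w' w : dimvec Q) (z : rep R w') (x : rep R w) :=
  forall i (L : seq (C * qpath i inf)), comb x L = 0 -> comb z L = 0.

Definition is_hom (w' w : dimvec Q) (J : forall i, 'M[C]_(w i, w' i)) (z : rep R w') (x : rep R w) :=
  forall a, J (qhead a) *m z a = x a *m J (qtail a).

Definition mono (w' w : dimvec Q) (J : forall i, 'M[C]_(w i, w' i)) :=
  forall i, injective (fun b : 'cV[C]_(w' i) => J i *m b).

Lemma hom_path_eval (w' w : dimvec Q) (J : forall i, 'M[C]_(w i, w' i)) z x s d (p : qpath s d) :
  is_hom J z x -> J d *m path_eval z p = path_eval x p *m J s.
Proof.
move=> h; elim: p => [|a p ih] /=; first by rewrite mulmx1 mul1mx.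
by rewrite mulmxA h -!mulmxA ih.
Qed.

Lemma hom_comb (w' w : dimvec Q) (J : forall i, 'M[C]_(w i, w' i)) z x s d (L : seq (C * qpath s d)) :
  is_hom J z x -> J d *m comb z L = comb x L *m J s.
Proof.
move=> h; rewrite /comb mulmx_sumr mulmx_suml; apply: eq_bigr => t _.
by rewrite -scalemxAr -scalemxAl (hom_path_eval _ h).
Qed.

Lemma hom_nu_zero (w' w : dimvec Q) (J : forall i, 'M[C]_(w i, w' i)) z x rels :
  is_hom J z x -> mono J -> nu_zero rels x -> nu_zero rels z.
Proof.
move=> h inj; apply: sub_all => r /eqP e; apply/eqP.
by apply: (row_inj_mx (inj _)); rewrite (hom_comb _ h) [comb _ _]e mul0mx.
Qed.

Lemma hom_cogen (w' w : dimvec Q) (J : forall i, 'M[C]_(w i, w' i)) z x :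
  is_hom J z x -> mono J -> cogen x -> cogen z.
Proof.
move=> h inj cx i c hc; apply: inj; rewrite mulmx0; apply: cx => p.
by rewrite mulmxA -(hom_path_eval _ h) -mulmxA hc mulmx0.
Qed.

Lemma cogen_mx (w : dimvec Q) (x : rep R w) i n (A : 'M[C]_(w i, n)) : cogen x ->
  (forall p : qpath i inf, path_eval x p *m A = 0) -> A = 0.
Proof.
move=> cx h; apply/matrixP => p q.
have : col q A = 0 by apply: cx => r; rewrite colE mulmxA h mul0mx.
by move=> /matrixP/(_ p 0); rewrite !mxE.
Qed.

Section InfOne.
Variables (w : dimvec Q) (hw : w inf = 1%N).

Definition inf_ord : 'I_(w inf) := cast_ord (esym hw) ord0.

Lemma inf_ordE o : o = inf_ord.
Proof. by apply: (can_inj (cast_ordK hw)); by rewrite !ord1. Qed.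

Definition prow (x : rep R w) i (p : qpath i inf) : 'rV[C]_(w i) := row inf_ord (path_eval x p).

Definition crow (x : rep R w) i (L : seq (C * qpath i inf)) : 'rV[C]_(w i) := row inf_ord (comb x L).

Lemma row_inf_eq0 n (A : 'M[C]_(w inf, n)) : row inf_ord A = 0 -> A = 0.
Proof.
move=> /matrixP h; apply/matrixP => p q; have := h 0 q.
by rewrite !mxE (inf_ordE p).
Qed.

Lemma crow_eq0 x i (L : seq (C * qpath i inf)) : crow x L = 0 <-> comb x L = 0.
Proof. by split=> [/row_inf_eq0 //|e]; rewrite /crow e raddf0. Qed.

Lemma crowE x i (L : seq (C * qpath i inf)) : crow x L = \sum_(t <- L) t.1 *: prow x t.2.
Proof.
rewrite /crow /comb; elim: L => [|t L ih]; first by rewrite !big_nil raddf0.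
by rewrite !big_cons raddfD /= ih linearZ.
Qed.

(** Its invertibility says that the functionals of the paths [ps i] form a basis of the dual of V_i;
    its determinant later measures the distance to instability. *)
Definition pmx (x : rep R w) (ps : forall i : Q, 'I_(w i) -> qpath i inf) i : 'M[C]_(w i) :=
  \matrix_j prow x (ps i j).

Lemma cogen_basis (x : rep R w) : cogen x -> exists ps, forall i, pmx x ps i \in unitmx.
Proof.
move=> cx.
have /fin_all_exists : forall i : Q, exists ps : 'I_(w i) -> qpath i inf,
    (\matrix_j prow x (ps j)) \in unitmx.
  move=> i; apply: separating_basis => c h; apply: cx => p.
  by apply: row_inf_eq0; rewrite row_mul; apply: h.
by move=> [ps hps]; exists ps.
Qed.

Lemma pmx_cogen (x : rep R w) ps : (forall i, pmx x ps i \in unitmx) -> cogen x.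
Proof.
move=> u i c h; apply: (can_inj (mulKmx (u i))); rewrite mulmx0.
apply/row_matrixP => j; rewrite row_mul rowK row0 -row_mul h.
by apply/rowP => k; rewrite !mxE.
Qed.

End InfOne.

(* The functionals attached to paths ending at [inf] determine a cogenerated
   representation. *)
Lemma rel_le_hom (w' w : dimvec Q) (z : rep R w') (x : rep R w) :
  w' inf = 1%N -> w inf = 1%N -> cogen z -> cogen x -> rel_le z x ->
  exists J : forall i, 'M[C]_(w i, w' i), is_hom J z x /\ mono J.
Proof.
move=> hw' hw cz cx zx; have [ps u] := cogen_basis hw cx.
pose Z i : 'M[C]_(w i, w' i) := \matrix_j prow hw' z (ps i j).
pose J i := invmx (pmx hw x ps i) *m Z i.
have key i (p : qpath i inf) : prow hw x p *m J i = prow hw' z p.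
  pose v := prow hw x p *m invmx (pmx hw x ps i).
  have vE : v *m pmx hw x ps i = prow hw x p by rewrite mulmxKV.
  (* The relation expanding [p] in the basis [ps] of functionals of [x]. Since [z] satisfies it as
     well, the functional of [p] on [z] is the one on [x] composed with [J]. *)
  pose L := (1, p) :: [seq (- v 0 j, ps i j) | j <- enum 'I_(w i)].
  have LE (w2 : dimvec Q) (h2 : w2 inf = 1%N) (y : rep R w2) :
     crow h2 y L = prow h2 y p - v *m (\matrix_j prow h2 y (ps i j)).
    rewrite crowE big_cons scale1r big_map big_enum /= mulmx_sum_row -sumrN.
    by congr (_ + _); apply: eq_bigr => j _; rewrite rowK scaleNr.
  have : crow hw x L = 0 by rewrite LE -/(pmx hw x ps i) vE subrr.
  move=> /crow_eq0 /zx /(crow_eq0 hw'); rewrite LE => /eqP; rewrite subr_eq0 => /eqP ->.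
  by rewrite mulmxA.
have keyr i (p : qpath i inf) (c : 'cV[C]_(w' i)) : J i *m c = 0 -> path_eval z p *m c = 0.
  by move=> h; apply: (row_inf_eq0 (hw := hw')); rewrite row_mul -/(prow hw' z p) -key -mulmxA h mulmx0.
exists J; split => [a|i b b' /= e].
  apply/eqP; rewrite -subr_eq0; apply/eqP; apply: (cogen_mx cx) => p.
  apply: (row_inf_eq0 (hw := hw)); rewrite row_mul -/(prow hw x p) mulmxBr [X in X - _]mulmxA key [X in _ - X]mulmxA.
  have pa (w2 : dimvec Q) (h2 : w2 inf = 1%N) (y : rep R w2) :
     prow h2 y p *m y a = prow h2 y (pcat p (Pcons (Pnil (qtail a)))).
    by rewrite /prow path_eval_cat /= mulmx1 row_mul.
  by rewrite !pa key subrr.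
apply/eqP; rewrite -subr_eq0; apply/eqP; apply: cz => p; apply: keyr.
by rewrite mulmxBr e subrr.
Qed.

Lemma iso_class_act (w : dimvec Q) (x : rep R w) g : (forall i, g i \in unitmx) ->
  iso_class (act g x) = iso_class x.
Proof.
have act_act (g1 g2 : forall i, 'M[C]_(w i)) (y : rep R w) :
    (forall i, g1 i \in unitmx) -> (forall i, g2 i \in unitmx) ->
    act g1 (act g2 y) = act (fun i => g1 i *m g2 i) y.
  move=> u1 u2; apply: functional_extensionality_dep => a.
  by rewrite /act invmx_mul //= !mulmxA.
move=> ug; apply/seteqP; split => _ [h [uh ->]].
  by exists (fun i => h i *m g i); split; [move=> i; rewrite unitmx_mul uh ug|exact: act_act].
exists (fun i => h i *m invmx (g i)); split.
  by move=> i; rewrite unitmx_mul uh unitmx_inv ug.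
rewrite act_act //; last by move=> i; rewrite unitmx_mul uh unitmx_inv ug.
by congr act; apply: functional_extensionality_dep => i; rewrite mulmxKV.
Qed.

Lemma iso_class_refl (w : dimvec Q) (x : rep R w) : iso_class x x.
Proof.
exists (fun i => 1%:M); split=> [i|]; first exact: unitmx1.
by apply: functional_extensionality_dep => a; rewrite /act mul1mx invmx1 mulmx1.
Qed.

Lemma hom_iso_class (w : dimvec Q) (J : forall i, 'M[C]_(w i)) (z x : rep R w) :
  is_hom J z x -> mono J -> iso_class z = iso_class x.
Proof.
move=> h inj; have u i := mx_inj_unit (inj i).
rewrite -(iso_class_act z u); congr iso_class.
by apply: functional_extensionality_dep => a; rewrite /act h mulmxK.
Qed.

Lemma iso_class_hom (w : dimvec Q) (z x : rep R w) : iso_class z = iso_class x ->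
  exists J : forall i, 'M[C]_(w i), is_hom J z x /\ mono J.
Proof.
move=> e; have : iso_class z x by rewrite e; apply: iso_class_refl.
move=> [g [ug ->]]; exists g; split => [a|i]; first by rewrite /act mulmxKV.
exact: can_inj (mulKmx (ug i)).
Qed.

Lemma rel_le_iso_class (w : dimvec Q) (z x : rep R w) : w inf = 1%N ->
  cogen z -> cogen x -> rel_le z x -> iso_class z = iso_class x.
Proof. by move=> hw cz cx h; have [J [hJ iJ]] := rel_le_hom hw hw cz cx h; apply: hom_iso_class hJ iJ. Qed.

Lemma subrep_path (w : dimvec Q) (x : rep R w) (U : subfamily R w) s d (p : qpath s d) c :
  is_subrep x U -> c \in U s -> path_eval x p *m c \in U d.
Proof.
move=> sU cU; elim: p => [|a p ih] /=; first by rewrite mul1mx.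
by rewrite -mulmxA; apply: sU.
Qed.

(** The vectors killed by all paths to [inf] form a subrepresentation missing [inf], whose slope is
    not negative. Conversely a non-zero subrepresentation of a cogenerated one contains the line at
    [inf]; the numerator of its slope is then minus its codimension. *)
Lemma stable_cogen (w : dimvec Q) (x : rep R w) : w inf = 1%N -> stable inf x <-> cogen x.
Proof.
move=> hw.
have dimf i : \dim {:'cV[C]_(w i)} = w i by rewrite dimvf /dim /= muln1.
have dimle (U : subfamily R w) i : (\dim (U i) <= w i)%N by rewrite -[leqRHS]dimf dimvS ?subvf.
have slopeE (U : subfamily R w) : (\sum_i can_stab inf w i * (\dim (U i))%:Z) =
    (\sum_(i | i != inf) \dim (U i))%N%:Z - ((\sum_(j | j != inf) w j) * \dim (U inf))%N%:Z.
  rewrite (bigD1 inf) //= /can_stab eqxx mulNr -PoszM addrC; congr (_ - _).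
  rewrite -[RHS]natz natr_sum.
  by apply: eq_bigr => i /negPf ->; rewrite mul1r natz.
have possum (U : subfamily R w) : (exists i, U i != 0%VS) -> (0 < \sum_i \dim (U i))%N.
  move=> [i Ui]; rewrite (bigD1 i) //= ltn_addr // lt0n dimv_eq0 //.
split => [st i c hc|cx U sU nz pr].
  apply: contrapT => c0.
  have /fin_all_exists [U hU] : forall i, exists U : {vspace 'cV[C]_(w i)},
      forall c, c \in U <-> forall p : qpath i inf, path_eval x p *m c = 0.
    move=> j; apply: vspace_of_pred => [p|k u v hu hv p]; first by rewrite mulmx0.
    by rewrite mulmxDr -scalemxAr hu hv scaler0 addr0.
  have Uinf : U inf = 0%VS.
    apply/eqP; rewrite -subv0; apply/subvP => u /hU /(_ (Pnil inf)).
    by rewrite /= mul1mx => ->; rewrite mem0v.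
  have nz : exists i, U i != 0%VS.
    by exists i; apply/eqP => e; apply: c0; apply/eqP; rewrite -memv0 -e; apply/hU.
  have sU : is_subrep x U.
    move=> a u /hU h; apply/hU => p; have := h (pcat p (Pcons (Pnil (qtail a)))).
    by rewrite path_eval_cat /= mulmx1 mulmxA.
  have pr : exists i, U i != fullv.
    by exists inf; rewrite Uinf; apply/eqP => e; have := dimf inf; rewrite -e dimv0 hw.
  have := st U sU nz pr; rewrite /slope slopeE Uinf dimv0 muln0 subr0.
  by rewrite ltNge divr_ge0 // ler0z.
have [i Ui] := nz; have : exists2 c, c \in U i & c != 0.
  by exists (vpick (U i)); rewrite ?memv_pick ?vpick0.
move=> [c cU c0].
have [p hp] : exists p : qpath i inf, path_eval x p *m c != 0.
  apply: contrapT => h; move/eqP: c0; apply; apply: cx => p.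
  by apply: contrapT => /eqP h'; apply: h; exists p.
have d1 : \dim (U inf) = 1%N.
  apply/eqP; rewrite eqn_leq; have -> /= : (\dim (U inf) <= 1)%N by rewrite -[leqRHS]hw dimle.
  rewrite lt0n dimv_eq0; apply: contra hp => /eqP e.
  by rewrite -memv0 -e; apply: subrep_path.
have [j Uj] := pr.
have dj : (\dim (U j) < w j)%N.
  rewrite ltn_neqAle dimle andbT; apply: contra Uj => /eqP e.
  by rewrite eqEdim subvf dimf e leqnn.
have jinf : j != inf by apply: contraTneq dj => ->; rewrite d1 hw.
rewrite /slope slopeE d1 muln1 ltr_pdivrMr ?ltr0n ?possum // mul0r ltrz0 subr_lt0 ltz_nat.
by rewrite (bigD1 j) //= [ltnRHS](bigD1 j) //= -addSn leq_add // leq_sum.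
Qed.

End Paths.

(** * The gradient flow *)

Section Blocks.
Variables (R : realType) (Q : quiver).
Notation C := R[i].
Notation Re := complex.Re.
Implicit Types w : dimvec Q.

(** [conform_mx] merely transports [A] along the equality that the test decides. *)
Definition put w (i : Q) (A : 'M[C]_(w i)) (j : Q) : 'M[C]_(w j) :=
  if i == j then conform_mx 0 A else 0.

Lemma put_id w i (A : 'M[C]_(w i)) : put A i = A.
Proof. by rewrite /put eqxx conform_mx_id. Qed.
Lemma put_neq w i j (A : 'M[C]_(w i)) : i != j -> put A j = 0.
Proof. by rewrite /put => /negPf ->. Qed.
Lemma put0 w (i j : Q) : put (0 : 'M[C]_(w i)) j = 0.
Proof. by have [<-|ne] := eqVneq i j; rewrite ?put_id ?put_neq. Qed.
Lemma putD w i j (A B : 'M[C]_(w i)) : put (A + B) j = put A j + put B j.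
Proof. by have [<-|ne] := eqVneq i j; rewrite ?put_id ?put_neq ?addr0. Qed.
Lemma put_adj w i j (A : 'M[C]_(w i)) : adj (put A j) = put (adj A) j.
Proof. by have [<-|ne] := eqVneq i j; rewrite ?put_id ?put_neq ?adj0. Qed.
Lemma put_conj w w1 (J : forall i, 'M[C]_(w i, w1 i)) (K : forall i, 'M[C]_(w1 i, w i))
    i j (A : 'M[C]_(w1 i)) :
  J j *m put A j *m K j = put (J i *m A *m K i) j.
Proof. by have [<-|ne] := eqVneq i j; rewrite ?put_id ?put_neq ?mulmx0 ?mul0mx. Qed.
Lemma sum_tr_put w (u : forall i, 'M[C]_(w i)) i (A : 'M[C]_(w i)) :
  \sum_j \tr (u j *m put A j) = \tr (u i *m A).
Proof.
rewrite (bigD1 i) //= put_id big1 ?addr0 // => j; rewrite eq_sym => ne.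
by rewrite put_neq // mulmx0 raddf0.
Qed.
Lemma mder_put w i j (A : R -> 'M[C]_(w i)) t D : mder A t D ->
  mder (fun s => put (A s) j) t (put D j).
Proof.
move=> h; have [<-|ne] := eqVneq i j.
  by apply: mder_ext h => *; rewrite put_id.
by apply: mder_ext (mder_cst 0 t) => *; rewrite put_neq.
Qed.
Lemma mlim_put (F : set_system R) (FF : ProperFilter F) w i j (A : R -> 'M[C]_(w i)) D :
  mlim F A D -> mlim F (fun s => put (A s) j) (put D j).
Proof.
move=> h; have [<-|ne] := eqVneq i j.
  by apply: mlim_ext h => *; rewrite put_id.
by apply: mlim_ext (mlim_cst FF 0) => *; rewrite put_neq.
Qed.

(* The polarisation of [sum_a [x_a, x_a^*]]. *)
Definition hmu2 w (x y : rep R w) (i : Q) : 'M[C]_(w i) :=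
  \sum_a (put (x a *m adj (y a)) i - put (adj (y a) *m x a) i).

Definition hmu w (x : rep R w) := hmu2 x x.

Lemma momentE w (x : rep R w) i : moment x i = (2%:R * 'i%C)^-1 *: hmu x i.
Proof.
rewrite /moment; congr (_ *: _); apply: eq_bigr => a _ /=; congr (_ - _).
  rewrite /endo_mul /endo_adj /endo_of_edge.
  have [<-|ne] := eqVneq (qhead a) i.
    rewrite put_id (bigD1 (qtail a)) //= !eqxx conform_mx_id big1 ?addr0 // => l.
    by rewrite eq_sym => /negPf ->; rewrite mul0mx.
  by rewrite put_neq // big1 // => l _; rewrite mul0mx.
rewrite /endo_mul /endo_adj /endo_of_edge.
have [<-|ne] := eqVneq (qtail a) i.
  rewrite put_id (bigD1 (qhead a)) //= !eqxx conform_mx_id big1 ?addr0 // => l.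
  by rewrite eq_sym => /negPf ->; rewrite mulmx0.
by rewrite put_neq // big1 // => l _; rewrite andbF mulmx0.
Qed.

Lemma adj_hmu2 w (x y : rep R w) i : adj (hmu2 x y i) = hmu2 y x i.
Proof.
by rewrite /hmu2 adj_sum; apply: eq_bigr => a _; rewrite adjB !put_adj !adjM !adjK.
Qed.

Lemma adj_hmu w (x : rep R w) i : adj (hmu x i) = hmu x i.
Proof. exact: adj_hmu2. Qed.

(** The moment map identity, by cyclicity of the trace: [hmu2 y x] is the adjoint of the
    infinitesimal action at [x], applied to [y]. *)
Lemma tr_hmu2 w (x y : rep R w) (u : forall i, 'M[C]_(w i)) :
  \sum_i \tr (u i *m hmu2 x y i) = \sum_a \tr (inf_act x u a *m adj (y a)).
Proof.
under eq_bigr do rewrite mulmx_sumr raddf_sum.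
rewrite exchange_big; apply: eq_bigr => a _ /=.
under eq_bigr do rewrite mulmxBr raddfB.
rewrite sumrB !sum_tr_put /inf_act mulmxBl raddfB /= !mulmxA; congr (_ - _).
by rewrite -mulmxA mxtrace_mulC -!mulmxA mxtrace_mulC mulmxA.
Qed.

Lemma tr_hmu w (x : rep R w) : \sum_i \tr (hmu x i) = 0.
Proof.
have := tr_hmu2 x x (fun i => 1%:M); under eq_bigr do rewrite mul1mx.
by move=> ->; rewrite big1 // => a _; rewrite /inf_act mul1mx mulmx1 subrr mul0mx raddf0.
Qed.

Lemma mder_hmu2 w (x y : R -> rep R w) t (dx dy : rep R w) i :
  (forall a, mder (fun s => x s a) t (dx a)) -> (forall a, mder (fun s => y s a) t (dy a)) ->
  mder (fun s => hmu2 (x s) (y s) i) t (hmu2 dx (y t) i + hmu2 (x t) dy i).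
Proof.
move=> hx hy; rewrite /hmu2 -big_split /=.
apply: mder_sum => a _.
have h1 := mder_put (j := i) (mderM (hx a) (mder_adj (hy a))).
have h2 := mder_put (j := i) (mderM (mder_adj (hy a)) (hx a)).
by apply: mder_ext (mderB h1 h2) => //; rewrite !putD [X in _ - X]addrC opprD addrACA.
Qed.

Lemma mlim_hmu (F : set_system R) (FF : ProperFilter F) w (x : R -> rep R w) (l : rep R w) i :
  (forall a, mlim F (fun s => x s a) (l a)) -> mlim F (fun s => hmu (x s) i) (hmu l i).
Proof.
move=> h; apply: mlim_sum => a _; apply: mlimB; apply: mlim_put;
  by apply: mlimM => //; apply: mlim_adj.
Qed.

(* [Bf] is [i (mu - alpha)] when [c = alpha]; only its class modulo scalars
   matters for [bfield]. *)
Definition Bf (c : Q -> R) w (x : rep R w) (i : Q) : 'M[C]_(w i) :=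
  (2^-1)%:C%C *: hmu x i + ((c i)%:C%C)%:M.

Definition bfield (c : Q -> R) w (x : rep R w) : rep R w := fun a => - inf_act x (Bf c x) a.

Lemma conj_real (r : R) : conjc (r%:C%C) = r%:C%C.
Proof. by rewrite /= oppr0. Qed.

Lemma adj_Bf c w (x : rep R w) i : adj (Bf c x i) = Bf c x i.
Proof.
rewrite /Bf adjD adjZ adj_hmu conj_real; congr (_ + _).
by apply/matrixP => p q; rewrite adjE !mxE eq_sym; case: eqP => _; rewrite ?mulr1n ?mulr0n ?conj_real ?rmorph0.
Qed.

Lemma Bf_shifted_moment (alpha : Q -> int) w (x : rep R w) i :
  'i%C *: shifted_moment alpha x i = Bf (fun j => (alpha j)%:~R) x i.
Proof.
rewrite /shifted_moment momentE /stab_elt scalerBr scalerA scale_scalar_mx /Bf.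
have i2 : ('i : C)%C * 'i%C = -1 by rewrite -expr2 sqr_i.
have i0 : 'i%C != 0 :> C.
  by apply/eqP => h; move: i2; rewrite h mul0r => /eqP; rewrite eq_sym oppr_eq0 oner_eq0.
congr (_ *: _ + _).
  rewrite invfM mulrCA mulfV // mulr1 -[2%:R in LHS](rmorph_nat (real_complex R)).
  by rewrite -fmorphV.
by rewrite mulrA i2 mulN1r raddfN opprK rmorph_int.
Qed.

Lemma flow_fieldE (alpha : Q -> int) w (x : rep R w) a :
  flow_field alpha x a = bfield (fun j => (alpha j)%:~R) x a.
Proof.
rewrite /flow_field /bfield /inf_act -!Bf_shifted_moment scaleNr scalerBr.
by rewrite scalemxAl scalemxAr.
Qed.

Lemma bfield_shift (c c' : Q -> R) k w (x : rep R w) a : (forall i, c i = c' i + k) ->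
  bfield c x a = bfield c' x a.
Proof.
move=> h; have e i : Bf c x i = Bf c' x i + (k%:C%C)%:M.
  by rewrite /Bf h rmorphD [(_ + _)%:M]raddfD addrA.
rewrite /bfield /inf_act !e mulmxDl mulmxDr mul_scalar_mx mul_mx_scalar.
by congr (- _); rewrite opprD addrACA subrr addr0.
Qed.

Definition isflow c w (phi : R -> rep R w) t := forall a, mder (fun s => phi s a) t (bfield c (phi t) a).

Lemma gradient_flowE (alpha : Q -> int) w (y : rep R w) phi :
  gradient_flow alpha y phi <-> phi 0 = y /\ forall t, isflow (fun j => (alpha j)%:~R) phi t.
Proof.
split=> [[h0 h]|[h0 h]]; split => // t a p q; have := h t a p q; by rewrite flow_fieldE.
Qed.

Lemma mder_mlim m n (A : R -> 'M[C]_(m, n)) t D : mder A t D -> mlim (nbhs t) A (A t).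
Proof. by move=> h p q; have [d1 d2] := h p q; split; [exact: is_derive_continuous d1|exact: is_derive_continuous d2]. Qed.

Lemma mlim_Bf (F : set_system R) (FF : ProperFilter F) c w (x : R -> rep R w) (l : rep R w) i :
  (forall a, mlim F (fun s => x s a) (l a)) -> mlim F (fun s => Bf c (x s) i) (Bf c l i).
Proof. by move=> h; apply: mlimD; [apply: mlimZ; apply: mlim_hmu|apply: mlim_cst]. Qed.

Lemma mlim_path (F : set_system R) (FF : ProperFilter F) w (x : R -> rep R w) (l : rep R w)
    s d (p : qpath s d) :
  (forall a, mlim F (fun s => x s a) (l a)) -> mlim F (fun t => path_eval (x t) p) (path_eval l p).
Proof. by move=> h; elim: p => [|a p ih] /=; [apply: mlim_cst|apply: mlimM]. Qed.

Lemma mlim_comb (F : set_system R) (FF : ProperFilter F) w (x : R -> rep R w) (l : rep R w)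
    s d (L : seq (C * qpath s d)) :
  (forall a, mlim F (fun s => x s a) (l a)) -> mlim F (fun t => comb (x t) L) (comb l L).
Proof. by move=> h; apply: mlim_sum => t _; apply: mlimZ; apply: mlim_path. Qed.

(** The field is an infinitesimal gauge transformation, so the contributions of the intermediate
    vertices of a path cancel and only its two ends remain. *)
Lemma mder_path c w (phi : R -> rep R w) t s d (p : qpath s d) : isflow c phi t ->
  mder (fun u => path_eval (phi u) p) t
    (path_eval (phi t) p *m Bf c (phi t) s - Bf c (phi t) d *m path_eval (phi t) p).
Proof.
move=> h; elim: p => [|a p ih] /=.
  by apply: mder_ext (mder_cst 1%:M t) => //; rewrite mul1mx mulmx1 subrr.
apply: mder_ext (mderM (h a) ih) => //.
rewrite /bfield /inf_act mulNmx mulmxBl opprB mulmxBr !mulmxA.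
by rewrite addrC addrA subrK.
Qed.

Lemma mder_comb c w (phi : R -> rep R w) t s d (L : seq (C * qpath s d)) : isflow c phi t ->
  mder (fun u => comb (phi u) L) t
    (comb (phi t) L *m Bf c (phi t) s - Bf c (phi t) d *m comb (phi t) L).
Proof.
move=> h.
have := @mder_sum _ _ _ _ L xpredT _ _ _ (fun k _ => mderZ k.1 (mder_path k.2 h)).
apply: mder_ext => //.
rewrite /comb mulmx_suml mulmx_sumr -sumrB; apply: eq_bigr => k _.
by rewrite scalerBr -scalemxAl -scalemxAr.
Qed.

Section InfOne.
Variables (inf : Q) (w : dimvec Q) (hw : w inf = 1%N).

(** V_inf being a line, the Hermitian [Bf] acts on it by this real scalar, which makes the equation
    for functionals close up at each vertex. *)
Definition binf c (x : rep R w) : R := Re (\tr (Bf c x inf)).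

Lemma herm_real n (A : 'M[C]_n) p : adj A = A -> (Re (A p p))%:C%C = A p p.
Proof.
move=> h; have : A p p = conjc (A p p) by rewrite -{1}h adjE.
move: (A p p) => [a b] /= [] e; congr Complex; lra.
Qed.

Lemma Bf_inf c (x : rep R w) : Bf c x inf = ((binf c x)%:C%C)%:M.
Proof.
have h1 (A : 'M[C]_(w inf)) : A = (\tr A)%:M.
  by move: A; rewrite hw => A; rewrite trace_mx11 -mx11_scalar.
rewrite [LHS]h1; congr (_%:M).
have e : \tr (Bf c x inf) = Bf c x inf (inf_ord hw) (inf_ord hw).
  by rewrite {2}[Bf c x inf]h1 mxE eqxx.
by rewrite /binf e herm_real // adj_Bf.
Qed.

Lemma mder_crow c (phi : R -> rep R w) t i (L : seq (C * qpath i inf)) : isflow c phi t ->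
  mder (fun u => crow hw (phi u) L) t
    (crow hw (phi t) L *m Bf c (phi t) i - (binf c (phi t))%:C%C *: crow hw (phi t) L).
Proof.
move=> h p q; apply: cder_ext (mder_comb L h (inf_ord hw) q) => [s|]; first by rewrite !mxE.
by rewrite Bf_inf mul_scalar_mx -row_mul !mxE.
Qed.

Lemma innerZl_real m n (r : R) (A B : 'M[C]_(m, n)) : inner (r%:C%C *: A) B = r * inner A B.
Proof. by rewrite /inner -scalemxAl mxtraceZ Re_mul /= mul0r subr0. Qed.

(** Uniqueness for the linear equation [mder_crow], whose coefficients are bounded on the
    segment. *)
Lemma flow_comb_eq0 c (phi : R -> rep R w) a b t0 i (L : seq (C * qpath i inf)) : a <= t0 <= b ->
  (forall t, a <= t <= b -> isflow c phi t) -> comb (phi t0) L = 0 ->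
  forall t, a <= t <= b -> comb (phi t) L = 0.
Proof.
move=> t0ab fl e t tab; apply/(crow_eq0 hw)/nsq_eq0.
pose r t := crow hw (phi t) L.
pose g' t := 2 * inner (r t *m Bf c (phi t) i - (binf c (phi t))%:C%C *: r t) (r t).
have lim s : a <= s <= b -> forall e, mlim (nbhs s) (fun u => phi u e) (phi s e).
  by move=> /fl h e'; apply: mder_mlim (h e').
have [K1 hK1] : exists K, forall t, a <= t <= b -> `|n1 (Bf c (phi t) i)| <= K.
  apply: bounded_segment => s /lim h.
  exact: (mlim_n1 _ (A := fun u => Bf c (phi u) i) (mlim_Bf (i := i) _ c h)).
have [K2 hK2] : exists K, forall t, a <= t <= b -> `|n1 (Bf c (phi t) inf)| <= K.
  apply: bounded_segment => s /lim h.
  exact: (mlim_n1 _ (A := fun u => Bf c (phi u) inf) (mlim_Bf (i := inf) _ c h)).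
apply: (@gronwall_eq0 _ (fun t => nsq (r t)) g' (2 * (K1 * 2 + K2)) a b t0) => //.
- by move=> s /fl h; apply: mder_nsq; apply: mder_crow.
- move=> s sab; rewrite /g' innerBl innerZl_real inner_nsq normrM ger0_norm // -mulrA ler_wpM2l //.
  rewrite mulrDl; apply: (le_trans (ler_normB _ _)); apply: lerD.
    apply: (le_trans (inner_mul_le _ _ _)).
    have -> : nsq (r s) + nsq (r s) = 2 * nsq (r s) by ring.
    rewrite mulrA; apply: ler_wpM2r; first exact: nsq_ge0.
    by rewrite ler_wpM2r //; apply: le_trans (hK1 s sab); rewrite ler_norm.
  rewrite normrM (ger0_norm (nsq_ge0 _)) ler_wpM2r ?nsq_ge0 //.
  apply: le_trans (hK2 s sab); apply: le_trans (ler_norm _).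
  have -> : binf c (phi s) = Re (Bf c (phi s) inf (inf_ord hw) (inf_ord hw)).
    by rewrite Bf_inf mxE eqxx.
  exact: le_trans (Re_le_cabs _) (cabs_le_n1 _ _ _).
- by move=> s; apply: nsq_ge0.
- by rewrite /r /crow e row0 nsq0.
Qed.

End InfOne.
End Blocks.

(** * Real coordinates on Rep(Q, w), in which the flow is polynomial *)

Section Coordinates.
Variables (R : realType) (Q : quiver) (w : dimvec Q).
Notation C := R[i].
Notation Re := complex.Re.
Notation Im := complex.Im.

Definition entry := {a : edge Q & ('I_(w (qhead a)) * 'I_(w (qtail a)))%type}.

Definition ndim := #|{: entry * bool}|.

Definition enc (x : rep R w) (k : 'I_ndim) : R :=
  let: (e, b) := enum_val k in
  let z := x (tag e) (tagged e).1 (tagged e).2 in if b then Re z else Im z.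

Definition entry_rank (a : edge Q) p q (b : bool) : 'I_ndim :=
  enum_rank (@Tagged _ a (fun a => ('I_(w (qhead a)) * 'I_(w (qtail a)))%type) (p, q) : entry, b).

Definition dec (u : 'I_ndim -> R) : rep R w := fun a =>
  \matrix_(p, q) Complex (u (entry_rank p q true)) (u (entry_rank p q false)).

Lemma encK x : dec (enc x) = x.
Proof.
apply: functional_extensionality_dep => a; apply/matrixP => p q.
by rewrite mxE /enc !enum_rankK /=; case: (x a p q).
Qed.

Lemma decK u : enc (dec u) = u.
Proof.
apply/funext => k; rewrite /enc; case e: (enum_val k) => [[a [p q]] b] /=.
have -> : k = entry_rank p q b by rewrite -[LHS]enum_valK e.
by rewrite mxE; case: b e.
Qed.

Definition rnsq (x : rep R w) : R := \sum_a nsq (x a).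

Lemma rnsq_ge0 x : 0 <= rnsq x.
Proof. by apply: sumr_ge0 => a _; apply: nsq_ge0. Qed.

Lemma nsq_le_rnsq x a : nsq (x a) <= rnsq x.
Proof. by rewrite /rnsq (bigD1 a) //= lerDl sumr_ge0 // => b _; apply: nsq_ge0. Qed.

Lemma sum_enc (x y : rep R w) : \sum_k enc x k * enc y k = \sum_a inner (x a) (y a).
Proof.
transitivity (\sum_(eb : entry * bool)
  (let z := x (tag eb.1) (tagged eb.1).1 (tagged eb.1).2 in if eb.2 then Re z else Im z) *
  (let z := y (tag eb.1) (tagged eb.1).1 (tagged eb.1).2 in if eb.2 then Re z else Im z)).
  rewrite (reindex (@enum_val _ {: entry * bool})) /=; last first.
    by exists enum_rank => k _; rewrite ?enum_valK ?enum_rankK.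
  by apply: eq_bigr => k _; rewrite /enc; case: (enum_val k).
rewrite -(pair_bigA _ (fun (e : entry) (b : bool) =>
  (let z := x (tag e) (tagged e).1 (tagged e).2 in if b then Re z else Im z) *
  (let z := y (tag e) (tagged e).1 (tagged e).2 in if b then Re z else Im z))) /=.
under eq_bigr do rewrite big_bool /=.
pose G (a : edge Q) (pq : 'I_(w (qhead a)) * 'I_(w (qtail a))) :=
  Re (x a pq.1 pq.2) * Re (y a pq.1 pq.2) + Im (x a pq.1 pq.2) * Im (y a pq.1 pq.2).
transitivity (\sum_(e : entry) G (tag e) (tagged e)); first by [].
transitivity (\sum_a \sum_(pq : 'I_(w (qhead a)) * 'I_(w (qtail a))) G a pq).
  rewrite (@sig_big_dep _ _ _ _ (fun a => ('I_(w (qhead a)) * 'I_(w (qtail a)))%type) xpredT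
     (fun _ => xpredT) G) /=.
  by apply: eq_bigl.
apply: eq_bigr => a _; rewrite innerE.
by rewrite (pair_bigA _ (fun p q => Re (x a p q) * Re (y a p q) + Im (x a p q) * Im (y a p q))).
Qed.

Lemma enc_sqr x : \sum_k enc x k ^+ 2 = rnsq x.
Proof.
rewrite /rnsq -(eq_bigr _ (fun a _ => inner_nsq (x a))) -sum_enc.
by apply: eq_bigr => k _; rewrite expr2.
Qed.

Lemma enc_le x k : enc x k ^+ 2 <= rnsq x.
Proof. by rewrite -enc_sqr (bigD1 k) //= lerDl sumr_ge0 // => j _; apply: sqr_ge0. Qed.

Local Notation V := ('I_ndim -> R).

(** Only the existence of an expression matters, so closure properties replace writing the
    polynomials out. *)
Definition polyfun (g : V -> R) := exists p : pexp R ndim, forall u, g u = peval p u.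
Definition cpoly (g : V -> C) := polyfun (fun u => Re (g u)) /\ polyfun (fun u => Im (g u)).
Definition mpoly m n (A : V -> 'M[C]_(m, n)) := forall p q, cpoly (fun u => A u p q).

Lemma polyfun_ext g h : (forall u, g u = h u) -> polyfun g -> polyfun h.
Proof. by move=> gh [p hp]; exists p => u; rewrite -gh hp. Qed.
Lemma polyfunD g h : polyfun g -> polyfun h -> polyfun (fun u => g u + h u).
Proof. by move=> [p hp] [q hq]; exists (PD p q) => u; rewrite hp hq. Qed.
Lemma polyfunM g h : polyfun g -> polyfun h -> polyfun (fun u => g u * h u).
Proof. by move=> [p hp] [q hq]; exists (PM p q) => u; rewrite hp hq. Qed.
Lemma polyfunN g : polyfun g -> polyfun (fun u => - g u).
Proof. by move=> [p hp]; exists (PM (PC _ (-1)) p) => u; rewrite hp /= mulN1r. Qed.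
Lemma cpoly_ext g h : (forall u, g u = h u) -> cpoly g -> cpoly h.
Proof. by move=> gh [a b]; split; [apply: polyfun_ext a|apply: polyfun_ext b] => u; rewrite gh. Qed.
Lemma cpoly_cst z : cpoly (fun=> z).
Proof. by split; [exists (PC _ (Re z))|exists (PC _ (Im z))]. Qed.
Lemma cpolyD g h : cpoly g -> cpoly h -> cpoly (fun u => g u + h u).
Proof.
move=> [a b] [c d]; split.
  by apply: polyfun_ext (polyfunD a c) => u; rewrite Re_add.
by apply: polyfun_ext (polyfunD b d) => u; rewrite Im_add.
Qed.
Lemma cpolyN g : cpoly g -> cpoly (fun u => - g u).
Proof.
move=> [a b]; split.
  by apply: polyfun_ext (polyfunN a) => u; rewrite Re_opp.
by apply: polyfun_ext (polyfunN b) => u; rewrite Im_opp.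
Qed.
Lemma cpolyM g h : cpoly g -> cpoly h -> cpoly (fun u => g u * h u).
Proof.
move=> [a b] [c d]; split.
  by apply: polyfun_ext (polyfunD (polyfunM a c) (polyfunN (polyfunM b d))) => u; rewrite Re_mul.
by apply: polyfun_ext (polyfunD (polyfunM a d) (polyfunM b c)) => u; rewrite Im_mul.
Qed.
Lemma cpoly_conj g : cpoly g -> cpoly (fun u => conjc (g u)).
Proof.
move=> [a b]; split.
  by apply: polyfun_ext a => u; rewrite Re_conjc.
by apply: polyfun_ext (polyfunN b) => u; rewrite Im_conjc.
Qed.
Lemma cpoly_sum I (r : seq I) (P : pred I) (g : I -> V -> C) : (forall i, P i -> cpoly (g i)) ->
  cpoly (fun u => \sum_(i <- r | P i) g i u).
Proof.
move=> h; elim: r => [|i r ih].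
  by apply: cpoly_ext (cpoly_cst 0) => u; rewrite big_nil.
case Pi: (P i).
  by apply: cpoly_ext (cpolyD (h i Pi) ih) => u; rewrite big_cons Pi.
by apply: cpoly_ext ih => u; rewrite big_cons Pi.
Qed.
Lemma mpoly_ext m n (A B : V -> 'M[C]_(m, n)) : (forall u, A u = B u) -> mpoly A -> mpoly B.
Proof. by move=> AB h p q; apply: cpoly_ext (h p q) => u; rewrite AB. Qed.
Lemma mpoly_cst m n (A : 'M[C]_(m, n)) : mpoly (fun=> A).
Proof. by move=> p q; apply: cpoly_cst. Qed.
Lemma mpolyD m n (A B : V -> 'M[C]_(m, n)) : mpoly A -> mpoly B -> mpoly (fun u => A u + B u).
Proof. by move=> a b p q; apply: cpoly_ext (cpolyD (a p q) (b p q)) => u; rewrite mxE. Qed.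
Lemma mpolyN m n (A : V -> 'M[C]_(m, n)) : mpoly A -> mpoly (fun u => - A u).
Proof. by move=> a p q; apply: cpoly_ext (cpolyN (a p q)) => u; rewrite mxE. Qed.
Lemma mpolyZ m n c (A : V -> 'M[C]_(m, n)) : mpoly A -> mpoly (fun u => c *: A u).
Proof. by move=> a p q; apply: cpoly_ext (cpolyM (cpoly_cst c) (a p q)) => u; rewrite mxE. Qed.
Lemma mpolyM m n l (A : V -> 'M[C]_(m, n)) (B : V -> 'M[C]_(n, l)) :
  mpoly A -> mpoly B -> mpoly (fun u => A u *m B u).
Proof.
move=> a b p q; apply: (@cpoly_ext (fun u => \sum_k A u p k * B u k q)).
  by move=> u; rewrite mxE.
by apply: cpoly_sum => k _; apply: cpolyM.
Qed.
Lemma mpoly_adj m n (A : V -> 'M[C]_(m, n)) : mpoly A -> mpoly (fun u => adj (A u)).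
Proof. by move=> a p q; apply: cpoly_ext (cpoly_conj (a q p)) => u; rewrite adjE. Qed.
Lemma mpoly_sum m n I (r : seq I) (P : pred I) (A : I -> V -> 'M[C]_(m, n)) :
  (forall i, P i -> mpoly (A i)) -> mpoly (fun u => \sum_(i <- r | P i) A i u).
Proof.
move=> h p q; apply: (@cpoly_ext (fun u => \sum_(i <- r | P i) A i u p q)).
  by move=> u; rewrite summxE.
by apply: cpoly_sum => k Pk; apply: h.
Qed.
Lemma mpoly_put i j (A : V -> 'M[C]_(w i)) : mpoly A -> mpoly (fun u => put (A u) j).
Proof.
move=> h; have [<-|ne] := eqVneq i j.
  by apply: mpoly_ext h => u; rewrite put_id.
by apply: mpoly_ext (mpoly_cst 0) => u; rewrite put_neq.
Qed.
Lemma mpoly_dec a : mpoly (fun u => dec u a).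
Proof.
move=> p q; split.
  by exists (PX R (entry_rank p q true)) => u; rewrite mxE.
by exists (PX R (entry_rank p q false)) => u; rewrite mxE.
Qed.

Variable c : Q -> R.

Lemma mpoly_bfield a : mpoly (fun u => bfield c (dec u) a).
Proof.
have hB i : mpoly (fun u => Bf c (dec u) i).
  apply: mpolyD (mpoly_cst _); apply: mpolyZ; apply: mpoly_sum => b _.
  apply: mpolyD; last apply: mpolyN; apply: mpoly_put; apply: mpolyM;
    by [apply: mpoly_dec|apply: mpoly_adj; apply: mpoly_dec].
apply: mpolyN; apply: mpolyD; last apply: mpolyN; apply: mpolyM => //; exact: mpoly_dec.
Qed.

Lemma bfield_pexp : exists f : 'I_ndim -> pexp R ndim,
  forall u k, peval (f k) u = enc (bfield c (dec u)) k.
Proof.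
have h k : exists p : pexp R ndim, forall u, peval p u = enc (bfield c (dec u)) k.
  rewrite /enc; case: (enum_val k) => [[a [p q]] b] /=.
  have [[f hf] [g hg]] := mpoly_bfield p q.
  by case: b; [exists f|exists g] => u; rewrite ?hf ?hg.
by have [f hf] := choice h; exists f => u k; rewrite hf.
Qed.

Lemma solves_isflow f (psi : R -> V) t :
  (forall u k, peval (f k) u = enc (bfield c (dec u)) k) ->
  solves_at f psi t -> isflow c (fun s => dec (psi s)) t.
Proof.
move=> hf h a p q; split.
  apply: is_derive_ext (h (entry_rank p q true)) => [s|]; first by rewrite mxE.
  by rewrite hf /enc enum_rankK.
apply: is_derive_ext (h (entry_rank p q false)) => [s|]; first by rewrite mxE.
by rewrite hf /enc enum_rankK.
Qed.

Lemma isflow_near (phi psi : R -> rep R w) t : (\near t, phi t = psi t) ->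
  isflow c phi t -> isflow c psi t.
Proof.
move=> e h a; rewrite -(nbhs_singleton e); apply: mder_near (h a).
by apply: filterS e => s ->.
Qed.

Lemma isflow_shift (phi : R -> rep R w) s t : isflow c phi (t - s) -> isflow c (fun u => phi (u - s)) t.
Proof.
move=> h a p q; have [d1 d2] := h a p q.
have d0 : is_derive t (1 : R) (fun u => u - s) 1.
  apply: is_derive_ext (is_deriveD (is_derive_id t (1 : R)) (is_derive_cst (- s) t 1)) => //.
  by rewrite addr0.
split.
  have := @is_derive1_comp _ (fun v => Re (phi v a p q)) (fun u => u - s) t _ _ d1 d0.
  by rewrite mulr1.
have := @is_derive1_comp _ (fun v => Im (phi v a p q)) (fun u => u - s) t _ _ d2 d0.
by rewrite mulr1.
Qed.

Lemma isflow_glue (phi psi : R -> rep R w) s t : phi s = psi s ->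
  (t <= s -> isflow c phi t) -> (s <= t -> isflow c psi t) ->
  isflow c (fun u => if u <= s then phi u else psi u) t.
Proof.
move=> e h1 h2; case: (ltgtP t s) => ts.
- apply: isflow_near (h1 (ltW ts)); near=> u.
  by rewrite ifT //; apply/ltW; near: u; exact: lt_nbhsl.
- apply: isflow_near (h2 (ltW ts)); near=> u.
  by rewrite leNgt ifF //; apply/negbF; near: u; exact: lt_nbhsr.
- have tss : t <= s by rewrite ts.
  have sst : s <= t by rewrite ts.
  move=> a p q; have [d1 d2] := h1 tss a p q; have [d3 d4] := h2 sst a p q.
  rewrite ts in d1 d2 d3 d4 *; rewrite -e in d3 d4; rewrite lexx.
  split.
    apply: is_derive_ext (is_derive_glue _ d1 d3); [|by []|by rewrite e].
    by move=> u /=; case: ifP.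
  apply: is_derive_ext (is_derive_glue _ d2 d4); [|by []|by rewrite e].
  by move=> u /=; case: ifP.
Unshelve. all: by end_near. Qed.

Lemma flow_global (y : rep R w) (M : R) : rnsq y <= M ->
  (forall T h (phi : R -> rep R w), 0 < h -> 0 < T -> phi 0 = y ->
     (forall t, - h < t < T -> isflow c phi t) -> forall t, 0 <= t < T -> rnsq (phi t) <= M) ->
  exists (phi : R -> rep R w) h, [/\ 0 < h, phi 0 = y & forall t, - h < t -> isflow c phi t].
Proof.
move=> yM apr; have [f hf] := bfield_pexp.
have M0 : 0 <= M by apply: le_trans yM; apply: rnsq_ge0.
(* [M + 1] dominates the square root of [M] and is positive even when [M = 0]. *)
have bd x k : rnsq x <= M -> `|enc x k| <= M + 1.
  move=> xM; rewrite -(ler_pXn2r (n := 2)) ?nnegrE ?addr_ge0 // -normrX ger0_norm ?sqr_ge0 //.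
  apply: (le_trans (enc_le x k)); apply: (le_trans xM).
  by have := sqr_ge0 M; nra.
have [|||psi [h [h0 p0 hp]]] := @poly_ode_global R ndim f (M + 1) (enc y).
- by rewrite ltr_wpDl.
- by move=> i; apply: bd.
- move=> T h psi h0 T0 p0 hp t i ht; rewrite -(decK (psi t)); apply: bd.
  apply: (apr T h (fun s => dec (psi s))) => //; first by rewrite p0 encK.
  by move=> s hs; apply: solves_isflow hf _; apply: hp.
exists (fun s => dec (psi s)), h; split => //; first by rewrite p0 encK.
by move=> s hs; apply: solves_isflow hf _; apply: hp.
Qed.

End Coordinates.

(** * Evolution of the norm, the energy and the determinants along the flow *)

Section Energy.
Variables (R : realType) (Q : quiver) (inf : Q) (w : dimvec Q).
Hypothesis hw : w inf = 1%N.
Variable N : R.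
Notation C := R[i].
Notation Re := complex.Re.
Implicit Types (x : rep R w) (phi : R -> rep R w) (t : R).

Definition wsize : R := \sum_i (w i)%:R.
(** For N = |v| this is the difference between the eigenvalue 1 on x_2 and the one on x_1 when x_1
    has dimension [w]; see [crit_splitting_Bf]. *)
Definition slope_gap : R := N / wsize.

(* [alpha] shifted by the constant that makes [Bf] traceless. *)
Definition traceless_shift (i : Q) : R := slope_gap - N *+ (i == inf).

Local Notation c := traceless_shift.
Local Notation B := (Bf c).

Lemma wsize_gt0 : 0 < wsize.
Proof. by rewrite /wsize (bigD1 inf) //= hw ltr_pwDl // sumr_ge0. Qed.

Lemma slope_gap_size : slope_gap * wsize = N.
Proof. by rewrite divfK // gt_eqF // wsize_gt0. Qed.

Lemma Re_tr_scalar n (r : R) : Re (\tr ((r%:C%C)%:M : 'M[C]_n)) = r * n%:R.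
Proof. by rewrite mxtrace_scalar Re_mulrn mulr_natr. Qed.

Lemma sum_tr_Bf x : \sum_i Re (\tr (B x i)) = 0.
Proof.
have -> : \sum_i Re (\tr (B x i)) = 2^-1 * Re (\sum_i \tr (hmu x i)) + \sum_i c i * (w i)%:R.
  rewrite Re_sum mulr_sumr -big_split /=; apply: eq_bigr => i _.
  by rewrite /Bf mxtraceD Re_add Re_tr_scalar mxtraceZ Re_mul /= mul0r subr0.
rewrite tr_hmu mulr0 add0r /traceless_shift.
under eq_bigr do rewrite mulrBl.
rewrite sumrB -mulr_sumr slope_gap_size (bigD1 inf) //= eqxx hw mulr1 big1 ?addr0 ?subrr //.
by move=> i /negPf ->; rewrite mul0r.
Qed.

Definition energy x : R := \sum_i nsq (B x i).

Lemma energy_ge0 x : 0 <= energy x.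
Proof. by apply: sumr_ge0 => i _; apply: nsq_ge0. Qed.

Lemma energy_eq0 x : energy x = 0 -> forall i, B x i = 0.
Proof.
move=> h i; apply: nsq_eq0; apply/eqP; rewrite eq_le nsq_ge0 andbT -h /energy (bigD1 i) //=.
by rewrite lerDl sumr_ge0 // => j _; apply: nsq_ge0.
Qed.

Lemma is_derive_rsum I (r : seq I) (g : I -> R -> R) (dg : I -> R) t :
  (forall i, is_derive t (1 : R) (g i) (dg i)) ->
  is_derive t (1 : R) (fun s => \sum_(i <- r) g i s) (\sum_(i <- r) dg i).
Proof.
move=> hg; elim: r => [|i r ih].
  by apply: is_derive_ext (is_derive_cst 0 t (1 : R)) => *; rewrite big_nil.
by apply: is_derive_ext (is_deriveD (hg i) ih) => *; rewrite ?fctE big_cons.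
Qed.

Lemma is_derive_rprod I (r : seq I) (g : I -> R -> R) (k : I -> R) t :
  (forall i, is_derive t (1 : R) (g i) (k i * g i t)) ->
  is_derive t (1 : R) (fun s => \prod_(i <- r) g i s)
    ((\sum_(i <- r) k i) * \prod_(i <- r) g i t).
Proof.
move=> hg; elim: r => [|i r ih].
  by apply: is_derive_ext (is_derive_cst (1 : R) t (1 : R)) => *; rewrite ?big_nil ?mul0r.
apply: is_derive_ext (is_deriveM (hg i) ih) => [s|]; first by rewrite !fctE big_cons.
by rewrite !scale_mul !big_cons; ring.
Qed.

Lemma inner_inf_act x u : \sum_a inner (inf_act x u a) (x a) = \sum_i Re (\tr (u i *m hmu x i)).
Proof. by rewrite -!Re_sum tr_hmu2. Qed.

(** The moment map identity turns the derivative into traces of [B *m hmu]. Since hmu = 2 (B - c)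
    and [B] is traceless, only the part of [c] at [inf] survives besides the energy. *)
Lemma rnsq_flow phi t : isflow c phi t ->
  is_derive t (1 : R) (fun s => rnsq (phi s)) (- 4 * energy (phi t) - 4 * N * binf inf c (phi t)).
Proof.
move=> h; apply: is_derive_ext (is_derive_rsum (index_enum _) (fun a => mder_nsq (h a))) => //.
set x := phi t; rewrite -mulr_sumr.
have -> : \sum_a inner (bfield c x a) (x a) = - \sum_i Re (\tr (B x i *m hmu x i)).
  by rewrite -inner_inf_act -sumrN; apply: eq_bigr => a _; rewrite /bfield innerNl.
have e i : Re (\tr (B x i *m hmu x i)) = 2 * nsq (B x i) - 2 * c i * Re (\tr (B x i)).
  have -> : hmu x i = (2%:C%C) *: (B x i - ((c i)%:C%C)%:M).
    by rewrite /Bf addrK scalerA -rmorphM /= mulfV // scale1r.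
  rewrite -scalemxAr mulmxBr mxtraceZ mxtraceB mul_mx_scalar mxtraceZ.
  rewrite -inner_nsq /inner adj_Bf !(Re_mul, Re_add, Re_opp) /=; ring.
have ec : \sum_i c i * Re (\tr (B x i)) = - N * binf inf c x.
  rewrite /traceless_shift; under eq_bigr do rewrite mulrBl.
  rewrite sumrB -mulr_sumr sum_tr_Bf mulr0 sub0r (bigD1 inf) //= eqxx big1 ?addr0 ?mulNr //.
  by move=> i /negPf ->; rewrite mul0r.
under eq_bigr do rewrite e -mulrA.
rewrite sumrB -!mulr_sumr ec -/(energy x); ring.
Qed.

(** [Bf] varies by half the polarised moment map, and pairing this with [Bf] gives back the velocity
    by [tr_hmu2]: up to a factor this is the downward gradient flow of [energy]. *)
Lemma energy_flow phi t : isflow c phi t ->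
  is_derive t (1 : R) (fun s => energy (phi s)) (- 2 * rnsq (fun a => inf_act (phi t) (B (phi t)) a)).
Proof.
move=> h; set x := phi t; pose dx := bfield c x.
have hB i : mder (fun s => B (phi s) i) t ((2^-1)%:C%C *: (hmu2 dx x i + hmu2 x dx i)).
  apply: mder_ext (mderD (mderZ (2^-1)%:C%C (mder_hmu2 (i := i) h h)) (mder_cst ((c i)%:C%C)%:M t)) => //.
  by rewrite addr0.
apply: is_derive_ext (is_derive_rsum (index_enum _) (fun i => mder_nsq (hB i))) => //.
have e i : 2 * inner ((2^-1)%:C%C *: (hmu2 dx x i + hmu2 x dx i)) (B x i) =
           2 * Re (\tr (B x i *m hmu2 x dx i)).
  rewrite innerZl_real innerDl -{1}(adj_hmu2 x dx) -{1}(adj_Bf c x) inner_adj.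
  rewrite {1 2}/inner adj_Bf mxtrace_mulC; lra.
rewrite (eq_bigr _ (fun i _ => e i)) -mulr_sumr -Re_sum tr_hmu2 Re_sum mulNr -mulrN; congr (_ * _).
rewrite /rnsq -sumrN; apply: eq_bigr => a _.
by rewrite -inner_nsq -[LHS]/(inner (inf_act x (B x) a) (dx a)) innerC /dx /bfield innerNl.
Qed.

Variable ps : forall i : Q, 'I_(w i) -> qpath i inf.
Local Notation P := (pmx hw ^~ ps).

Lemma pmx_flow phi t i : isflow c phi t ->
  mder (fun s => P (phi s) i) t (P (phi t) i *m (B (phi t) i - ((binf inf c (phi t))%:C%C)%:M)).
Proof.
move=> h j q; have := mder_crow hw [:: (1, ps j)] h 0 q.
have e x : crow hw x [:: (1, ps j)] = row j (P x i).
  by rewrite crowE big_seq1 scale1r rowK.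
apply: cder_ext => [s|]; first by rewrite e mxE.
by rewrite e mulmxBr mul_mx_scalar -row_mul !mxE.
Qed.

Lemma csq_det_flow phi t i : isflow c phi t ->
  is_derive t (1 : R) (fun s => csq (\det (P (phi s) i)))
    (2 * (Re (\tr (B (phi t) i)) - (w i)%:R * binf inf c (phi t)) * csq (\det (P (phi t) i))).
Proof.
move=> h; have := cder_csq (cder_det (pmx_flow (i := i) h)).
apply: is_derive_ext => //.
set D := (B _ _ - _); set A := P _ _.
rewrite mxtrace_mulC mulmxA mul_adj_mx mul_scalar_mx mxtraceZ.
have -> : Re (\tr (B (phi t) i)) - (w i)%:R * binf inf c (phi t) = Re (\tr D).
  by rewrite mxtraceB Re_add Re_opp Re_tr_scalar mulrC.
rewrite /csq !(Re_mul, Im_mul, Re_conjc, Im_conjc); ring.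
Qed.

(* The exponent balances the trace of [Bf] at [inf] in [rnsq_flow] against the
   one in [csq_det_flow]. *)
Definition stab_fun x : R :=
  expR (- (2 * slope_gap)^-1 * rnsq x) * \prod_i csq (\det (P x i)).

Lemma stab_fun_flow phi t : 0 < N -> isflow c phi t ->
  is_derive t (1 : R) (fun s => stab_fun (phi s)) (2 / slope_gap * energy (phi t) * stab_fun (phi t)).
Proof.
move=> N0 h.
have g0 : 0 < slope_gap by rewrite divr_gt0 // wsize_gt0.
have d1 := is_derive_rprod (index_enum _) (fun i => csq_det_flow i h).
pose k := - (2 * slope_gap)^-1.
have d2 : is_derive t (1 : R) (fun s => k * rnsq (phi s))
    (k * (- 4 * energy (phi t) - 4 * N * binf inf c (phi t))).
  by apply: is_derive_ext (is_deriveZ k (rnsq_flow h)).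
have d3 : is_derive t (1 : R) (fun s => expR (k * rnsq (phi s)))
    (expR (k * rnsq (phi t)) * (k * (- 4 * energy (phi t) - 4 * N * binf inf c (phi t)))).
  exact: (@is_derive1_comp _ expR (fun s => k * rnsq (phi s)) _ _ _ (is_derive_expR _) d2).
apply: is_derive_ext (is_deriveM d3 d1) => //.
rewrite !scale_mul /stab_fun -/k.
have -> : \sum_i 2 * (Re (\tr (B (phi t) i)) - (w i)%:R * binf inf c (phi t)) =
   - 2 * wsize * binf inf c (phi t).
  rewrite -mulr_sumr sumrB sum_tr_Bf sub0r -mulr_suml; rewrite /wsize; ring.
have -> : wsize = N / slope_gap by rewrite -slope_gap_size mulrAC divff ?mul1r // gt_eqF.
set E := expR _; set Pr := \prod_i _; set e := energy _; set b := binf _ _ _.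
by rewrite /k; move: E Pr e b => E Pr e b; field; rewrite gt_eqF.
Qed.

End Energy.

(** * Uniform bounds on bounded sets of representations *)

Section PolynomialGrowth.
Variables (R : realType) (Q : quiver) (w : dimvec Q).
Notation C := R[i].
Implicit Types (x : rep R w) (g h : rep R w -> C).

(** Being closed under sums and products, this class yields bounds on balls without a compactness
    argument, and its polynomial order is what [stab_fun_bound] compares with an exponential. *)
Definition pgrow g := exists K m, 0 <= K /\ forall x, csq (g x) <= K * (1 + rnsq x) ^+ m.

Lemma pgrow_ext g h : (forall x, g x = h x) -> pgrow g -> pgrow h.
Proof. by move=> gh [K [m [K0 hK]]]; exists K, m; split=> // x; rewrite -gh. Qed.

Lemma pgrow_cst z : pgrow (fun=> z).
Proof. by exists (csq z), 0%N; split=> [|x]; rewrite ?csq_ge0 // expr0 mulr1. Qed.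

Let base1 x : 1 <= 1 + rnsq x. Proof. by rewrite lerDl rnsq_ge0. Qed.

Lemma pgrowM g h : pgrow g -> pgrow h -> pgrow (fun x => g x * h x).
Proof.
move=> [K [m [K0 hK]]] [L [n [L0 hL]]]; exists (K * L), (m + n)%N; split=> [|x].
  exact: mulr_ge0.
by rewrite csqM exprD mulrACA ler_pM ?csq_ge0.
Qed.

Lemma pgrowD g h : pgrow g -> pgrow h -> pgrow (fun x => g x + h x).
Proof.
move=> [K [m [K0 hK]]] [L [n [L0 hL]]]; exists (2 * (K + L)), (m + n)%N; split=> [|x].
  by rewrite mulr_ge0 // addr_ge0.
have hz (z z' : C) : csq (z + z') <= 2 * (csq z + csq z').
  rewrite /csq Re_add Im_add.
  have := sqr_ge0 (complex.Re z - complex.Re z').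
  have := sqr_ge0 (complex.Im z - complex.Im z'); nra.
apply: (le_trans (hz _ _)); rewrite -mulrA ler_wpM2l // mulrDl; apply: lerD.
  by apply: (le_trans (hK x)); rewrite ler_wpM2l // ler_weXn2l ?base1 // leq_addr.
by apply: (le_trans (hL x)); rewrite ler_wpM2l // ler_weXn2l ?base1 // leq_addl.
Qed.

Lemma pgrow_sum I (r : seq I) (P : pred I) (g : I -> rep R w -> C) : (forall i, P i -> pgrow (g i)) ->
  pgrow (fun x => \sum_(i <- r | P i) g i x).
Proof.
move=> h; elim: r => [|i r ih].
  by apply: pgrow_ext (pgrow_cst 0) => x; rewrite big_nil.
case Pi: (P i).
  by apply: pgrow_ext (pgrowD (h i Pi) ih) => x; rewrite big_cons Pi.
by apply: pgrow_ext ih => x; rewrite big_cons Pi.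
Qed.

Lemma pgrow_prod I (r : seq I) (P : pred I) (g : I -> rep R w -> C) : (forall i, P i -> pgrow (g i)) ->
  pgrow (fun x => \prod_(i <- r | P i) g i x).
Proof.
move=> h; elim: r => [|i r ih].
  by apply: pgrow_ext (pgrow_cst 1) => x; rewrite big_nil.
case Pi: (P i).
  by apply: pgrow_ext (pgrowM (h i Pi) ih) => x; rewrite big_cons Pi.
by apply: pgrow_ext ih => x; rewrite big_cons Pi.
Qed.

Lemma pgrow_path s d (p : qpath s d) a b : pgrow (fun x => path_eval x p a b).
Proof.
elim: p a b => [|e p ih] a b /=; first exact: pgrow_cst.
apply: (@pgrow_ext (fun x => \sum_k x e a k * path_eval x p k b)); first by move=> x; rewrite mxE.
apply: pgrow_sum => k _; apply: pgrowM => //.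
exists 1, 1%N; split=> // x; rewrite mul1r expr1.
apply: (le_trans (csq_le_nsq _ _ _)); apply: (le_trans (nsq_le_rnsq _ _)).
by rewrite lerDr.
Qed.

Lemma pgrow_det n (A : rep R w -> 'M[C]_n) : (forall a b, pgrow (fun x => A x a b)) ->
  pgrow (fun x => \det (A x)).
Proof.
move=> h; apply: pgrow_sum => s _; apply: pgrowM; first exact: pgrow_cst.
by apply: pgrow_prod => i _; apply: h.
Qed.

Lemma pgrow_adjugate n (A : rep R w -> 'M[C]_n) : (forall a b, pgrow (fun x => A x a b)) ->
  forall a b, pgrow (fun x => (\adj (A x)) a b).
Proof.
move=> h a b; apply: (@pgrow_ext (fun x => (-1) ^+ (b + a) * \det (row' b (col' a (A x))))).
  by move=> x; rewrite mxE.
apply: pgrowM; first exact: pgrow_cst.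
apply: pgrow_det => k l.
by apply: pgrow_ext (h (lift b k) (lift a l)) => x; rewrite !mxE.
Qed.

Lemma pgrow_bounded g M : pgrow g -> 0 <= M ->
  exists2 K, 0 <= K & forall x, rnsq x <= M -> cabs (g x) <= K.
Proof.
move=> [K [m [K0 hK]]] M0; exists (Num.sqrt (2 * (K * (1 + M) ^+ m))); first exact: sqrtr_ge0.
move=> x xM; rewrite -[leLHS](@ger0_norm _ _) ?cabs_ge0 // -sqrtr_sqr; apply: ler_wsqrtr.
apply: (le_trans (cabs_le_csq _)); rewrite ler_wpM2l //; apply: (le_trans (hK x)).
rewrite ler_wpM2l // lerXn2r ?nnegrE ?addr_ge0 ?rnsq_ge0 //.
by rewrite lerD2l.
Qed.

Lemma pgrow_n1_bounded n m (A : rep R w -> 'M[C]_(n, m)) M : (forall a b, pgrow (fun x => A x a b)) ->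
  0 <= M -> exists2 K, 0 <= K & forall x, rnsq x <= M -> n1 (A x) <= K.
Proof.
move=> h M0.
have /fin_all_exists [K hK] (ab : 'I_n * 'I_m) : exists K, 0 <= K /\
    forall x, rnsq x <= M -> cabs (A x ab.1 ab.2) <= K.
  by have [K K0 hK] := pgrow_bounded (h ab.1 ab.2) M0; exists K.
exists (\sum_a \sum_b K (a, b)).
  by apply: sumr_ge0 => a _; apply: sumr_ge0 => b _; case: (hK (a, b)).
by move=> x xM; apply: ler_sum => a _; apply: ler_sum => b _; apply: (hK (a, b)).2.
Qed.

Lemma n1_sqr_le m n (A : 'M[C]_(m, n)) : n1 A ^+ 2 <= 2 * (m%:R * n%:R) ^+ 2 * nsq A.
Proof.
have e (z : C) : csq z <= nsq A -> cabs z <= Num.sqrt (2 * nsq A).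
  move=> hz; rewrite -[leLHS](@ger0_norm _ _) ?cabs_ge0 // -sqrtr_sqr; apply: ler_wsqrtr.
  by apply: (le_trans (cabs_le_csq _)); rewrite ler_wpM2l.
have : n1 A <= m%:R * n%:R * Num.sqrt (2 * nsq A).
  apply: (@le_trans _ _ (\sum_(p < m) \sum_(q < n) Num.sqrt (2 * nsq A))).
    by apply: ler_sum => p _; apply: ler_sum => q _; apply: e; apply: csq_le_nsq.
  rewrite !sumr_const !card_ord -mulrnA -[leLHS]mulr_natr natrM.
  by rewrite mulrC [m%:R * _]mulrC.
move=> h; apply: (@le_trans _ _ ((m%:R * n%:R * Num.sqrt (2 * nsq A)) ^+ 2)).
  by rewrite lerXn2r // nnegrE ?n1_ge0 // !mulr_ge0 // sqrtr_ge0.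
by rewrite exprMn sqr_sqrtr ?mulr_ge0 ?nsq_ge0 //; eqle.
Qed.

Lemma n1_scalar n (z : C) : n1 (z%:M : 'M[C]_n) <= n%:R * cabs z.
Proof.
rewrite /n1 mulr_natl -[X in _ *+ X]card_ord -sumr_const; apply: ler_sum => p _.
rewrite (bigD1 p) //= mxE eqxx mulr1n big1 ?addr0 // => q /negPf.
by rewrite mxE eq_sym => ->; rewrite mulr0n cabs0.
Qed.

Lemma n1Z m n (z : C) (A : 'M[C]_(m, n)) : n1 (z *: A) <= cabs z * n1 A.
Proof.
rewrite /n1 mulr_sumr; apply: ler_sum => p _; rewrite mulr_sumr; apply: ler_sum => q _.
by rewrite mxE cabsM.
Qed.

Lemma n1N m n (A : 'M[C]_(m, n)) : n1 (- A) = n1 A.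
Proof. by apply: eq_bigr => p _; apply: eq_bigr => q _; rewrite mxE /cabs Re_opp Im_opp !normrN. Qed.

Definition comm_size x (u : forall i, 'M[C]_(w i)) : R := \sum_a n1 (inf_act x u a).

Lemma comm_size_ge0 x u : 0 <= comm_size x u.
Proof. by apply: sumr_ge0 => a _; apply: n1_ge0. Qed.

(** The commutator with a product of edges telescopes into commutators with single edges. *)
Lemma path_comm_bound s d (p : qpath s d) M : 0 <= M -> exists2 K, 0 <= K & forall x u,
  rnsq x <= M -> n1 (u d *m path_eval x p - path_eval x p *m u s) <= K * comm_size x u.
Proof.
move=> M0; elim: p => [|a p [K K0 hK]].
  exists 0 => // x u _; rewrite /= mulmx1 mul1mx subrr mul0r /n1 big1 // => i _.
  by rewrite big1 // => j _; rewrite mxE cabs0.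
have [L L0 hL] := pgrow_n1_bounded (pgrow_path p) M0.
have [L' L'0 hL'] : exists2 K, 0 <= K & forall x, rnsq x <= M -> n1 (x a) <= K.
  apply: pgrow_n1_bounded => // k l.
  have := pgrow_path (Pcons (Pnil (qtail a))) k l.
  by apply: pgrow_ext => x /=; rewrite mulmx1.
exists (L + L' * K); first by rewrite addr_ge0 // mulr_ge0.
move=> x u xM /=.
have -> : u (qhead a) *m (x a *m path_eval x p) - x a *m path_eval x p *m u s =
   inf_act x u a *m path_eval x p +
   x a *m (u (qtail a) *m path_eval x p - path_eval x p *m u s).
  by rewrite /inf_act mulmxBl mulmxBr !mulmxA addrA subrK.
apply: (le_trans (n1D _ _)); rewrite mulrDl; apply: lerD.
  apply: (le_trans (n1M _ _)); rewrite mulrC ler_pM ?n1_ge0 ?hL //.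
  by rewrite /comm_size (bigD1 a) //= lerDl sumr_ge0 // => b _; apply: n1_ge0.
apply: (le_trans (n1M _ _)); rewrite -mulrA ler_pM ?n1_ge0 ?hL' //.
exact: hK.
Qed.

Lemma comm_size_sqr_le : exists2 K, 0 <= K & forall x u,
  comm_size x u ^+ 2 <= K * rnsq (fun a => inf_act x u a).
Proof.
pose k a : R := 2 * ((w (qhead a))%:R * (w (qtail a))%:R) ^+ 2.
have k0 a : 0 <= k a by rewrite mulr_ge0 // sqr_ge0.
exists ((\sum_a Num.sqrt (k a)) ^+ 2); first exact: sqr_ge0.
move=> x u; set c := rnsq _; have c0 : 0 <= c by apply: rnsq_ge0.
rewrite -[c]sqr_sqrtr // -exprMn lerXn2r // ?nnegrE ?comm_size_ge0 //.
  by rewrite mulr_ge0 ?sqrtr_ge0 // sumr_ge0 // => a _; rewrite sqrtr_ge0.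
rewrite /comm_size mulr_suml; apply: ler_sum => a _.
rewrite -sqrtrM // -[leLHS](@ger0_norm _ _) ?n1_ge0 // -sqrtr_sqr; apply: ler_wsqrtr.
apply: (le_trans (n1_sqr_le _)); rewrite ler_wpM2l //.
exact: (nsq_le_rnsq (fun a => inf_act x u a)).
Qed.

End PolynomialGrowth.

(** * Convergence of the forward flow from a stable point *)

Section ForwardFlow.
Variables (R : realType) (Q : quiver) (inf : Q) (w : dimvec Q).
Hypothesis hw : w inf = 1%N.
Variables (N : R) (N0 : 0 < N).
Notation C := R[i].
Notation Re := complex.Re.
Notation Im := complex.Im.
Implicit Types (x : rep R w) (phi : R -> rep R w).
Local Notation c := (traceless_shift inf w N).
Local Notation B := (Bf c).

Section Basis.
Variable ps : forall i : Q, 'I_(w i) -> qpath i inf.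
Local Notation P := (pmx hw ^~ ps).

Definition bigdet x : C := \prod_i \det (P x i).

Lemma csq_prod I (r : seq I) (F : I -> C) : csq (\prod_(i <- r) F i) = \prod_(i <- r) csq (F i).
Proof.
elim: r => [|i r ih]; last by rewrite !big_cons csqM ih.
by rewrite !big_nil /csq /= expr1n expr0n addr0.
Qed.

Lemma stab_funE x : stab_fun hw N ps x =
  expR (- (2 * slope_gap w N)^-1 * rnsq x) * csq (bigdet x).
Proof. by rewrite /bigdet csq_prod. Qed.

Lemma pgrow_pmx i a b : pgrow (fun x => P x i a b).
Proof.
apply: (@pgrow_ext R Q w (fun x => path_eval x (ps a) (inf_ord hw) b)).
  by move=> x; rewrite !mxE.
exact: pgrow_path.
Qed.

Lemma slope_gap_gt0 : 0 < slope_gap w N.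
Proof. by rewrite divr_gt0 // (wsize_gt0 _ hw). Qed.

(** The determinant grows polynomially while the exponential factor decays, so superlevel sets are
    bounded. As that factor is at most 1, the determinant stays away from 0 on them. *)
Lemma stab_fun_bound (delta : R) : 0 < delta -> exists2 M, 0 <= M & forall x,
  delta <= stab_fun hw N ps x -> rnsq x <= M /\ delta <= csq (bigdet x).
Proof.
move=> d0; have g0 := slope_gap_gt0.
have [K [m [K0 hK]]] : pgrow bigdet.
  by apply: pgrow_prod => i _; apply: pgrow_det => a b; apply: pgrow_pmx.
pose k := (2 * slope_gap w N)^-1.
have k0 : 0 < k by rewrite invr_gt0 mulr_gt0.
(* From exp(z) >= z^(m + 1) / (m + 1)!: one degree more than the growth of the determinant, so that
   for S > 1 the comparison leaves a bound on S itself. *)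
pose F := (m.+1)`!%:R : R.
have F0 : 0 < F by rewrite ltr0n fact_gt0.
pose L := delta * k ^+ m.+1 / F.
have L0 : 0 < L by rewrite divr_gt0 // mulr_gt0 // exprn_gt0.
have KL0 : 0 <= K * 2 ^+ m / L.
  by apply: divr_ge0; [apply: mulr_ge0 => //; exact: exprn_ge0|exact: ltW].
exists (1 + K * 2 ^+ m / L); first exact: addr_ge0.
move=> x; rewrite stab_funE -/k; set S := rnsq x; have S0 : 0 <= S := rnsq_ge0 x.
move=> h; split; last first.
  apply: (le_trans h); rewrite ler_piMl ?csq_ge0 // expR_le1 mulNr oppr_le0.
  by rewrite mulr_ge0 // ltW.
have [S1|S1] := leP S 1.
  by apply: (le_trans S1); rewrite lerDl.
have Sp : 0 < S by lra.
apply: (@le_trans _ _ (K * 2 ^+ m / L)); last by rewrite lerDr.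
rewrite ler_pdivlMr // -(ler_pM2r (exprn_gt0 m Sp)).
have h2 : delta * expR (k * S) <= K * (1 + S) ^+ m.
  rewrite -(ler_pM2l (expR_gt0 (- k * S))) mulrCA -expRD mulNr addNr expR0 mulr1.
  by apply: (le_trans h); rewrite mulNr ler_wpM2l ?expR_ge0 ?hK.
have h3 : (k * S) ^+ m.+1 / F <= expR (k * S).
  by apply: le_trans (expR_ge1Dxn m _); rewrite ?lerDr // mulr_ge0 // ltW.
apply: (@le_trans _ _ (delta * expR (k * S))).
  apply: le_trans (ler_wpM2l (ltW d0) h3); rewrite /L exprMn exprS [S ^+ m.+1]exprS; eqle.
apply: (le_trans h2); rewrite -mulrA ler_wpM2l // -exprMn lerXn2r ?nnegrE //.
- by rewrite addr_ge0.
- by rewrite mulr_ge0.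
- by lra.
Qed.

Lemma n1_row m n (A : 'M[C]_(m, n)) o : n1 (row o A) <= n1 A.
Proof.
rewrite /n1 big_ord1 (eq_bigr (fun q => cabs (A o q))) => [|q _]; last by rewrite mxE.
by rewrite [leRHS](bigD1 o) //= lerDl sumr_ge0 // => p _; apply: sumr_ge0 => q _; apply: cabs_ge0.
Qed.

Lemma n1_rows m n (A : 'M[C]_(m, n)) : n1 A = \sum_p n1 (row p A).
Proof.
apply: eq_bigr => p _; rewrite /n1 big_ord1; apply: eq_bigr => q _; by rewrite mxE.
Qed.

Lemma Re_tr_le n (A : 'M[C]_n) : `|Re (\tr A)| <= n1 A.
Proof.
apply: (le_trans (Re_le_cabs _)); apply: (le_trans (cabs_sum _ _ _)); apply: ler_sum => p _.
by rewrite (bigD1 p) //= lerDl sumr_ge0 // => q _; apply: cabs_ge0.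
Qed.

(* Endomorphisms of a stable representation are scalar: quantitatively, [B]
   minus its scalar at [inf] is controlled by the commutator. *)
Lemma Bf_minus_scalar_bound (delta M : R) i : 0 < delta -> 0 <= M ->
  exists2 K, 0 <= K & forall x, rnsq x <= M -> delta <= csq (bigdet x) ->
    n1 (B x i - ((binf inf c x)%:C%C)%:M) <= K * comm_size x (B x).
Proof.
move=> d0 M0.
pose G x : 'M[C]_(w i) := (\prod_(j | j != i) \det (P x j)) *: \adj (P x i).
have [L L0 hL] : exists2 K, 0 <= K & forall x, rnsq x <= M -> n1 (G x) <= K.
  apply: pgrow_n1_bounded => // a b.
  apply: (@pgrow_ext _ _ _ (fun x => (\prod_(j | j != i) \det (P x j)) * (\adj (P x i)) a b)).
    by move=> x; rewrite [RHS]mxE.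
  apply: pgrowM; last by apply: pgrow_adjugate => k l; apply: pgrow_pmx.
  by apply: pgrow_prod => j _; apply: pgrow_det => k l; apply: pgrow_pmx.
have /fin_all_exists [K hK] (j : 'I_(w i)) : exists K : R, 0 <= K /\ forall x (u : forall i, 'M[C]_(w i)), rnsq x <= M ->
    n1 (u inf *m path_eval x (ps j) - path_eval x (ps j) *m u i) <= K * comm_size x u.
  by have [K K0 hK] := @path_comm_bound R Q w _ _ (ps j) M M0; exists K.
have K0 : 0 <= \sum_j K j by apply: sumr_ge0 => j _; case: (hK j).
exists (Num.sqrt (2 / delta) * (L * \sum_j K j)).
  by rewrite mulr_ge0 ?sqrtr_ge0 // mulr_ge0.
move=> x xM xd; set E := _ - _.
have D0 : bigdet x != 0.
  by apply: contraTneq xd => ->; rewrite -ltNge /csq /= expr0n addr0.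
(* Cramer's rule: [G x] divided by [bigdet x] is the inverse of [P x i], with the denominator
   controlled by [delta]. *)
have -> : E = (bigdet x)^-1 *: (G x *m (P x i *m E)).
  rewrite /G mulmxA -scalemxAl mul_adj_mx -scalemxAl mul_scalar_mx scalerA.
  have -> : (\prod_(j | j != i) \det (P x j)) * \det (P x i) = bigdet x.
    by rewrite /bigdet [RHS](bigD1 i) //= mulrC.
  by rewrite scalerA mulVf // scale1r.
apply: (le_trans (n1Z _ _)); rewrite -mulrA; apply: ler_pM; rewrite ?cabs_ge0 ?n1_ge0 //.
  rewrite -[leLHS](@ger0_norm _ _) ?cabs_ge0 // -sqrtr_sqr; apply: ler_wsqrtr.
  apply: (le_trans (cabs_le_csq _)); rewrite ler_wpM2l //.
  have e : csq (bigdet x)^-1 * csq (bigdet x) = 1.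
    by rewrite -csqM mulVf // /csq /= expr1n expr0n addr0.
  have p0 : 0 < csq (bigdet x) by apply: lt_le_trans xd.
  by rewrite -(ler_pM2r p0) e ler_pdivlMl // mulr1.
apply: (le_trans (n1M _ _)); rewrite -mulrA; apply: ler_pM; rewrite ?n1_ge0 ?hL //.
rewrite n1_rows mulr_suml; apply: ler_sum => j _.
(* [B] acts at [inf] by the scalar subtracted in [E], so each row is a commutator of [B] with a
   path. *)
have -> : row j (P x i *m E) = - row (inf_ord hw)
    (B x inf *m path_eval x (ps j) - path_eval x (ps j) *m B x i).
  rewrite row_mul rowK /E mulmxBr mul_mx_scalar (Bf_inf hw) mul_scalar_mx.
  rewrite /prow -row_mul; apply/rowP => q; rewrite !mxE; ring.
rewrite n1N; apply: (le_trans (n1_row _ _)).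
exact: (hK j).2.
Qed.

(** A Lojasiewicz inequality with the optimal exponent: the energy is bounded by the square of its
    gradient, which forces exponential decay. *)
Lemma energy_comm_bound (delta M : R) : 0 < delta -> 0 <= M ->
  exists2 K, 0 < K & forall x, rnsq x <= M -> delta <= csq (bigdet x) ->
    energy inf N x <= K * rnsq (fun a => inf_act x (B x) a).
Proof.
move=> d0 M0.
have /fin_all_exists [A hA] (i : Q) : exists K : R, 0 <= K /\ forall x, rnsq x <= M ->
    delta <= csq (bigdet x) -> n1 (B x i - ((binf inf c x)%:C%C)%:M) <= K * comm_size x (B x).
  by have [K K0 hK] := Bf_minus_scalar_bound i d0 M0; exists K.
pose SA := \sum_i A i.
have SA0 : 0 <= SA by apply: sumr_ge0 => i _; case: (hA i).
have [L L0 hL] := @comm_size_sqr_le R Q w.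
pose D := \sum_i (A i + (w i)%:R * SA) ^+ 2.
have D0 : 0 <= D by apply: sumr_ge0 => i _; apply: sqr_ge0.
exists (D * L + 1); first by rewrite ltr_wpDl // mulr_ge0.
move=> x xM xd; set T := comm_size x (B x); have T0 : 0 <= T := comm_size_ge0 x _.
set b := binf inf c x.
(* Since [B] is traceless, the traces of [B - b] add up to -|w| b, so the scalar is controlled by
   the same commutator. *)
have bT : `|b| <= SA * T.
  have s0 := wsize_gt0 R hw.
  have s1 : 1 <= wsize R w.
    by rewrite /wsize (bigD1 inf) //= hw lerDl sumr_ge0.
  have e : \sum_i Re (\tr (B x i - (b%:C%C)%:M)) = - (wsize R w * b).
    under eq_bigr do rewrite mxtraceB Re_add Re_opp Re_tr_scalar.
    by rewrite sumrB sum_tr_Bf // sub0r -mulr_sumr mulrC.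
  apply: (@le_trans _ _ (wsize R w * `|b|)); first by rewrite ler_peMl.
  rewrite -[wsize R w]gtr0_norm // -normrM -normrN -e.
  apply: (le_trans (ler_norm_sum _ _ _)); rewrite mulr_suml; apply: ler_sum => i _.
  exact: le_trans (Re_tr_le _) ((hA i).2 x xM xd).
have nB i : n1 (B x i) <= (A i + (w i)%:R * SA) * T.
  rewrite -[B x i](subrK ((b%:C%C)%:M)) mulrDl; apply: (le_trans (n1D _ _)).
  apply: lerD; first exact: (hA i).2.
  apply: (le_trans (n1_scalar _ _)); rewrite -mulrA ler_wpM2l //.
  by rewrite /cabs /= normr0 addr0.
apply: (@le_trans _ _ (D * T ^+ 2)).
  rewrite /energy /D mulr_suml; apply: ler_sum => i _; apply: (le_trans (nsq_le_n1 _)).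
  rewrite -exprMn lerXn2r // nnegrE ?n1_ge0 //.
  by rewrite mulr_ge0 // addr_ge0 ?(hA i).1 // mulr_ge0.
rewrite mulrDl -mulrA; apply: (@le_trans _ _ (D * (L * rnsq (fun a => inf_act x (B x) a)))).
  by apply: ler_wpM2l => //; exact: hL.
by rewrite lerDl mul1r rnsq_ge0.
Qed.

End Basis.

Lemma comm_energy_bound (M : R) : 0 <= M -> exists2 K, 0 <= K & forall x, rnsq x <= M ->
  rnsq (fun a => inf_act x (B x) a) <= K * energy inf N x.
Proof.
move=> M0; pose k i : R := 2 * ((w i)%:R * (w i)%:R) ^+ 2.
have k0 i : 0 <= k i by rewrite mulr_ge0 // sqr_ge0.
have /fin_all_exists [X hX] (a : edge Q) : exists K : R, 0 <= K /\ forall x, rnsq x <= M -> n1 (x a) <= K.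
  have [|K K0 hK] := @pgrow_n1_bounded R Q w _ _ (fun x => x a) M _ M0.
    move=> p q; have := @pgrow_path R Q w _ _ (Pcons (Pnil (qtail a))) p q.
    by apply: pgrow_ext => x /=; rewrite mulmx1.
  by exists K.
pose D a := 2 * X a ^+ 2 * (k (qhead a) + k (qtail a)).
have D0 a : 0 <= D a by rewrite mulr_ge0 ?addr_ge0 // mulr_ge0 // sqr_ge0.
exists (\sum_a D a); first exact: sumr_ge0.
move=> x xM; rewrite mulr_suml; apply: ler_sum => a _.
have nB i : n1 (B x i) ^+ 2 <= k i * energy inf N x.
  apply: (le_trans (n1_sqr_le _)); rewrite ler_wpM2l //.
  by rewrite /energy (bigD1 i) //= lerDl sumr_ge0 // => j _; apply: nsq_ge0.
apply: (le_trans (nsq_le_n1 _)).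
have X0 := (hX a).1; have xX := (hX a).2 x xM.
have h : n1 (inf_act x (B x) a) <= X a * (n1 (B x (qhead a)) + n1 (B x (qtail a))).
  apply: (le_trans (n1D _ _)); rewrite n1N mulrDr; apply: lerD.
    by apply: (le_trans (n1M _ _)); rewrite mulrC ler_wpM2r ?n1_ge0.
  by apply: (le_trans (n1M _ _)); rewrite ler_wpM2r ?n1_ge0.
apply: (@le_trans _ _ ((X a * (n1 (B x (qhead a)) + n1 (B x (qtail a)))) ^+ 2)).
  by rewrite lerXn2r // nnegrE ?n1_ge0 // mulr_ge0 // addr_ge0 ?n1_ge0.
have h1 := nB (qhead a); have h2 := nB (qtail a).
have -> : D a * energy inf N x = X a ^+ 2 *
    (2 * (k (qhead a) * energy inf N x + k (qtail a) * energy inf N x)) by rewrite /D; ring.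
rewrite exprMn; apply: ler_wpM2l; first exact: sqr_ge0.
have := sqr_ge0 (n1 (B x (qhead a)) - n1 (B x (qtail a))).
move: h1 h2; set p := n1 _; set q := n1 _; nra.
Qed.

Lemma clim_prod (F : set_system R) (FF : ProperFilter F) I (r : seq I) (g : I -> R -> C) (z : I -> C) :
  (forall i, clim F (g i) (z i)) -> clim F (fun s => \prod_(i <- r) g i s) (\prod_(i <- r) z i).
Proof.
move=> h; elim: r => [|i r ih].
  by apply: clim_ext (clim_cst FF 1) => *; rewrite big_nil.
by apply: clim_ext (climM FF (h i) ih) => *; rewrite big_cons.
Qed.

Lemma clim_det (F : set_system R) (FF : ProperFilter F) n (A : R -> 'M[C]_n) L : mlim F A L ->
  clim F (fun s => \det (A s)) (\det L).
Proof.
move=> h; apply: clim_sum => s _; apply: climM; first exact: clim_cst.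
by apply: clim_prod => i; apply: h.
Qed.

(** The lower bound on the determinant is closed, so the limit [z] is stable. The relations of [y]
    hold along the orbit and hence for [z]; with equal dimension vectors this is an isomorphism. *)
Lemma forward_flow (y : rep R w) : cogen inf y -> exists phi h (z : rep R w),
  [/\ 0 < h, phi 0 = y, forall t, - h < t -> isflow c phi t,
      forall a, mlim +oo (fun t => phi t a) (z a) & (forall i, B z i = 0) /\
      cogen inf z /\ iso_class z = iso_class y].
Proof.
move=> cy; have [ps ups] := cogen_basis hw cy.
pose Psi := stab_fun hw N ps; pose delta := Psi y.
have d0 : 0 < delta.
  rewrite /delta /Psi /stab_fun mulr_gt0 ?expR_gt0 //; apply: prodr_gt0 => i _.
  rewrite lt_neqAle csq_ge0 andbT eq_sym; apply: contraTneq (ups i) => /csq_eq0 e.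
  by rewrite unitmxE e unitr0.
have [M M0 hM] := stab_fun_bound ps d0.
have mono phi h T : 0 < h -> phi 0 = y -> (forall t, - h < t < T -> isflow c phi t) ->
    forall t, 0 <= t < T -> delta <= Psi (phi t).
  move=> h0 p0 fl t /andP[t0 tT]; rewrite /delta -p0.
  apply: (@derive_ge0 _ (fun s => Psi (phi s)) (fun s => 2 / slope_gap w N * energy inf N (phi s) * Psi (phi s))) => //.
    move=> s /andP[s0 st]; apply: stab_fun_flow => //; apply: fl.
    by rewrite (lt_le_trans _ s0) ?oppr_lt0 // (le_lt_trans st).
  move=> s _; rewrite !mulr_ge0 ?energy_ge0 ?expR_ge0 ?invr_ge0 ?(ltW slope_gap_gt0) //.
  by apply: prodr_ge0 => i _; apply: csq_ge0.
have [|T h phi h0 T0 p0 fl t ht|phi [h [h0 p0 fl]]] := @flow_global R Q w c y M.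
- by case: (hM y (lexx _)).
- by case: (hM _ (mono phi h T h0 p0 fl t ht)).
have ge_t t : 0 <= t -> rnsq (phi t) <= M /\ delta <= csq (bigdet ps (phi t)).
  move=> t0; apply: hM; apply: (mono phi h (t + 1) h0 p0); last by rewrite t0 ltrDl ltr01.
  by move=> s /andP[s1 _]; apply: fl.
have fl0 t : 0 <= t -> isflow c phi t by move=> t0; apply: fl; rewrite (lt_le_trans _ t0) // oppr_lt0.
have [K K0 hK] := energy_comm_bound ps d0 M0.
have [L L0 hL] := comm_energy_bound M0.
(* The energy has derivative -2 times the squared gradient, hence at most -(2 / K) times the
   energy. *)
pose kappa := 2 / K; have kap0 : 0 < kappa by rewrite divr_gt0.
pose e0 := energy inf N (phi 0).
have e00 : 0 <= e0 by apply: energy_ge0.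
have decay t : 0 <= t -> energy inf N (phi t) <= e0 * expR (- kappa * t).
  move=> t0; have -> : - kappa * t = - kappa * (t - 0) by rewrite subr0.
  apply: (@gronwall_le _ (fun s => energy inf N (phi s)) (fun s => - 2 * rnsq (fun a => inf_act (phi s) (B (phi s)) a))) => //.
    by move=> s /andP[s0 _]; apply: energy_flow => //; apply: fl0.
  move=> s /andP[s0 _]; have [sM sd] := ge_t s s0.
  rewrite !mulNr lerN2 /kappa mulrAC ler_pdivrMr // -mulrA ler_wpM2l //.
  by rewrite mulrC; apply: hK.
(* The squared speed is at most [L] times the energy, so the speed decays at half the rate. *)
pose A := Num.sqrt (L * e0).
have vel t a p q : 0 <= t -> csq (bfield c (phi t) a p q) <= (A * expR (- (kappa / 2) * t)) ^+ 2.
  move=> t0; have [sM _] := ge_t t t0.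
  rewrite exprMn sqr_sqrtr ?mulr_ge0 // -expRM_natl.
  have -> : 2%:R * (- (kappa / 2) * t) = - kappa * t by field.
  apply: (le_trans (csq_le_nsq _ _ _)); rewrite nsqN.
  apply: (le_trans (nsq_le_rnsq (fun a => inf_act (phi t) (B (phi t)) a) a)).
  by apply: (le_trans (hL _ sM)); rewrite -mulrA ler_wpM2l // decay.
have A0 t : 0 <= A * expR (- (kappa / 2) * t) by rewrite mulr_ge0 ?sqrtr_ge0 ?expR_ge0.
have sq (r s : R) : 0 <= s -> r ^+ 2 <= s ^+ 2 -> `|r| <= s.
  by move=> s0 h'; rewrite -(ger0_norm s0) -!sqrtr_sqr ler_wsqrtr.
have k20 : 0 < kappa / 2 by rewrite divr_gt0.
have cvR a p q : exists l : R, (fun t => Re (phi t a p q)) @ +oo --> l.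
  apply: (@exp_bounded_derive_cvg R (fun t => Re (phi t a p q)) (fun t => Re (bfield c (phi t) a p q)) A _ k20) => t t0.
    by case: (fl0 t t0 a p q).
  by apply: sq => //; apply: le_trans (vel t a p q t0); rewrite lerDl sqr_ge0.
have cvI a p q : exists l : R, (fun t => Im (phi t a p q)) @ +oo --> l.
  apply: (@exp_bounded_derive_cvg R (fun t => Im (phi t a p q)) (fun t => Im (bfield c (phi t) a p q)) A _ k20) => t t0.
    by case: (fl0 t t0 a p q).
  by apply: sq => //; apply: le_trans (vel t a p q t0); rewrite lerDr sqr_ge0.
pose z : rep R w := fun a => \matrix_(p, q)
  Complex (lim ((fun t => Re (phi t a p q)) @ +oo)) (lim ((fun t => Im (phi t a p q)) @ +oo)).
have lz a : mlim +oo (fun t => phi t a) (z a).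
  move=> p q; rewrite mxE; split => /=.
    by have [l hl] := cvR a p q; rewrite (cvg_lim (@norm_hausdorff _ _) hl).
  by have [l hl] := cvI a p q; rewrite (cvg_lim (@norm_hausdorff _ _) hl).
have Bz : forall i, B z i = 0.
  apply: energy_eq0.
  have c1 : energy inf N (phi t) @[t --> +oo] --> energy inf N z.
    by apply: cvg_rsum => i; apply: mlim_nsq; apply: mlim_Bf.
  have c2 : energy inf N (phi t) @[t --> +oo] --> 0.
    apply: (@cvg0_le _ _ _ _ _ (fun t => e0 * expR (- kappa * t))).
      near=> t; rewrite ger0_norm ?energy_ge0 //; apply: decay.
      by near: t; apply: nbhs_pinfty_ge; rewrite num_real.
    by rewrite -[X in _ --> X](mulr0 e0); apply: cvgM; [exact: cvg_cst|exact: cvg_expN].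
  exact: (cvg_unique (@norm_hausdorff _ _) c1 c2).
have dz : delta <= csq (bigdet ps z).
  have cl : clim +oo (fun t => bigdet ps (phi t)) (bigdet ps z).
    apply: clim_prod => i; apply: clim_det => p q.
    apply: (@clim_ext _ _ (fun s => path_eval (phi s) (ps i p) (inf_ord hw) q) _
      (path_eval z (ps i p) (inf_ord hw) q)); [by move=> s; rewrite !mxE|by rewrite !mxE|].
    exact: (mlim_path _ (ps i p) lz).
  apply: (cvgr_to_ge (clim_csq _ cl)); near=> t.
  have t0 : 0 <= t by near: t; apply: nbhs_pinfty_ge; rewrite num_real.
  by case: (ge_t t t0).
have cz : cogen inf z.
  apply: (@pmx_cogen _ _ _ _ hw _ ps) => i; rewrite unitmxE unitfE.
  have : bigdet ps z != 0.
    by apply: contraTneq dz => ->; rewrite -ltNge /csq /= expr0n addr0.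
  by move=> /prodf_neq0; apply.
exists phi, h, z; split => //; split => //; split => //.
apply: (rel_le_iso_class hw cz cy) => i Lr er.
have lc : mlim +oo (fun t => comb (phi t) Lr) (comb z Lr) by exact: mlim_comb.
have uq := @mlim_unique R (+oo) _ _ _ (fun t => comb (phi t) Lr) _ 0 lc.
apply: uq; apply: mlim_near (mlim_cst _ 0).
near=> t; have t0 : 0 <= t by near: t; apply: nbhs_pinfty_ge; rewrite num_real.
symmetry; apply: (@flow_comb_eq0 _ _ inf w hw c phi 0 t 0) => //; rewrite ?lexx ?t0 //.
  by move=> s /andP[s0 _]; apply: fl0.
by rewrite p0.
Unshelve. all: by end_near. Qed.

End ForwardFlow.

(** * From flow lines to the Hecke correspondence *)

Section OrthogonalSums.
Variables (R : realType) (Q : quiver).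
Notation C := R[i].
Implicit Types v w : dimvec Q.

Lemma adj_mono m n (J : 'M[C]_(m, n)) : adj J *m J = 1%:M -> injective (fun b : 'cV[C]_n => J *m b).
Proof. by move=> h b b' /= /(congr1 (mulmx (adj J))); rewrite !mulmxA h !mul1mx. Qed.

Lemma matrix0_cols m n (A : 'M[C]_(m, n)) : n = 0%N -> A = 0.
Proof. by move=> e; subst n; apply/matrixP => p []. Qed.

Section Projections.
Variables (v v1 v2 : dimvec Q) (J1 : forall i, 'M[C]_(v i, v1 i)) (J2 : forall i, 'M[C]_(v i, v2 i)).
Hypotheses (J11 : forall i, adj (J1 i) *m J1 i = 1%:M) (J22 : forall i, adj (J2 i) *m J2 i = 1%:M)
  (J12 : forall i, adj (J1 i) *m J2 i = 0)
  (Jsum : forall i, J1 i *m adj (J1 i) + J2 i *m adj (J2 i) = 1%:M).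

Lemma orth21 i : adj (J2 i) *m J1 i = 0.
Proof. by apply: (@adj_inj R); rewrite adjM adjK J12 adj0. Qed.

Lemma orth_dim i : (v1 i + v2 i)%N = v i.
Proof.
have := congr1 mxtrace (Jsum i).
rewrite raddfD /= mxtrace_mulC J11 mxtrace_mulC J22 !mxtrace1 -natrD => /eqP.
by rewrite eqr_nat => /eqP.
Qed.

Lemma nsq_orth i (r : 'rV[C]_(v i)) : nsq r = nsq (r *m J1 i) + nsq (r *m J2 i).
Proof.
rewrite -!inner_nsq /inner !adjM !mulmxA -[r *m J1 i *m _]mulmxA -[r *m J2 i *m _]mulmxA.
by rewrite -Re_add -raddfD /= -mulmxDl -mulmxDr Jsum mulmx1.
Qed.

Lemma cancel_orth i n (X Y : 'M[C]_(n, v i)) : X *m J1 i = Y *m J1 i -> X *m J2 i = Y *m J2 i -> X = Y.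
Proof.
by move=> h1 h2; rewrite -[X]mulmx1 -[Y]mulmx1 -(Jsum i) !mulmxDr !mulmxA h1 h2.
Qed.

Variables (x : rep R v) (x1 : rep R v1) (x2 : rep R v2).
Hypothesis xE : forall a, x a = J1 (qhead a) *m x1 a *m adj (J1 (qtail a))
                    + J2 (qhead a) *m x2 a *m adj (J2 (qtail a)).

Lemma orth_hom1 : is_hom J1 x1 x.
Proof.
by move=> a; rewrite xE mulmxDl -!mulmxA J11 orth21 !mulmx0 addr0 mulmx1.
Qed.

Lemma orth_hom2 : is_hom J2 x2 x.
Proof.
by move=> a; rewrite xE mulmxDl -!mulmxA J12 J22 !mulmx0 add0r mulmx1.
Qed.

Lemma orth_mono1 : mono J1. Proof. by move=> i; apply: adj_mono. Qed.

Lemma orth_hmu i : hmu x i = J1 i *m hmu x1 i *m adj (J1 i) + J2 i *m hmu x2 i *m adj (J2 i).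
Proof.
have pc1 k (A : 'M[C]_(v1 k)) : J1 i *m put A i *m adj (J1 i) = put (J1 k *m A *m adj (J1 k)) i.
  exact: (put_conj J1 (fun i => adj (J1 i))).
have pc2 k (A : 'M[C]_(v2 k)) : J2 i *m put A i *m adj (J2 i) = put (J2 k *m A *m adj (J2 k)) i.
  exact: (put_conj J2 (fun i => adj (J2 i))).
rewrite /hmu /hmu2 !mulmx_sumr !mulmx_suml -big_split; apply: eq_bigr => a _ /=.
rewrite !mulmxBr !mulmxBl !pc1 !pc2 addrACA -opprD -!putD.
have a1 : adj (x a) *m J1 (qhead a) = J1 (qtail a) *m adj (x1 a).
  by rewrite xE adjD !adjM !adjK mulmxDl -!mulmxA J11 orth21 !mulmx0 addr0 mulmx1.
have a2 : adj (x a) *m J2 (qhead a) = J2 (qtail a) *m adj (x2 a).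
  by rewrite xE adjD !adjM !adjK mulmxDl -!mulmxA J12 J22 !mulmx0 add0r mulmx1.
have -> : x a *m adj (x a) = J1 (qhead a) *m (x1 a *m adj (x1 a)) *m adj (J1 (qhead a)) +
    J2 (qhead a) *m (x2 a *m adj (x2 a)) *m adj (J2 (qhead a)).
  rewrite {2}xE adjD !adjM !adjK mulmxDr !mulmxA -(orth_hom1 a) -(orth_hom2 a).
  by rewrite -!mulmxA.
have -> : adj (x a) *m x a = J1 (qtail a) *m (adj (x1 a) *m x1 a) *m adj (J1 (qtail a)) +
    J2 (qtail a) *m (adj (x2 a) *m x2 a) *m adj (J2 (qtail a)).
  by rewrite [X in _ *m X]xE mulmxDr !mulmxA a1 a2.
by [].
Qed.

Lemma orth_Bf c i : Bf c x i = J1 i *m Bf c x1 i *m adj (J1 i) + J2 i *m Bf c x2 i *m adj (J2 i).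
Proof.
rewrite /Bf orth_hmu !mulmxDr !mulmxDl -!scalemxAr -!scalemxAl addrACA scalerDr; congr (_ + _).
by rewrite !mul_mx_scalar -!scalemxAl -scalerDr Jsum scalemx1.
Qed.

End Projections.

Lemma sum_c_can_stab (inf : Q) v i : v inf = 1%N ->
  (can_stab inf v i)%:~R = 1 - wsize R v *+ (i == inf) :> R.
Proof.
move=> hv; rewrite /can_stab; case: eqP => [_|_]; last by rewrite mulr0n subr0.
rewrite mulr1n /wsize [in RHS](bigD1 inf) //= hv opprD addrA subrr add0r.
by rewrite mulrNz -pmulrn natr_sum.
Qed.

Lemma moment_eq0 w (x : rep R w) i : moment x i = 0 <-> hmu x i = 0.
Proof.
rewrite momentE; split => [/eqP|->]; last by rewrite scaler0.
rewrite scaler_eq0 invr_eq0 mulf_eq0 pnatr_eq0 /= => /orP[/eqP h|/eqP //].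
have : ('i : C)%C ^+ 2 = -1 by rewrite sqr_i.
by rewrite h expr0n => /eqP; rewrite eq_sym oppr_eq0 oner_eq0.
Qed.

(** Taking traces over x_1, where the moment map contributes 0, gives lambda |v_1| = |v_1| - |v|. On
    x_2 the moment map vanishes and alpha is 1, because x_2 does not contain [inf]. *)
Lemma crit_splitting_Bf (inf : Q) v v1 v2 (x : rep R v) (x1 : rep R v1) (x2 : rep R v2)
    (J1 : forall i, 'M[C]_(v i, v1 i)) (J2 : forall i, 'M[C]_(v i, v2 i)) (lambda : C) :
  v inf = 1%N -> v1 inf = 1%N -> orth_sum J1 J2 x x1 x2 ->
  (forall i (c : 'cV[C]_(v i)), (exists b : 'cV[C]_(v1 i), c = J1 i *m b) <->
     ('i%C *: shifted_moment (can_stab inf v) x i) *m c = lambda *: c) ->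
  (forall i, moment x2 i = 0) ->
  v2 inf = 0%N /\ forall i, Bf (fun j => (can_stab inf v j)%:~R) x i =
    ((1 - slope_gap v1 (wsize R v))%:C%C) *: (J1 i *m adj (J1 i)) + J2 i *m adj (J2 i).
Proof.
move=> hv hv1 [J11 J22 J12 Jsum xE] eig m2.
set c := fun j => _; have cE i : c i = 1 - wsize R v *+ (i == inf) by exact: sum_c_can_stab.
have d2 : v2 inf = 0%N by have := orth_dim J11 J22 Jsum inf; rewrite hv hv1 add1n => -[].
split=> // i.
have B1 j : Bf c x1 j = lambda%:M.
  have e : Bf c x j *m J1 j = lambda *: J1 j.
    apply/matrixP => p q; have /(eig j _).1 : exists b, col q (J1 j) = J1 j *m b.
      by exists (col q 1%:M); rewrite !colE !mulmxA mulmx1.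
    by rewrite Bf_shifted_moment -/c !colE !mulmxA -!colE => /matrixP/(_ p 0); rewrite !mxE.
  have : adj (J1 j) *m Bf c x j *m J1 j = lambda%:M.
    by rewrite -mulmxA e -scalemxAr J11 scalemx1.
  rewrite (orth_Bf J11 J22 J12 Jsum xE) mulmxDr mulmxDl !mulmxA J11 J12 !mul0mx addr0 mul1mx.
  by rewrite -!mulmxA J11 mulmx1.
have lamE : lambda = (1 - slope_gap v1 (wsize R v))%:C%C.
  have s0 := wsize_gt0 R hv1.
  have e : \sum_j \tr (Bf c x1 j) = ((wsize R v1 - wsize R v)%:C)%C.
    have -> : \sum_j \tr (Bf c x1 j) = (2^-1)%:C%C * (\sum_j \tr (hmu x1 j)) + \sum_j (c j * (v1 j)%:R)%:C%C.
      rewrite mulr_sumr -big_split; apply: eq_bigr => j _ /=.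
      by rewrite /Bf mxtraceD mxtraceZ mxtrace_scalar rmorphM rmorph_nat mulr_natr.
    rewrite tr_hmu mulr0 add0r -rmorph_sum; congr (_%:C)%C.
    under eq_bigr do rewrite cE mulrBl mul1r.
    rewrite sumrB; congr (_ - _); rewrite (bigD1 inf) //= eqxx hv1 mulr1 big1 ?addr0 //.
    by move=> j /negPf ->; rewrite mul0r.
  have : lambda * ((wsize R v1)%:C)%C = ((wsize R v1 - wsize R v)%:C)%C.
    rewrite -e (eq_bigr (fun j => lambda * (v1 j)%:R)); last first.
      by move=> j _; rewrite B1 mxtrace_scalar mulr_natr.
    rewrite -mulr_sumr /wsize rmorph_sum; congr (_ * _); apply: eq_bigr => j _.
    by rewrite rmorph_nat.
  move=> h; apply: (@mulIf _ ((wsize R v1)%:C)%C).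
    by apply/eqP => /(congr1 (@complex.Re _)) /= e0; rewrite e0 ltxx in s0.
  by rewrite h -rmorphM mulrBl mul1r (slope_gap_size hv1).
rewrite (orth_Bf J11 J22 J12 Jsum xE) B1 lamE mul_mx_scalar -scalemxAl; congr (_ + _).
rewrite /Bf (moment_eq0 x2 i).1 // scaler0 add0r mul_mx_scalar -scalemxAl.
have [e|ne] := eqVneq i inf.
  by subst i; rewrite (matrix0_cols (J2 inf) d2) mul0mx scaler0.
by rewrite cE (negPf ne) subr0 scale1r.
Qed.

End OrthogonalSums.

(** * Functionals along a flow line near its forward limit *)

Section DownwardCone.
Variables (R : realType) (Q : quiver) (inf : Q) (v v1 v2 : dimvec Q).
Notation C := R[i].
Notation Re := complex.Re.
Variables (J1 : forall i, 'M[C]_(v i, v1 i)) (J2 : forall i, 'M[C]_(v i, v2 i)).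
Hypotheses (hv : v inf = 1%N) (hv1 : v1 inf = 1%N) (hv2 : v2 inf = 0%N).
Hypotheses (J11 : forall i, adj (J1 i) *m J1 i = 1%:M) (J22 : forall i, adj (J2 i) *m J2 i = 1%:M)
  (J12 : forall i, adj (J1 i) *m J2 i = 0)
  (Jsum : forall i, J1 i *m adj (J1 i) + J2 i *m adj (J2 i) = 1%:M).
Variables (c : Q -> R) (gam : R) (x : rep R v).
Hypothesis gam0 : 0 < gam.
Hypothesis BxE : forall i,
  Bf c x i = ((1 - gam)%:C%C) *: (J1 i *m adj (J1 i)) + J2 i *m adj (J2 i).
Variable phi : R -> rep R v.
Hypothesis fl : forall t, isflow c phi t.
Hypothesis lim : forall a, mlim +oo (fun t => phi t a) (x a).

(* A solution of the linear equation satisfied by path functionals that stays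
   bounded lies in the cone where the [J1] component dominates: outside of it
   the [J2] component grows like [expR (gam * t)]. *)
Lemma bounded_in_cone i : exists T, forall (L : seq (C * qpath i inf)) t, T <= t ->
  nsq (crow hv (phi t) L *m J2 i) <= nsq (crow hv (phi t) L *m J1 i).
Proof.
pose E t := Bf c (phi t) i - Bf c x i.
pose eps t := binf inf c (phi t) - (1 - gam).
pose kap := n1 (J1 i *m adj (J1 i)) + n1 (J2 i *m adj (J2 i)).
have kap0 : 0 <= kap by apply: addr_ge0; apply: n1_ge0.
pose eta t := 4 * (n1 (E t) * kap) + 2 * `|eps t|.
have limB j : mlim +oo (fun t => Bf c (phi t) j) (Bf c x j) by exact: mlim_Bf.
have limE : n1 (E t) @[t --> +oo] --> 0.
  have -> : 0 = n1 (Bf c x i - Bf c x i).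
    by rewrite subrr /n1 big1 // => p _; rewrite big1 // => q _; rewrite mxE cabs0.
  by apply: mlim_n1; apply: mlimB => //; apply: mlim_cst.
have binfx : binf inf c x = 1 - gam.
  rewrite /binf BxE (matrix0_cols (J2 inf) hv2) mul0mx addr0.
  have := Jsum inf; rewrite (matrix0_cols (J2 inf) hv2) mul0mx addr0 => ->.
  by rewrite mxtraceZ mxtrace1 hv Re_mul /= mulr1 mul0r subr0.
have limeps : `|eps t| @[t --> +oo] --> 0.
  have e0 : eps t @[t --> +oo] --> 0.
    rewrite -[X in _ --> X](subrr (1 - gam)); apply: cvgB; last exact: cvg_cst.
    rewrite -binfx /binf /mxtrace Re_sum; under eq_fun do rewrite Re_sum.
    by apply: cvg_rsum => p; case: (limB inf p p).
  rewrite -[X in _ --> X](@normr0 R R); exact: (cvg_norm e0).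
have limeta : eta t @[t --> +oo] --> 0.
  rewrite -[X in _ --> X](addr0 0); apply: cvgD.
    rewrite -[X in _ --> X](mulr0 4); apply: cvgM; first exact: cvg_cst.
    by rewrite -[X in _ --> X](mul0r kap); apply: cvgM => //; exact: cvg_cst.
  by rewrite -[X in _ --> X](mulr0 2); apply: cvgM => //; exact: cvg_cst.
have [T hT] : exists T, forall t, T <= t -> eta t <= gam.
  have /cvgr0Pnorm_lt /(_ gam gam0) [M [_ hM]] := limeta.
  exists (M + 1) => t Mt; apply/ltW/(le_lt_trans (ler_norm _)); apply: hM.
  by rewrite (lt_le_trans _ Mt) // ltrDl.
exists T => L t0 Tt0.
pose r t := crow hv (phi t) L.
pose g1 t := nsq (r t *m J1 i). pose g2 t := nsq (r t *m J2 i).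
pose dr t := r t *m Bf c (phi t) i - (binf inf c (phi t))%:C%C *: r t.
have dJ m (J : 'M[C]_(v i, m)) t : is_derive t (1 : R) (fun s => nsq (r s *m J))
    (2 * inner (dr t *m J) (r t *m J)).
  apply: mder_nsq; have := mderM (mder_crow hv L (fl t)) (mder_cst J t).
  by apply: mder_ext => //; rewrite mulmx0 addr0.
have innerJ m (J : 'M[C]_(v i, m)) (X : 'M[C]_(v i)) t :
    inner (r t *m X *m J) (r t *m J) = inner (r t *m (X *m (J *m adj J))) (r t).
  by rewrite /inner adjM !mulmxA.
have drE t m (J : 'M[C]_(v i, m)) (k : R) : Bf c x i *m J = (k%:C%C) *: J ->
    inner (dr t *m J) (r t *m J) = (k - (1 - gam)) * nsq (r t *m J)
      + inner (r t *m (E t *m (J *m adj J))) (r t) - eps t * nsq (r t *m J).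
  move=> hJ; rewrite -innerJ.
  have alg (u : 'rV[C]_(v i)) (X Y : 'M[C]_(v i)) (b : R) : Y *m J = (k%:C%C) *: J ->
      (u *m X - b%:C%C *: u) *m J = ((k - b)%:C%C) *: (u *m J) + u *m (X - Y) *m J.
    move=> hY; rewrite mulmxBl -scalemxAl mulmxBr mulmxBl -[u *m Y *m J]mulmxA hY -scalemxAr.
    by rewrite rmorphB scalerBl [RHS]addrC addrA subrK.
  rewrite /dr (alg _ _ _ _ hJ) -/(E t).
  rewrite innerDl innerZl_real inner_nsq /eps; ring.
have BJ1 : Bf c x i *m J1 i = ((1 - gam)%:C%C) *: J1 i.
  rewrite BxE mulmxDl -scalemxAl -!mulmxA J11 (orth21 J12) mulmx0 addr0 mulmx1 //.
have BJ2 : Bf c x i *m J2 i = (1%:C%C) *: J2 i.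
  by rewrite BxE mulmxDl -scalemxAl -!mulmxA J12 J22 mulmx0 scaler0 add0r mulmx1 scale1r.
pose h t := g2 t - g1 t.
pose h' t := 2 * inner (dr t *m J2 i) (r t *m J2 i) - 2 * inner (dr t *m J1 i) (r t *m J1 i).
have dh t : is_derive t (1 : R) h (h' t) by exact: is_deriveB.
(* At the limit point the derivative would be [2 * gam * g2 t]. The error is at most eta (g1 + g2)
   <= gam (g1 + g2), which leaves gam (g2 - g1). *)
have hineq t : T <= t -> gam * h t <= h' t.
  move=> Tt; have := hT t Tt; rewrite /h' (drE t _ _ _ BJ1) (drE t _ _ _ BJ2) /h /eta.
  have rs : nsq (r t) = g1 t + g2 t by exact: nsq_orth.
  have b1 := inner_mul_le (r t) (r t) (E t *m (J1 i *m adj (J1 i))).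
  have b2 := inner_mul_le (r t) (r t) (E t *m (J2 i *m adj (J2 i))).
  have m1 := n1M (E t) (J1 i *m adj (J1 i)); have m2 := n1M (E t) (J2 i *m adj (J2 i)).
  have p1 : 0 <= g1 t := nsq_ge0 _; have p2 : 0 <= g2 t := nsq_ge0 _.
  rewrite rs in b1 b2; rewrite -/(g1 t) -/(g2 t).
  have q1 : n1 (E t *m (J1 i *m adj (J1 i))) * (g1 t + g2 t + (g1 t + g2 t)) <=
            n1 (E t) * n1 (J1 i *m adj (J1 i)) * (2 * (g1 t + g2 t)).
    have -> : g1 t + g2 t + (g1 t + g2 t) = 2 * (g1 t + g2 t) by ring.
    by rewrite ler_wpM2r // mulr_ge0 // addr_ge0.
  have q2 : n1 (E t *m (J2 i *m adj (J2 i))) * (g1 t + g2 t + (g1 t + g2 t)) <=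
            n1 (E t) * n1 (J2 i *m adj (J2 i)) * (2 * (g1 t + g2 t)).
    have -> : g1 t + g2 t + (g1 t + g2 t) = 2 * (g1 t + g2 t) by ring.
    by rewrite ler_wpM2r // mulr_ge0 // addr_ge0.
  move: (le_trans b1 q1) (le_trans b2 q2) => {b1 b2 q1 q2 m1 m2 rs}.
  rewrite /kap; move: (inner (r t *m (E t *m (J1 i *m _))) _) (inner (r t *m (E t *m (J2 i *m _))) _).
  move: (n1 (E t)) (n1 (J1 i *m _)) (n1 (J2 i *m _)) (g1 t) (g2 t) p1 p2 (eps t).
  move=> e k1 k2 a b a0 b0 ep u1 u2; rewrite !ler_norml => /andP[_ hu1] /andP[hu2 _] heta.
  have hep : ep * (b - a) <= `|ep| * (a + b).
    apply: (le_trans (ler_norm _)); rewrite normrM ler_wpM2l //.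
    by rewrite ler_norml; apply/andP; split; lra.
  have : (4 * (e * (k1 + k2)) + 2 * `|ep|) * (a + b) <= gam * (a + b) by rewrite ler_wpM2r // addr_ge0.
  move: hu1 hu2 hep; lra.
rewrite leNgt; apply/negP => lt21.
have h0 : 0 < h t0 by rewrite subr_gt0.
have cvh : h t @[t --> +oo] --> nsq (crow hv x L *m J2 i) - nsq (crow hv x L *m J1 i).
  have lr : mlim +oo r (crow hv x L).
    move=> p q; apply: (@clim_ext _ _ (fun s => comb (phi s) L (inf_ord hv) q) _
      (comb x L (inf_ord hv) q)); [by move=> s; rewrite mxE|by rewrite mxE|].
    exact: (mlim_comb _ L lim).
  by apply: cvgB; apply: mlim_nsq; apply: mlimM => //; apply: mlim_cst.
(* [h] converges, so this tends to 0; but by Gronwall it stays above its value at [t0], which would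
   be positive outside the cone. *)
have cv0 : h t * expR (- gam * t) @[t --> +oo] --> 0.
  rewrite -[X in _ --> X](mulr0 (nsq (crow hv x L *m J2 i) - nsq (crow hv x L *m J1 i))).
  by apply: cvgM => //; exact: cvg_expN.
have : h t0 * expR (- gam * t0) <= 0.
  apply: (cvgr_to_ge cv0); near=> t.
  have tt : t0 <= t by near: t; apply: nbhs_pinfty_ge; rewrite num_real.
  have Ts s : t0 <= s <= t -> T <= s by move=> /andP[h1 _]; exact: le_trans Tt0 h1.
  have hh := @gronwall_ge _ h h' gam t0 t tt (fun s _ => dh s) (fun s hs => hineq s (Ts s hs)).
  move: (h t0) (h t) hh => ht0 ht hh.
  rewrite -(ler_pM2r (expR_gt0 (gam * t))) -!mulrA -!expRD !mulNr addNr expR0 mulr1.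
  by apply: le_trans hh; rewrite mulrBr addrC.
by rewrite leNgt mulr_gt0 // expR_gt0.
Unshelve. all: by end_near. Qed.

Variable x1 : rep R v1.
Hypotheses (hom1 : is_hom J1 x1 x) (cog1 : cogen inf x1).
Hypothesis hom2 : exists x2 : rep R v2, is_hom J2 x2 x.

(** By the cone condition a functional at time [T] is determined by its restriction to the image of
    [J1]. The basis paths [ps] of [x1] stay independent after this restriction, so any combination
    can be corrected by them until its restriction vanishes. *)
Lemma flow_limit_comb i (L0 : seq (C * qpath i inf)) : comb x1 L0 = 0 -> forall t, comb (phi t) L0 = 0.
Proof.
have [T hT] := bounded_in_cone i.
have all_t (L : seq (C * qpath i inf)) : comb (phi T) L = 0 -> forall t, comb (phi t) L = 0.
  move=> h t; apply: (@flow_comb_eq0 _ _ inf v hv c phi (Num.min T t) (Num.max T t) T) => //.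
    by rewrite ge_min le_max lexx.
  by rewrite ge_min le_max lexx !orbT.
have key (L : seq (C * qpath i inf)) : crow hv (phi T) L *m J1 i = 0 ->
    comb (phi T) L = 0 /\ comb x1 L = 0.
  move=> h; have h2 := hT L T (lexx T); rewrite h nsq0 in h2.
  have z2 : crow hv (phi T) L *m J2 i = 0.
    by apply: nsq_eq0; apply/eqP; rewrite eq_le h2 nsq_ge0.
  have z : comb (phi T) L = 0.
    by apply/(crow_eq0 hv); apply: (cancel_orth Jsum); rewrite ?h ?z2 mul0mx.
  split=> //; have xz : comb x L = 0.
    have lc : mlim +oo (fun t => comb (phi t) L) (comb x L) by exact: mlim_comb.
    have uq := @mlim_unique R (+oo) _ _ _ (fun t => comb (phi t) L) _ 0 lc.
    by apply: uq; apply: mlim_ext (mlim_cst _ 0) => // s; rewrite all_t.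
  by apply: (row_inj_mx (adj_mono (J11 inf))); rewrite (hom_comb _ hom1) xz mul0mx.
have [ps u] := cogen_basis hv1 cog1.
pose Lu (r : 'rV[C]_(v1 i)) := [seq (r 0 j, ps i j) | j <- enum 'I_(v1 i)].
have LuE w (hw : w inf = 1%N) (y : rep R w) r :
    crow hw y (Lu r) = r *m (\matrix_j prow hw y (ps i j)).
  rewrite crowE big_map big_enum mulmx_sum_row /=.
  by apply: eq_bigr => j _; rewrite rowK.
pose A := (\matrix_j prow hv (phi T) (ps i j)) *m J1 i.
have uA : A \in unitmx.
  rewrite -row_free_unit; apply/inj_row_free => r rA.
  have [|_] := key (Lu r); first by rewrite LuE -mulmxA.
  move=> /(crow_eq0 hv1); rewrite LuE -/(pmx hv1 x1 ps i) => e.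
  by rewrite -[r](mulmxK (u i)) e mul0mx.
move=> z1 t; apply: all_t.
(* The correction making [L0] vanish on the image of [J1]. The corrected combination is then zero on
   [x1] too, where [L0] already is, so independence on [x1] gives [r = 0]. *)
pose r := crow hv (phi T) L0 *m J1 i *m invmx A.
have catE w (y : rep R w) (L L' : seq (C * qpath i inf)) : comb y (L ++ L') = comb y L + comb y L'.
  by rewrite /comb big_cat.
have [|k1] := key (L0 ++ Lu (- r)).
  rewrite /crow catE raddfD /= -/(crow hv (phi T) L0) -/(crow hv (phi T) (Lu (- r))) LuE mulmxDl.
  by rewrite !mulNmx -mulmxA -/A /r mulmxKV // subrr.
rewrite catE z1 add0r => /(crow_eq0 hv1); rewrite LuE -/(pmx hv1 x1 ps i) => e.
have r0 : - r = 0 by rewrite -[- r](mulmxK (u i)) e mul0mx.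
move: k1; rewrite catE r0.
have -> : comb (phi T) (Lu 0) = 0 by apply/(crow_eq0 hv); rewrite LuE mul0mx.
by rewrite addr0.
Qed.

End DownwardCone.

Section FlowToHecke.
Variables (R : realType) (Q : quiver) (inf : Q).
Notation C := R[i].

Lemma hom_iso_to_subrep (w' w : dimvec Q) (J : forall i, 'M[C]_(w i, w' i)) (z : rep R w') (x : rep R w) :
  is_hom J z x -> mono J -> iso_to_subrep z x.
Proof.
move=> h inj.
have /fin_all_exists [U hU] (i : Q) : exists U : {vspace 'cV[C]_(w i)},
    forall c, c \in U <-> exists b : 'cV[C]_(w' i), c = J i *m b.
  apply: vspace_of_pred => [|k u u' [b ->] [b' ->]]; first by exists 0; rewrite mulmx0.
  by exists (k *: b + b'); rewrite mulmxDr scalemxAr.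
exists U, J; split => // a c /hU [b ->]; apply/hU; exists (z a *m b).
by rewrite !mulmxA h.
Qed.

Lemma gamma_gt0 (w v : dimvec Q) : w inf = 1%N -> v inf = 1%N -> 0 < slope_gap w (wsize R v).
Proof. by move=> hw hv; rewrite divr_gt0 // (wsize_gt0 _ hw, wsize_gt0 _ hv). Qed.

Lemma flow_moduli_hecke (rels : seq (relation R Q)) (v v1l : dimvec Q) (k : Q) :
  v inf = 1%N -> k <> inf -> v1l inf = 1%N ->
  flow_moduli inf rels v (dim_sub_basis v1l k) v1l `<=` hecke inf k rels v1l.
Proof.
move=> hv hk hl c [[xu xl] [[[[nxu _] _] [[nxl _] _]] fc]].
move=> [v2u [v2l [x1u [x2u [x1l [x2l [su sl ->]]]]]]] /=.
have [Ju [Ju2 [osu hu [lu eu] stu mu]]] := su.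
have [Jl [Jl2 [osl _ [ll el] stl ml]]] := sl.
have [hu2 _] := crit_splitting_Bf hv hu osu eu mu.
have [hl2 BE] := crit_splitting_Bf hv hl osl el ml.
have [u11 u22 u12 us uE] := osu; have [l11 l22 l12 ls lE] := osl.
have homu : is_hom Ju x1u xu := orth_hom1 u11 u12 uE.
have homl : is_hom Jl x1l xl := orth_hom1 l11 l12 lE.
have cogu : cogen inf x1u by apply/(stable_cogen x1u hu).
have cogl : cogen inf x1l by apply/(stable_cogen x1l hl).
split.
  split; [exists x1u|exists x1l] => //; split=> //.
    exact: hom_nu_zero homu (orth_mono1 u11) nxu.
  exact: hom_nu_zero homl (orth_mono1 l11) nxl.
exists x1u, x1l; split=> //.
have [y ny [phi [/gradient_flowE [p0 fl] limu liml]]] := fc.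
have rl : rel_le inf x1u x1l.
  move=> i L e.
  have z := flow_limit_comb hv hl hl2 l11 l22 l12 ls (gamma_gt0 hl hv) BE fl liml homl cogl e.
  have xz : comb xu L = 0.
    have lc : mlim (-oo_ R) (fun t => comb (phi t) L) (comb xu L) by exact: mlim_comb.
    have uq := @mlim_unique R (-oo_ R) _ _ _ (fun t => comb (phi t) L) _ 0 lc.
    by apply: uq; apply: mlim_ext (mlim_cst _ 0) => // s; rewrite z.
  by apply: (row_inj_mx (adj_mono (u11 inf))); rewrite (hom_comb _ homu) xz mul0mx.
have [J [hJ mJ]] := rel_le_hom hu hl cogu cogl rl.
exact: hom_iso_to_subrep hJ mJ.
Qed.

End FlowToHecke.

(** * From the Hecke correspondence to flow lines *)

Section TriangularForm.
Variables (R : realType) (Q : quiver).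
Notation C := R[i].
Implicit Types w : dimvec Q.

Lemma lin_inj_surj (K : fieldType) (V : vectType K) (f : V -> V) :
  (forall (k : K) u v, f (k *: u + v) = k *: f u + f v) -> (forall u, f u = 0 -> u = 0) ->
  forall v, exists u, f u = v.
Proof.
move=> flin finj v.
pose fL : {linear V -> V} := HB.pack f (GRing.isLinear.Build K V V *:%R f flin).
pose g := linfun fL.
have gE u : g u = f u by rewrite lfunE.
have kg : lker g == 0%VS.
  by rewrite -subv0; apply/subvP => u; rewrite memv_ker gE memv0 => /eqP /finj ->.
have : v \in limg g.
  by rewrite (lker0_limgf kg) memvf.
by move=> /memv_imgP [u _ ->]; exists u; rewrite gE.
Qed.

(** The coordinate splitting into the first [m] and the remaining coordinates, by numerical indices
    so that no cast between [n] and [m + (n - m)] arises. *)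
Definition inc1 (m n : nat) : 'M[C]_(n, m) := \matrix_(p, q) ((p : nat) == q)%:R.
Definition inc2 (m n : nat) : 'M[C]_(n, n - m) := \matrix_(p, q) ((p : nat) == m + q)%N%:R.

Lemma inc11 m n : (m <= n)%N -> adj (inc1 m n) *m inc1 m n = 1%:M.
Proof.
move=> mn; apply/matrixP => p q; rewrite !mxE (bigD1 (widen_ord mn p)) //=.
rewrite !mxE eqxx conjc_nat mul1r big1 ?addr0; first by rewrite -val_eqE.
move=> j /negPf; rewrite -val_eqE /= => jp; rewrite !mxE.
by rewrite [(j : nat) == p]jp rmorph0 mul0r.
Qed.

Lemma inc22 m n : (m <= n)%N -> adj (inc2 m n) *m inc2 m n = 1%:M.
Proof.
move=> mn; apply/matrixP => p q; rewrite !mxE.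
have pm : (m + p < n)%N by rewrite -ltn_subRL.
rewrite (bigD1 (Ordinal pm)) //= !mxE /= eqxx conjc_nat mul1r big1 ?addr0.
  by rewrite eqn_add2l -val_eqE.
move=> j /negPf; rewrite -val_eqE /= => jp; rewrite !mxE.
by rewrite jp rmorph0 mul0r.
Qed.

Lemma inc12 m n : adj (inc1 m n) *m inc2 m n = 0.
Proof.
apply/matrixP => p q; rewrite !mxE big1 // => j _; rewrite !mxE conjc_nat.
case: eqP => [->|_]; last by rewrite mul0r.
by rewrite ltn_eqF ?mulr0 // (leq_trans (ltn_ord p)) // leq_addr.
Qed.

Lemma inc_sum m n : (m <= n)%N ->
  inc1 m n *m adj (inc1 m n) + inc2 m n *m adj (inc2 m n) = 1%:M.
Proof.
move=> mn; apply/matrixP => p q; rewrite !mxE.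
have [pm|mp] := ltnP p m.
  rewrite (bigD1 (Ordinal pm)) //= !mxE /= eqxx mul1r conjc_nat big1; last first.
    by move=> j /negPf; rewrite -val_eqE /= eq_sym => h; rewrite !mxE h mul0r.
  rewrite addr0 big1 ?addr0; first by rewrite eq_sym -val_eqE.
  by move=> j _; rewrite !mxE ltn_eqF ?mul0r // (leq_trans pm) // leq_addr.
have pn : (p - m < n - m)%N by rewrite ltn_sub2r // (leq_ltn_trans mp).
rewrite big1 ?add0r; last first.
  by move=> j _; rewrite !mxE gtn_eqF ?mul0r // (leq_trans (ltn_ord j)).
rewrite (bigD1 (Ordinal pn)) //= !mxE /= subnKC // eqxx mul1r conjc_nat big1 ?addr0.
  by rewrite eq_sym -val_eqE.
move=> j /negPf; rewrite -val_eqE /= => h; rewrite !mxE.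
by rewrite -{1}(subnKC mp) eqn_add2l eq_sym h mul0r.
Qed.

Lemma inc1_trans m n p : (m <= n)%N -> (n <= p)%N -> inc1 n p *m inc1 m n = inc1 m p.
Proof.
move=> mn np; apply/matrixP => i j; rewrite !mxE (bigD1 (widen_ord mn j)) //= !mxE /= eqxx mulr1.
rewrite big1 ?addr0 // => k /negPf; rewrite -val_eqE /= => h.
by rewrite !mxE h mulr0.
Qed.

Section Blocks.
Variables (w w1 w2 : dimvec Q) (j1 : forall i, 'M[C]_(w i, w1 i)) (j2 : forall i, 'M[C]_(w i, w2 i)).
Hypotheses (j11 : forall i, adj (j1 i) *m j1 i = 1%:M) (j22 : forall i, adj (j2 i) *m j2 i = 1%:M)
  (j12 : forall i, adj (j1 i) *m j2 i = 0)
  (jsum : forall i, j1 i *m adj (j1 i) + j2 i *m adj (j2 i) = 1%:M).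

(** The embedding and the coordinate inclusion [j1] have the same rank, so some automorphism carries
    [j1] to the embedding; conjugate [y] by its inverse. *)
Lemma triangularise (x1 : rep R w1) (y : rep R w) : iso_to_subrep x1 y ->
  exists z : rep R w, iso_class z = iso_class y /\ is_hom j1 x1 z.
Proof.
move=> [U [J [_ _ inj hom]]].
have rk m n (A : 'M[C]_(m, n)) : injective (fun b : 'cV[C]_n => A *m b) -> \rank A^T = n.
  move=> iA; apply/eqP; rewrite -[_ == n]/(row_free A^T); apply/inj_row_free => v h.
  apply: (can_inj (@trmxK _ _ _)); rewrite trmx0; apply: (row_inj_mx iA).
  by apply: (can_inj (@trmxK _ _ _)); rewrite trmx_mul trmxK h trmx0.
have /fin_all_exists [G hG] (i : Q) : exists G : 'M[C]_(w i), G \in unitmx /\ G *m j1 i = J i.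
  have e : (j1 i)^T *m (J i *m adj (j1 i))^T = (J i)^T by rewrite -trmx_mul -mulmxA j11 mulmx1.
  have [|g ug gE] := @complete_unitmx _ _ _ (j1 i)^T (J i *m adj (j1 i))^T.
    by rewrite e !rk //; exact: (adj_mono (j11 i)).
  exists g^T; rewrite unitmx_tr; split=> //.
  by apply: (can_inj (@trmxK _ _ _)); rewrite trmx_mul trmxK -gE e.
pose z := act (fun i => invmx (G i)) y.
have uG i : G i \in unitmx by case: (hG i).
exists z; split; first by apply: iso_class_act => i; rewrite unitmx_inv.
move=> a; rewrite /z /act invmxK -!mulmxA (hG _).2 -hom -(hG (qhead a)).2 -!mulmxA mulKmx //.
Qed.

Variables (x1 : rep R w1) (y : rep R w).
Hypothesis homy : is_hom j1 x1 y.

Definition quot_rep : rep R w2 := fun a => adj (j2 (qhead a)) *m y a *m j2 (qtail a).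
(** The associated graded of the block triangular [y]; it becomes the point from which the orbit
    emanates. *)
Definition diag_rep : rep R w := fun a => j1 (qhead a) *m x1 a *m adj (j1 (qtail a))
    + j2 (qhead a) *m quot_rep a *m adj (j2 (qtail a)).
Definition off_diag : rep R w := fun a => y a - diag_rep a.

Lemma quot_hom a : adj (j2 (qhead a)) *m y a = quot_rep a *m adj (j2 (qtail a)).
Proof.
rewrite -[LHS]mulmx1 -(jsum (qtail a)) mulmxDr !mulmxA -[adj _ *m y a *m j1 _]mulmxA -homy.
by rewrite !mulmxA (orth21 j12) !mul0mx add0r.
Qed.

Lemma quot_rel_eval r : adj (j2 (rel_head r)) *m rel_eval y r = rel_eval quot_rep r *m adj (j2 (rel_tail r)).
Proof.
rewrite /rel_eval mulmx_sumr mulmx_suml; apply: eq_bigr => t _.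
rewrite -scalemxAr -scalemxAl; congr (_ *: _); elim: t.2 => [|a p ih] /=.
  by rewrite mulmx1 mul1mx.
by rewrite mulmxA quot_hom -[LHS]mulmxA ih mulmxA.
Qed.

Lemma quot_nu_zero rels : nu_zero rels y -> nu_zero rels quot_rep.
Proof.
apply: sub_all => r /eqP e; apply/eqP.
have := quot_rel_eval r; rewrite e mulmx0 => /(congr1 (mulmx^~ (j2 (rel_tail r)))).
by rewrite mul0mx -mulmxA j22 mulmx1.
Qed.

(** Relations pass to subrepresentations and quotients, hence to the sum of the two. *)
Lemma diag_nu_zero rels : nu_zero rels y -> nu_zero rels diag_rep.
Proof.
move=> ny.
have n1 : nu_zero rels x1 := hom_nu_zero homy (orth_mono1 j11) ny.
have h1 : is_hom j1 x1 diag_rep := orth_hom1 j11 j12 (fun a => erefl).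
have h2 : is_hom j2 quot_rep diag_rep := orth_hom2 j22 j12 (fun a => erefl).
have n2 := quot_nu_zero ny.
elim: rels n1 n2 {ny} => //= r rels ih /andP[/eqP e1 n1] /andP[/eqP e2 n2].
apply/andP; split; last exact: ih.
apply/eqP; apply: (cancel_orth jsum); rewrite mul0mx.
  by rewrite -(hom_comb (rel_terms r) h1) [comb _ _]e1 mulmx0.
by rewrite -(hom_comb (rel_terms r) h2) [comb _ _]e2 mulmx0.
Qed.

Lemma off_diagE a : off_diag a =
  j1 (qhead a) *m adj (j1 (qhead a)) *m y a *m j2 (qtail a) *m adj (j2 (qtail a)).
Proof.
apply: (cancel_orth jsum).
  rewrite /off_diag /diag_rep mulmxBl mulmxDl -!mulmxA j11 (orth21 j12) !mulmx0 !mulmx1 addr0.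
  by rewrite homy subrr.
rewrite /off_diag /diag_rep mulmxBl mulmxDl -!mulmxA j12 j22 !mulmx0 !mulmx1 add0r.
rewrite /quot_rep !mulmxA -{1}[y a]mul1mx -(jsum (qhead a)) mulmxDl mulmxDl.
by rewrite addrK.
Qed.

End Blocks.
End TriangularForm.

(** * The harmonic representative of an extension and the linearised flow *)

Section HarmonicGauge.
Variables (R : realType) (Q : quiver) (inf : Q).
Notation C := R[i].
Notation Re := complex.Re.

Lemma hmu2Dl (w : dimvec Q) (x x' y : rep R w) i :
  hmu2 (fun a => x a + x' a) y i = hmu2 x y i + hmu2 x' y i.
Proof.
rewrite /hmu2 -big_split; apply: eq_bigr => a _ /=.
by rewrite mulmxDl mulmxDr !putD opprD addrACA.
Qed.

Lemma putZ (w : dimvec Q) (i j : Q) (k : C) (A : 'M[C]_(w i)) : put (k *: A) j = k *: put A j.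
Proof. by have [<-|ne] := eqVneq i j; rewrite ?put_id ?put_neq ?scaler0. Qed.

Lemma hmu2Zl (w : dimvec Q) (x y : rep R w) (k : C) i :
  hmu2 (fun a => k *: x a) y i = k *: hmu2 x y i.
Proof.
rewrite /hmu2 scaler_sumr; apply: eq_bigr => a _ /=.
by rewrite -scalemxAl -scalemxAr !putZ scalerBr.
Qed.

Lemma hmu2_lin (w : dimvec Q) (x x' z y : rep R w) (l : C) i :
  (forall a, z a = l *: x a + x' a) -> hmu2 z y i = l *: hmu2 x y i + hmu2 x' y i.
Proof.
move=> e; have -> : z = fun a => l *: x a + x' a by exact: functional_extensionality_dep.
by rewrite -hmu2Zl -hmu2Dl.
Qed.

Lemma matrix0_rows m n (A : 'M[C]_(m, n)) : m = 0%N -> A = 0.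
Proof. by move=> e; subst m; apply/matrixP => -[]. Qed.

(** Only the 1 by 1 block at [k] can be non-zero, and the traces add up to 0. *)
Lemma hmu_dim1 (k : Q) (w2 : dimvec Q) (s : rep R w2) : w2 k = 1%N ->
  (forall i, i != k -> w2 i = 0%N) -> forall i, hmu s i = 0.
Proof.
move=> w2k w20 i; have [->|ik] := eqVneq i k; last by apply/matrix0_rows/w20.
have := tr_hmu s; rewrite (bigD1 k) //= big1 ?addr0; last first.
  by move=> j /w20 e; rewrite (matrix0_rows (hmu s j) e) raddf0.
have h1 (A : 'M[C]_(w2 k)) : A = (\tr A)%:M.
  by move: A; rewrite w2k => A; rewrite trace_mx11 -mx11_scalar.
by move=> e; rewrite [LHS]h1 e; apply/matrixP => p q; rewrite !mxE mul0rn.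
Qed.

Variables (w w1 w2 : dimvec Q) (j1 : forall i, 'M[C]_(w i, w1 i)) (j2 : forall i, 'M[C]_(w i, w2 i)).
Hypotheses (j11 : forall i, adj (j1 i) *m j1 i = 1%:M) (j22 : forall i, adj (j2 i) *m j2 i = 1%:M)
  (j12 : forall i, adj (j1 i) *m j2 i = 0)
  (jsum : forall i, j1 i *m adj (j1 i) + j2 i *m adj (j2 i) = 1%:M).
Local Notation pi1 i := (j1 i *m adj (j1 i)).
Local Notation pi2 i := (j2 i *m adj (j2 i)).

Lemma pi11 i : pi1 i *m pi1 i = pi1 i.
Proof. by rewrite mulmxA -[_ *m j1 i]mulmxA j11 mulmx1. Qed.
Lemma pi22 i : pi2 i *m pi2 i = pi2 i.
Proof. by rewrite mulmxA -[_ *m j2 i]mulmxA j22 mulmx1. Qed.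
Lemma pi12 i : pi1 i *m pi2 i = 0.
Proof. by rewrite mulmxA -[_ *m j2 i]mulmxA j12 mulmx0 mul0mx. Qed.
Lemma pi21 i : pi2 i *m pi1 i = 0.
Proof. by rewrite mulmxA -[_ *m j1 i]mulmxA (orth21 j12) mulmx0 mul0mx. Qed.
Lemma adj_pi1 i : adj (pi1 i) = pi1 i. Proof. by rewrite adjM adjK. Qed.
Lemma adj_pi2 i : adj (pi2 i) = pi2 i. Proof. by rewrite adjM adjK. Qed.

Variables (x1 : rep R w1) (s : rep R w2) (xu : rep R w).
Hypothesis xuE : forall a, xu a = j1 (qhead a) *m x1 a *m adj (j1 (qtail a))
                    + j2 (qhead a) *m s a *m adj (j2 (qtail a)).

Lemma xu_pi1 a : pi1 (qhead a) *m xu a = xu a *m pi1 (qtail a).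
Proof.
rewrite mulmxA -(orth_hom1 j11 j12 xuE) xuE mulmxDr !mulmxA.
rewrite -[j1 _ *m adj (j1 _) *m j1 _]mulmxA j11 mulmx1.
by rewrite -[j1 _ *m adj (j1 _) *m j2 _]mulmxA j12 mulmx0 !mul0mx addr0.
Qed.

Lemma xu_pi2 a : pi2 (qhead a) *m xu a = xu a *m pi2 (qtail a).
Proof.
have e i : pi2 i = 1%:M - pi1 i by rewrite -(jsum i) addrC addKr.
by rewrite !e mulmxBl mulmxBr xu_pi1 mul1mx mulmx1.
Qed.

Definition upper (b : rep R w) := forall a, b a = pi1 (qhead a) *m b a *m pi2 (qtail a).

Lemma upper_hmu2 b i : upper b -> hmu2 b xu i = pi1 i *m hmu2 b xu i *m pi2 i.
Proof.
move=> ub; rewrite {2}/hmu2 mulmx_sumr mulmx_suml; apply: eq_bigr => a _.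
have pc k (A : 'M[C]_(w k)) : pi1 i *m put A i *m pi2 i = put (pi1 k *m A *m pi2 k) i.
  exact: (put_conj (fun i => pi1 i) (fun i => pi2 i)).
have x2 : pi2 (qtail a) *m adj (xu a) = adj (xu a) *m pi2 (qhead a).
  by rewrite -[LHS]adjK adjM adjK adj_pi2 -xu_pi2 adjM adj_pi2.
have x1' : pi1 (qtail a) *m adj (xu a) = adj (xu a) *m pi1 (qhead a).
  by rewrite -[LHS]adjK adjM adjK adj_pi1 -xu_pi1 adjM adj_pi1.
rewrite mulmxBr mulmxBl !pc.
have -> : pi1 (qhead a) *m (b a *m adj (xu a)) *m pi2 (qhead a) = b a *m adj (xu a).
  transitivity (pi1 (qhead a) *m b a *m (adj (xu a) *m pi2 (qhead a))); first by rewrite !mulmxA.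
  by rewrite -x2 [LHS]mulmxA -(ub a).
have -> : pi1 (qtail a) *m (adj (xu a) *m b a) *m pi2 (qtail a) = adj (xu a) *m b a; last by [].
transitivity (pi1 (qtail a) *m adj (xu a) *m b a *m pi2 (qtail a)); first by rewrite !mulmxA.
rewrite x1'; transitivity (adj (xu a) *m (pi1 (qhead a) *m b a *m pi2 (qtail a))).
  by rewrite !mulmxA.
by rewrite -(ub a).
Qed.

Variable k : Q.
Hypotheses (kinf : k != inf) (w2k : w2 k = 1%N) (w20 : forall i, i != k -> w2 i = 0%N).
Hypothesis cog1 : cogen inf x1.

Definition gauge (A : 'M[C]_(w1 k, w2 k)) (i : Q) : 'M[C]_(w i) :=
  put (j1 k *m A *m adj (j2 k)) i.

Lemma gauge_upper A i : gauge A i = pi1 i *m gauge A i *m pi2 i.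
Proof.
have pc := put_conj (fun i => pi1 i) (fun i => pi2 i) i (j1 k *m A *m adj (j2 k)).
rewrite /gauge [RHS]pc; congr (put _ i).
by rewrite !mulmxA -[j1 k *m _ *m j1 k]mulmxA j11 mulmx1 -[_ *m adj (j2 k) *m j2 k]mulmxA j22 mulmx1.
Qed.

Lemma inf_act_gauge_upper A : upper (inf_act xu (gauge A)).
Proof.
move=> a; rewrite /inf_act mulmxBr mulmxBl; congr (_ - _).
  transitivity (pi1 (qhead a) *m gauge A (qhead a) *m (xu a *m pi2 (qtail a))).
    by rewrite -xu_pi2 [RHS]mulmxA -gauge_upper.
  by rewrite !mulmxA.
transitivity (pi1 (qhead a) *m xu a *m gauge A (qtail a) *m pi2 (qtail a)); last by rewrite !mulmxA.
rewrite xu_pi1; transitivity (xu a *m (pi1 (qtail a) *m gauge A (qtail a) *m pi2 (qtail a))).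
  by rewrite -gauge_upper.
by rewrite !mulmxA.
Qed.

(** The Laplacian d^* d on gauges from the quotient to the subrepresentation: d is the infinitesimal
    action at [xu], and its adjoint d^* is [hmu2 _ xu] by [tr_hmu2]. *)
Definition gauge_hmu (A : 'M[C]_(w1 k, w2 k)) : 'M[C]_(w1 k, w2 k) :=
  adj (j1 k) *m hmu2 (inf_act xu (gauge A)) xu k *m j2 k.

Lemma gauge_hmu_lin (l : C) A B : gauge_hmu (l *: A + B) = l *: gauge_hmu A + gauge_hmu B.
Proof.
have e a : inf_act xu (gauge (l *: A + B)) a = l *: inf_act xu (gauge A) a + inf_act xu (gauge B) a.
  have g i : gauge (l *: A + B) i = l *: gauge A i + gauge B i.
    by rewrite /gauge mulmxDr mulmxDl putD -scalemxAr -scalemxAl putZ.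
  rewrite /inf_act !g mulmxDl mulmxDr -scalemxAl -scalemxAr scalerBr opprD.
  by rewrite addrACA.
have h : hmu2 (inf_act xu (gauge (l *: A + B))) xu k =
    l *: hmu2 (inf_act xu (gauge A)) xu k + hmu2 (inf_act xu (gauge B)) xu k.
  exact: (hmu2_lin _ _ e).
have lin (a : 'M[C]_(w1 k, w k)) (b : 'M[C]_(w k, w2 k)) (X Y : 'M[C]_(w k)) :
    l *: (a *m X *m b) + a *m Y *m b = a *m (l *: X + Y) *m b.
  by rewrite mulmxDr mulmxDl -scalemxAr -scalemxAl.
by rewrite /gauge_hmu lin; congr (_ *m _ *m _); exact: h.
Qed.

(* A gauge in the kernel is a homomorphism from the simple quotient to [x1]. *)
Lemma gauge_hmu_inj A : gauge_hmu A = 0 -> A = 0.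
Proof.
move=> h; pose z := inf_act xu (gauge A).
have zz : rnsq z = 0.
  have -> : rnsq z = Re (\sum_a \tr (z a *m adj (z a))).
    by rewrite Re_sum; apply: eq_bigr => a _; rewrite -inner_nsq.
  rewrite -[\sum_a _]/(\sum_a \tr (inf_act xu (gauge A) a *m adj (z a))) -tr_hmu2.
  rewrite (bigD1 k) //= big1 ?addr0; last first.
    by move=> i ik; rewrite /gauge put_neq 1?eq_sym // mul0mx raddf0.
  rewrite /gauge put_id -!mulmxA mxtrace_mulC -!mulmxA.
  have -> : adj (j2 k) *m (hmu2 xu z k *m j1 k) = adj (gauge_hmu A).
    by rewrite /gauge_hmu !adjM adjK adj_hmu2.
  by rewrite h adj0 mulmx0 raddf0.
have z0 a : z a = 0.
  apply: nsq_eq0; apply/eqP; rewrite eq_le nsq_ge0 andbT -zz.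
  exact: nsq_le_rnsq.
have hg : is_hom (gauge A) xu xu.
  by move=> a; apply/eqP; rewrite -subr_eq0; apply/eqP; exact: z0.
apply: (cogen_mx cog1) => p.
have := hom_path_eval p hg; rewrite {1}/gauge put_neq // mul0mx => e.
have : path_eval xu p *m gauge A k *m j2 k = 0 by rewrite -e mul0mx.
rewrite /gauge put_id -!mulmxA j22 mulmx1 mulmxA -(hom_path_eval p (orth_hom1 j11 j12 xuE)).
by rewrite -mulmxA; apply: (row_inj_mx (adj_mono (j11 inf))).
Qed.

Lemma unipotent_inv n (U : 'M[C]_n) : U *m U = 0 ->
  1%:M + U \in unitmx /\ invmx (1%:M + U) = 1%:M - U.
Proof.
move=> U2; have e : (1%:M + U) *m (1%:M - U) = 1%:M.
  by rewrite mulmxDl !mulmxBr !mul1mx mulmx1 U2 subr0 subrK.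
have [u _] := mulmx1_unit e; split=> //.
by apply: (can_inj (mulKmx u)); rewrite mulmxV // e.
Qed.

Lemma block12_r i j (B : 'M[C]_(w i, w j)) : B = pi1 i *m B *m pi2 j -> B *m pi2 j = B.
Proof. by move=> e; rewrite {1}e -mulmxA pi22 -e. Qed.

Lemma block12_l i j (B : 'M[C]_(w i, w j)) : B = pi1 i *m B *m pi2 j -> pi1 i *m B = B.
Proof. by move=> e; rewrite {1}e mulmxA [pi1 i *m (_ *m _)]mulmxA pi11 -e. Qed.

Lemma block12_mul0 m n i (X : 'M[C]_(m, w i)) (Y : 'M[C]_(w i, n)) :
  X *m pi2 i = X -> pi1 i *m Y = Y -> X *m Y = 0.
Proof. by move=> <- <-; rewrite mulmxA -[X *m _ *m _]mulmxA pi21 mulmx0 mul0mx. Qed.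

(** Solve d^* d A = - d^* b. The gauge transformation 1 + U then replaces [b] by b + d U exactly,
    because all products of two strictly triangular blocks vanish. *)
Lemma harmonic_gauge (y b : rep R w) : upper b -> (forall a, y a = xu a + b a) ->
  exists z b', [/\ iso_class z = iso_class y, upper b', (forall a, z a = xu a + b' a) &
    forall i, hmu2 b' xu i = 0].
Proof.
move=> ub yE.
have [A hA] := @lin_inj_surj _ _ gauge_hmu gauge_hmu_lin gauge_hmu_inj
  (- (adj (j1 k) *m hmu2 b xu k *m j2 k)).
pose U := gauge A.
have UU i : U i *m U i = 0.
  by apply: block12_mul0; [apply: block12_r|apply: block12_l]; apply: gauge_upper.
pose g i := 1%:M + U i.
have ug i : g i \in unitmx by case: (unipotent_inv (UU i)).
have gi i : invmx (g i) = 1%:M - U i by case: (unipotent_inv (UU i)).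
pose b' : rep R w := fun a => b a + inf_act xu U a.
have ub' : upper b'.
  by move=> a; rewrite /b' mulmxDr mulmxDl -ub -inf_act_gauge_upper.
exists (act g y), b'; split => //.
- exact: iso_class_act.
- move=> a.
  have Ur i : U i *m pi2 i = U i by apply: block12_r; apply: gauge_upper.
  have Ul i : pi1 i *m U i = U i by apply: block12_l; apply: gauge_upper.
  have Ub : U (qhead a) *m b a = 0 by apply: block12_mul0 => //; apply/block12_l/ub.
  have bU : b a *m U (qtail a) = 0 by apply: block12_mul0 => //; apply/block12_r/ub.
  have UxU : U (qhead a) *m xu a *m U (qtail a) = 0.
    by apply: block12_mul0 => //; rewrite -mulmxA -xu_pi2 mulmxA Ur.
  rewrite /act gi /g yE mulmxBr mulmx1 mulmxDl mul1mx mulmxDr Ub addr0 !mulmxDl.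
  by rewrite bU UxU !addr0 /b' /inf_act -!addrA; congr (_ + (_ + _)).
move=> i; rewrite (upper_hmu2 i ub').
have [->|ik] := eqVneq i k; last first.
  by rewrite (matrix0_cols (j2 i) (w20 ik)) mul0mx mulmx0.
have -> : pi1 k *m hmu2 b' xu k *m pi2 k = j1 k *m (adj (j1 k) *m hmu2 b' xu k *m j2 k) *m adj (j2 k).
  by rewrite !mulmxA.
have -> : adj (j1 k) *m hmu2 b' xu k *m j2 k = 0; last by rewrite mulmx0 mul0mx.
by rewrite /b' hmu2Dl mulmxDr mulmxDl -/(gauge_hmu A) hA subrr.
Qed.

Variables (c : Q -> R) (gam : R).
Hypotheses (Bx1 : forall i, Bf c x1 i = ((1 - gam)%:C%C)%:M) (c1 : forall i, i != inf -> c i = 1).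

Lemma split_Bf i : Bf c xu i = ((1 - gam)%:C%C) *: pi1 i + pi2 i.
Proof.
rewrite (orth_Bf j11 j22 j12 jsum xuE) Bx1 mul_mx_scalar -scalemxAl; congr (_ + _).
rewrite /Bf (hmu_dim1 s w2k w20) scaler0 add0r mul_mx_scalar -scalemxAl.
have [e|ne] := eqVneq i inf; last by rewrite c1 // scale1r.
have e0 : w2 i = 0%N by apply: w20; rewrite e eq_sym.
by rewrite (matrix0_cols (j2 i) e0) mul0mx scaler0.
Qed.

Lemma split_Bf1 i : Bf c xu i = 1%:M - (gam%:C%C) *: pi1 i.
Proof. by rewrite split_Bf rmorphB scalerBl scale1r -(jsum i) addrAC. Qed.

Lemma split_bfield a : bfield c xu a = 0.
Proof.
rewrite /bfield /inf_act !split_Bf1 mulmxBl mulmxBr mul1mx mulmx1 -scalemxAl -scalemxAr xu_pi1.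
by rewrite subrr oppr0.
Qed.

(** The linearisation of [bfield] at [xu] ([mder_bfield]): the first term keeps [Bf] fixed, the
    second differentiates it. *)
Definition dbfield (xi : rep R w) : rep R w := fun a =>
  - (inf_act xi (Bf c xu) a +
     inf_act xu (fun i => (2^-1)%:C%C *: (hmu2 xi xu i + hmu2 xu xi i)) a).

(** Harmonicity kills the variation of [Bf]; what remains acts by the difference 1 - (1 - gam) of
    the eigenvalues on the two summands. *)
Lemma dbfield_harmonic b : upper b -> (forall i, hmu2 b xu i = 0) -> forall a,
  dbfield b a = gam%:C%C *: b a.
Proof.
move=> ub h a; have lb := block12_l (ub a); have rb := block12_r (ub a).
have h' i : hmu2 xu b i = 0 by rewrite -adj_hmu2 h adj0.
rewrite /dbfield /inf_act !h !h' !addr0 !scaler0 mul0mx mulmx0 subr0 addr0.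
have -> : Bf c xu (qhead a) *m b a = (1 - gam)%:C%C *: b a.
  rewrite split_Bf mulmxDl -scalemxAl lb.
  have -> : pi2 (qhead a) *m b a = 0 by rewrite -lb mulmxA pi21 mul0mx.
  by rewrite addr0.
have -> : b a *m Bf c xu (qtail a) = b a.
  rewrite split_Bf mulmxDr -scalemxAr rb.
  have -> : b a *m pi1 (qtail a) = 0 by rewrite -rb -mulmxA pi21 mulmx0.
  by rewrite scaler0 add0r.
by rewrite rmorphB scalerBl scale1r addrAC subrr add0r opprK.
Qed.

(** The variation of [Bf] contributes minus a sum of squares, and the commutator with the projection
    [pi1] has eigenvalues at most 1. So no growth rate exceeds [gam], which excludes resonances. *)
Lemma dbfield_coercive (gam0 : 0 < gam) xi : \sum_a inner (dbfield xi a) (xi a) <= gam * rnsq xi.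
Proof.
pose D i := (2^-1)%:C%C *: (hmu2 xi xu i + hmu2 xu xi i).
have aD i : adj (D i) = D i by rewrite /D adjZ adjD !adj_hmu2 conj_real addrC.
have i2 : \sum_a inner (inf_act xu D a) (xi a) = \sum_i nsq (D i).
  rewrite /inner -Re_sum -tr_hmu2 Re_sum; apply: eq_bigr => i _.
  have e : inner (D i) (hmu2 xi xu i) = inner (D i) (hmu2 xu xi i).
    by rewrite -[in LHS]aD -[hmu2 xi xu i]adj_hmu2 inner_adj.
  rewrite -[hmu2 xu xi i]adj_hmu2 -/(inner _ _).
  rewrite -inner_nsq {3}/D innerC innerZl_real innerDl [inner (hmu2 xi xu i) _]innerC.
  rewrite [inner (hmu2 xu xi i) _]innerC -e; lra.
rewrite /rnsq mulr_sumr.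
apply: (@le_trans _ _ (\sum_a (gam * nsq (xi a) - inner (inf_act xu D a) (xi a)))); last first.
  rewrite sumrB i2 gerBl; apply: sumr_ge0 => i _; exact: nsq_ge0.
apply: ler_sum => a _; rewrite /dbfield innerNl innerDl opprD lerD2r.
have -> : inf_act xi (Bf c xu) a = - (gam%:C%C *: (pi1 (qhead a) *m xi a - xi a *m pi1 (qtail a))).
  rewrite /inf_act !split_Bf1 mulmxBl mulmxBr mul1mx mulmx1 -scalemxAl -scalemxAr scalerBr.
  by rewrite !opprB addrC addrA subrK.
rewrite innerNl opprK innerZl_real ler_wpM2l ?(ltW gam0) // innerBl.
have e1 m (J : 'M[C]_(w (qhead a), m)) :
    inner (J *m adj J *m xi a) (xi a) = nsq (adj J *m xi a).
  by rewrite -inner_nsq /inner adjM adjK !mulmxA [in RHS]mxtrace_mulC !mulmxA.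
have e2 : inner (xi a *m pi1 (qtail a)) (xi a) = nsq (xi a *m j1 (qtail a)).
  by rewrite -inner_nsq /inner adjM !mulmxA.
have e3 : nsq (xi a) = nsq (adj (j1 (qhead a)) *m xi a) + nsq (adj (j2 (qhead a)) *m xi a).
  by rewrite -!e1 -innerDl -mulmxDl jsum mul1mx inner_nsq.
rewrite e1 e2 e3; have := nsq_ge0 (xi a *m j1 (qtail a)).
have := nsq_ge0 (adj (j2 (qhead a)) *m xi a); lra.
Qed.

End HarmonicGauge.

(** * Power series orbit leaving the diagonal point *)

Section UnstableFlow.
Variables (R : realType) (Q : quiver) (w : dimvec Q).
Notation C := R[i].
Notation Re := complex.Re.
Notation Im := complex.Im.

Lemma is_derive_peval d (p : pexp R d) (x u : 'I_d -> R) :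
  is_derive (0 : R) (1 : R) (fun s => peval p (fun j => x j + s * u j)) (\sum_j pgrad p x j * u j).
Proof.
have x0 : (fun j => x j + 0 * u j) = x by apply/funext => j; rewrite mul0r addr0.
elim: p => [a|i|p ihp q ihq|p ihp q ihq] /=.
- rewrite big1 => [|j _]; last by rewrite mul0r.
  exact: is_derive_cst.
- rewrite (bigD1 i) //= eqxx mul1r big1 => [|j]; last by rewrite eq_sym => /negPf ->; rewrite mul0r.
  have d1 := is_deriveM (is_derive_id (0 : R) (1 : R)) (is_derive_cst (u i) (0 : R) (1 : R)).
  have d2 := is_deriveD (is_derive_cst (x i) (0 : R) (1 : R)) d1.
  by apply: is_derive_ext d2 => //; rewrite !scale_mul /=; ring.
- apply: is_derive_ext (is_deriveD ihp ihq) => //.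
  by rewrite -big_split; apply: eq_bigr => j _; rewrite mulrDl.
- apply: is_derive_ext (is_deriveM ihp ihq) => //.
  rewrite !scale_mul x0 !mulr_sumr -big_split; apply: eq_bigr => j _ /=; ring.
Qed.

Lemma encD (x xi : rep R w) (s : R) k :
  enc (fun a => x a + s%:C%C *: xi a) k = enc x k + s * enc xi k.
Proof.
rewrite /enc; case: (enum_val k) => [[a [p q]] b] /=; rewrite !mxE.
by case: b; rewrite ?Re_add ?Im_add ?Re_mul ?Im_mul /=; ring.
Qed.

Lemma is_derive_enc (phi : R -> rep R w) t (D : rep R w) k :
  (forall a, mder (fun s => phi s a) t (D a)) -> is_derive t (1 : R) (fun s => enc (phi s) k) (enc D k).
Proof.
move=> h; rewrite /enc; case: (enum_val k) => [[a [p q]] b] /=.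
by have [d1 d2] := h a p q; case: b.
Qed.

Lemma mder_line m n (A B : 'M[C]_(m, n)) t : mder (fun s => A + s%:C%C *: B) t B.
Proof.
move=> p q; split.
  have d1 := is_deriveM (is_derive_id t (1 : R)) (is_derive_cst (Re (B p q)) t (1 : R)).
  have d2 := is_deriveD (is_derive_cst (Re (A p q)) t (1 : R)) d1.
  apply: is_derive_ext d2 => [s|]; last by rewrite !scale_mul /=; ring.
  by rewrite !mxE Re_add Re_mul /= mul0r subr0.
have d1 := is_deriveM (is_derive_id t (1 : R)) (is_derive_cst (Im (B p q)) t (1 : R)).
have d2 := is_deriveD (is_derive_cst (Im (A p q)) t (1 : R)) d1.
apply: is_derive_ext d2 => [s|]; last by rewrite !scale_mul /=; ring.
by rewrite !mxE Im_add Im_mul /= mul0r addr0.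
Qed.

Lemma mder_bfield c (x xi : rep R w) a :
  mder (fun s => bfield c (fun b => x b + s%:C%C *: xi b) a) (0 : R) (dbfield x c xi a).
Proof.
pose z (s : R) : rep R w := fun b => x b + s%:C%C *: xi b.
have z0 : z 0 = x.
  by apply: functional_extensionality_dep => b; rewrite /z scale0r addr0.
have dz b : mder (fun s => z s b) (0 : R) (xi b) by exact: mder_line.
have dB i : mder (fun s => Bf c (z s) i) (0 : R) ((2^-1)%:C%C *: (hmu2 xi x i + hmu2 x xi i)).
  have h := mderD (mderZ (2^-1)%:C%C (mder_hmu2 (i := i) dz dz)) (mder_cst ((c i)%:C%C)%:M (0 : R)).
  by rewrite z0 addr0 in h.
have h := mderN (mderB (mderM (dB (qhead a)) (dz a)) (mderM (dz a) (dB (qtail a)))).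
apply: mder_ext h => //.
by rewrite z0 /dbfield /inf_act; congr (- _); rewrite [X in X - _]addrC opprD addrACA.
Qed.

Variables (c : Q -> R) (f : 'I_(ndim w) -> pexp R (ndim w)).
Hypothesis hf : forall u k, peval (f k) u = enc (bfield c (dec u)) k.

(** The expressions [f] are known only through their values, so both sides are compared as
    derivatives of one curve. *)
Lemma pgrad_bfield (x xi : rep R w) k :
  \sum_j pgrad (f k) (enc x) j * enc xi j = enc (dbfield x c xi) k.
Proof.
have d1 := is_derive_peval (f k) (enc x) (enc xi).
have d2 := is_derive_enc k (mder_bfield c x xi).
have e : (fun s => peval (f k) (fun j => enc x j + s * enc xi j)) =
         (fun s => enc (bfield c (fun b => x b + s%:C%C *: xi b)) k).
  apply/funext => s; rewrite hf; congr (enc (bfield c _) k).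
  by rewrite -[RHS]encK; congr dec; apply/funext => j; rewrite encD.
rewrite e in d1.
by rewrite -(@derive_val _ _ _ _ _ _ _ d1) (@derive_val _ _ _ _ _ _ _ d2).
Qed.

Variables (xu b : rep R w) (gam : R).
Hypotheses (gam0 : 0 < gam) (xu0 : forall a, bfield c xu a = 0)
  (bE : forall a, dbfield xu c b a = gam%:C%C *: b a)
  (coer : forall xi, \sum_a inner (dbfield xu c xi a) (xi a) <= gam * rnsq xi).

Lemma enc0 (x : rep R w) k : (forall a, x a = 0) -> enc x k = 0.
Proof. by move=> h; rewrite /enc; case: (enum_val k) => [[a [p q]] b'] /=; rewrite h mxE; case: b'. Qed.

Lemma encZ (x : rep R w) (s : R) k : enc (fun a => s%:C%C *: x a) k = s * enc x k.
Proof.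
rewrite /enc; case: (enum_val k) => [[a [p q]] b'] /=; rewrite !mxE.
by case: b'; rewrite ?Re_mul ?Im_mul /=; ring.
Qed.

(** Coercivity gives gam |u|^2 <= (T u, u) since n - 1 >= 1, hence injectivity and surjectivity, and
    by Young's inequality gam^2 |u|^2 <= |g|^2 <= d M^2. The constant uses d instead of its square
    root. *)
Lemma linear_part_inv n (g : 'I_(ndim w) -> R) (M : R) : (2 <= n)%N -> (forall i, `|g i| <= M) ->
  exists u : 'I_(ndim w) -> R, forall i,
    n%:R * gam * u i - \sum_j pgrad (f i) (enc xu) j * u j = g i /\ `|u i| <= ((ndim w)%:R / gam) * M.
Proof.
move=> n2 gM; pose d := ndim w.
pose T (u : 'rV[R]_d) := \row_i (n%:R * gam * u 0 i - \sum_j pgrad (f i) (enc xu) j * u 0 j).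
have Tlin (k : R) (u v : 'rV[R]_d) : T (k *: u + v) = k *: T u + T v.
  apply/rowP => i; rewrite !mxE.
  have -> : \sum_j pgrad (f i) (enc xu) j * (k *: u + v) 0 j =
    k * (\sum_j pgrad (f i) (enc xu) j * u 0 j) + \sum_j pgrad (f i) (enc xu) j * v 0 j.
    by rewrite mulr_sumr -big_split; apply: eq_bigr => j _; rewrite !mxE /=; ring.
  ring.
have n1 : 1 <= n%:R - 1 :> R by rewrite lerBrDr -[1 + 1]/(2%:R) ler_nat.
have low (u : 'rV[R]_d) : gam * (\sum_i u 0 i ^+ 2) <= \sum_i T u 0 i * u 0 i.
  pose xi := dec (fun i => u 0 i).
  have ux i : enc xi i = u 0 i by rewrite decK.
  have e1 : \sum_i (\sum_j pgrad (f i) (enc xu) j * u 0 j) * u 0 i <= gam * \sum_i u 0 i ^+ 2.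
    have -> : \sum_i u 0 i ^+ 2 = rnsq xi by rewrite -enc_sqr; apply: eq_bigr => i _; rewrite ux.
    apply: le_trans (coer xi); rewrite -sum_enc le_eqVlt; apply/orP; left; apply/eqP.
    by apply: eq_bigr => i _; rewrite -pgrad_bfield ux; congr (_ * _); apply: eq_bigr => j _; rewrite ux.
  have e2 : \sum_i T u 0 i * u 0 i = n%:R * gam * (\sum_i u 0 i ^+ 2)
      - \sum_i (\sum_j pgrad (f i) (enc xu) j * u 0 j) * u 0 i.
    by rewrite mulr_sumr -sumrB; apply: eq_bigr => i _; rewrite mxE; ring.
  have s0 : 0 <= \sum_i u 0 i ^+ 2 by apply: sumr_ge0 => i _; apply: sqr_ge0.
  rewrite e2; have : gam * \sum_i u 0 i ^+ 2 <= (n%:R - 1) * (gam * \sum_i u 0 i ^+ 2).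
    by rewrite ler_peMl // mulr_ge0 // ltW.
  lra.
have Tinj (u : 'rV[R]_d) : T u = 0 -> u = 0.
  move=> Tu; have := low u; rewrite Tu [X in _ <= X]big1 => [|i _]; last by rewrite mxE mul0r.
  rewrite pmulr_rle0 // => h; apply/rowP => i; rewrite mxE; apply/eqP; rewrite -sqrf_eq0 eq_le sqr_ge0 andbT.
  by apply: le_trans h; rewrite (bigD1 i) //= lerDl sumr_ge0 // => j _; apply: sqr_ge0.
have [u Tu] := lin_inj_surj Tlin Tinj (\row_i g i).
exists (fun i => u 0 i) => i; split.
  by have := congr1 (fun v : 'rV[R]_d => v 0 i) Tu; rewrite !mxE.
have M0 : 0 <= M by apply: le_trans (gM i).
have d1 : 1 <= d%:R :> R.
  by rewrite ler1n /d; case: (ndim w) i => [[]|].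
have bnd : (gam * u 0 i) ^+ 2 <= (d%:R * M) ^+ 2.
  have h1 : gam ^+ 2 * \sum_i u 0 i ^+ 2 <= \sum_i g i ^+ 2.
    have := low u; rewrite Tu => h.
    have h2 : 2 * gam * (\sum_i (\row_i g i) 0 i * u 0 i) <=
       \sum_i g i ^+ 2 + gam ^+ 2 * \sum_i u 0 i ^+ 2.
      rewrite !mulr_sumr -big_split /=; apply: ler_sum => j _; rewrite mxE.
      have := sqr_ge0 (g j - gam * u 0 j); nra.
    have := ler_wpM2l (ltW gam0) h; nra.
  have h3 : \sum_i g i ^+ 2 <= d%:R * M ^+ 2.
    apply: (@le_trans _ _ (\sum_(i < d) M ^+ 2)).
      by apply: ler_sum => j _; rewrite -real_normK ?num_real // lerXn2r ?nnegrE.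
    by rewrite sumr_const card_ord mulr_natl.
  have h4 : u 0 i ^+ 2 <= \sum_i u 0 i ^+ 2.
    by rewrite (bigD1 i) //= lerDl sumr_ge0 // => j _; apply: sqr_ge0.
  rewrite !exprMn; apply: (le_trans (ler_wpM2l (sqr_ge0 gam) h4)); apply: (le_trans h1).
  apply: (le_trans h3); rewrite ler_wpM2r ?sqr_ge0 // expr2 ler_peMl //.
rewrite mulrAC ler_pdivlMr // mulrC -[gam]gtr0_norm // -normrM.
have dM0 : 0 <= d%:R * M by rewrite mulr_ge0.
by rewrite -(ger0_norm dM0) -!sqrtr_sqr ler_wsqrtr.
Qed.

Lemma unstable_flow : exists (phi : R -> rep R w) T M, (forall t, t < T -> isflow c phi t) /\
  forall t k, t < T ->
    `|enc (phi t) k - enc xu k - expR (gam * t) * enc b k| <= M * expR (gam * t) ^+ 2.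
Proof.
have [|||n g M n2 gM|psi [T [M [h1 h2]]]] :=
  @poly_ode_unstable R (ndim w) f (enc xu) (enc b) gam ((ndim w)%:R / gam) gam0.
- by rewrite divr_ge0 // ltW.
- by move=> i; rewrite hf encK enc0.
- move=> i; rewrite pgrad_bfield -encZ; congr (enc _ i).
  exact: functional_extensionality_dep.
- exact: linear_part_inv.
exists (fun t => dec (psi t)), T, M; split=> [t tT|t k tT].
  by apply: solves_isflow hf _; apply: h1.
by rewrite decK; apply: h2.
Qed.

End UnstableFlow.

(** * The orbit lies in the class of the extension *)

Section UnstableOrbit.
Variables (R : realType) (Q : quiver) (inf : Q).
Notation C := R[i].
Notation Re := complex.Re.
Notation Im := complex.Im.

Lemma cvg_opp_ninfty : (- t : R) @[t --> -oo] --> +oo.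
Proof.
move=> A [M [_ hM]]; exists (- M); split; first by rewrite num_real.
by move=> t /= tM; apply: hM; rewrite ltrNr.
Qed.

Lemma cvg_exp_ninfty (g : R) : 0 < g -> expR (g * t) @[t --> -oo] --> 0.
Proof.
move=> g0; have := cvg_comp _ _ cvg_opp_ninfty (cvg_expN g0).
by apply: cvg_trans; apply: near_eq_cvg; near=> t; rewrite /= mulrNN.
Unshelve. all: by end_near. Qed.

Lemma mlim_enc (w : dimvec Q) (F : set_system R) (FF : ProperFilter F) (r : R -> rep R w) :
  (forall k, enc (r t) k @[t --> F] --> 0) -> forall a, mlim F (fun t => r t a) 0.
Proof.
move=> h a p q; rewrite mxE; split => /=.
  have := h (entry_rank p q true).
  by apply: cvg_trans; apply: near_eq_cvg; apply: nearW => t; rewrite /enc enum_rankK.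
have := h (entry_rank p q false).
by apply: cvg_trans; apply: near_eq_cvg; apply: nearW => t; rewrite /enc enum_rankK.
Qed.

Lemma mlimZr (F : set_system R) (FF : ProperFilter F) m n (e : R -> R) (A : R -> 'M[C]_(m, n)) (l : R) D :
  e @ F --> l -> mlim F A D -> mlim F (fun t => (e t)%:C%C *: A t) (l%:C%C *: D).
Proof.
move=> he hA p q; have ce : clim F (fun t => (e t)%:C%C) l%:C%C by split => //=; exact: cvg_cst.
by apply: clim_ext (climM FF ce (hA p q)) => *; rewrite mxE.
Qed.

Lemma enc_diff_quot (w : dimvec Q) (x y b : rep R w) (e : R) k :
  enc (fun a => e%:C%C *: (x a - y a) - b a) k = e * (enc x k - enc y k) - enc b k.
Proof.
rewrite /enc; case: (enum_val k) => [[a [p q]] c] /=; rewrite !mxE.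
by case: c; rewrite !(Re_add, Im_add, Re_opp, Im_opp, Re_mul, Im_mul) /=; ring.
Qed.

Lemma rescale_alg1 m n p (X X1 X2 B U V P O S T : 'M[C]_(m, n)) (J : 'M[C]_(n, p)) (k l : C) :
  X1 *m J = X *m J -> X2 *m J = 0 -> B *m J = 0 -> P *m J = U *m J -> O *m J = 0 ->
  S *m J = V *m J -> T *m J = 0 ->
  (X1 + k *: X2 + (k *: B + (k *: U + l *: V))) *m J
  = (X + B + (k *: P + O + (l *: S + k *: T))) *m J.
Proof.
move=> h1 h2 h3 h4 h5 h6 h7; rewrite !mulmxDl -!scalemxAl h1 h2 h3 h4 h5 h6 h7.
by rewrite !scaler0 !addr0 add0r.
Qed.

Lemma rescale_alg2 m n p (X X1 X2 B U V P O S T : 'M[C]_(m, n)) (J : 'M[C]_(n, p)) (k : C) :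
  X1 *m J = 0 -> X2 *m J = X *m J -> P *m J = 0 -> O *m J = U *m J ->
  S *m J = 0 -> T *m J = V *m J ->
  (X1 + k *: X2 + (k *: B + (k *: U + (k * k) *: V))) *m J
  = (X + B + (k *: P + O + ((k * k) *: S + k *: T))) *m (k *: J).
Proof.
move=> h1 h2 h3 h4 h5 h6; rewrite -scalemxAr !mulmxDl -!scalemxAl h1 h2 h3 h4 h5 h6.
by rewrite !scaler0 !add0r !scalerDr !scalerA !addrA.
Qed.

Variables (w w1 w2 : dimvec Q) (j1 : forall i, 'M[C]_(w i, w1 i)) (j2 : forall i, 'M[C]_(w i, w2 i)).
Hypotheses (j11 : forall i, adj (j1 i) *m j1 i = 1%:M) (j22 : forall i, adj (j2 i) *m j2 i = 1%:M)
  (j12 : forall i, adj (j1 i) *m j2 i = 0)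
  (jsum : forall i, j1 i *m adj (j1 i) + j2 i *m adj (j2 i) = 1%:M).
Local Notation pi1 i := (j1 i *m adj (j1 i)).
Local Notation pi2 i := (j2 i *m adj (j2 i)).
Variables (x1 : rep R w1) (s : rep R w2) (xu b y : rep R w).
Hypothesis xuE : forall a, xu a = j1 (qhead a) *m x1 a *m adj (j1 (qtail a))
                    + j2 (qhead a) *m s a *m adj (j2 (qtail a)).
Hypotheses (ub : upper j1 j2 b) (yE : forall a, y a = xu a + b a).

(* Conjugating by [pi1 + e pi2] turns [xu + e b + e r] into [y] up to terms
   that vanish with [e] and [r]. *)
Definition rescale (e : R) i : 'M[C]_(w i) := pi1 i + e%:C%C *: pi2 i.

(** Conjugation divides the block from [pi2] to [pi1] by e and multiplies the opposite one by e; as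
    the remainder enters as e r, its blocks get the factors e, 1, e^2 and e. The factor 1 is why [r]
    itself has to tend to 0. *)
Definition rescaled (e : R) (r : rep R w) : rep R w := fun a =>
  y a + (e%:C%C *: (pi1 (qhead a) *m r a *m pi1 (qtail a)) + pi1 (qhead a) *m r a *m pi2 (qtail a)
    + ((e * e)%:C%C *: (pi2 (qhead a) *m r a *m pi1 (qtail a))
       + e%:C%C *: (pi2 (qhead a) *m r a *m pi2 (qtail a)))).

Lemma rescale_inv e i : e != 0 -> rescale e^-1 i *m rescale e i = 1%:M.
Proof.
move=> e0; rewrite /rescale mulmxDl !mulmxDr -!scalemxAl -!scalemxAr.
rewrite (pi11 j11) (pi12 j12) (pi21 j12) (pi22 j22) !scaler0 addr0 add0r scalerA.
by rewrite -rmorphM mulVf // scale1r jsum.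
Qed.

Lemma rescale_hom (e : R) (x r : rep R w) :
  (forall a, x a = xu a + (e%:C%C *: b a + e%:C%C *: r a)) -> is_hom (rescale e) x (rescaled e r).
Proof.
move=> xE a.
have P1 i : pi1 i *m j1 i = j1 i by rewrite -mulmxA j11 mulmx1.
have P2 i : pi1 i *m j2 i = 0 by rewrite -mulmxA j12 mulmx0.
have Q1 i : pi2 i *m j1 i = 0 by rewrite -mulmxA (orth21 j12) mulmx0.
have Q2 i : pi2 i *m j2 i = j2 i by rewrite -mulmxA j22 mulmx1.
have lb : pi1 (qhead a) *m b a = b a := block12_l j11 (ub a).
have rb : b a *m pi2 (qtail a) = b a := block12_r j22 (ub a).
have b1 : b a *m j1 (qtail a) = 0 by rewrite -rb -mulmxA Q1 mulmx0.
have Qb : pi2 (qhead a) *m b a = 0 by rewrite -lb mulmxA (pi21 j12) mul0mx.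
have xp1 := xu_pi1 j11 j12 xuE a; have xp2 := xu_pi2 j11 j12 jsum xuE a.
have r1 : rescale e (qtail a) *m j1 (qtail a) = j1 (qtail a).
  by rewrite /rescale mulmxDl P1 -scalemxAl Q1 scaler0 addr0.
have r2 : rescale e (qtail a) *m j2 (qtail a) = e%:C%C *: j2 (qtail a).
  by rewrite /rescale mulmxDl P2 -scalemxAl Q2 add0r.
have L : rescale e (qhead a) *m x a = xu a *m pi1 (qtail a) + e%:C%C *: (xu a *m pi2 (qtail a)) +
   (e%:C%C *: b a + (e%:C%C *: (pi1 (qhead a) *m r a) + (e * e)%:C%C *: (pi2 (qhead a) *m r a))).
  rewrite xE /rescale mulmxDl !mulmxDr -!scalemxAl -!scalemxAr xp1 xp2 lb Qb.
  rewrite !scaler0 add0r !scalerA -rmorphM.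
  by rewrite addrACA; congr (_ + _); rewrite !addrA.
rewrite L; apply: (cancel_orth jsum).
  rewrite -[RHS]mulmxA r1 /rescaled yE; apply: rescale_alg1 => //.
  - by rewrite -mulmxA P1.
  - by rewrite -mulmxA Q1 mulmx0.
  - by rewrite -[LHS]mulmxA P1.
  - by rewrite -[LHS]mulmxA Q1 mulmx0.
  - by rewrite -[LHS]mulmxA P1.
  - by rewrite -[LHS]mulmxA Q1 mulmx0.
rewrite -[RHS]mulmxA r2 /rescaled yE rmorphM; apply: rescale_alg2 => //.
- by rewrite -mulmxA P2 mulmx0.
- by rewrite -mulmxA Q2.
- by rewrite -[LHS]mulmxA P2 mulmx0.
- by rewrite -[LHS]mulmxA Q2.
- by rewrite -[LHS]mulmxA P2 mulmx0.
- by rewrite -[LHS]mulmxA Q2.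
Qed.

Variables (c : Q -> R) (gam T M : R) (phi : R -> rep R w).
Hypotheses (hw : w inf = 1%N) (gam0 : 0 < gam).
Hypothesis fl : forall t, t < T -> isflow c phi t.
Hypothesis asym : forall t k, t < T ->
  `|enc (phi t) k - enc xu k - expR (gam * t) * enc b k| <= M * expR (gam * t) ^+ 2.

Let rest t : rep R w := fun a => ((expR (gam * t))^-1)%:C%C *: (phi t a - xu a) - b a.

Lemma near_lt_ninfty : \forall t \near -oo, t < T.
Proof. by exists T; split=> //; rewrite num_real. Qed.

Lemma rest_lim a : mlim -oo (fun t => rest t a) 0.
Proof.
apply: mlim_enc => k.
apply: (@cvg0_le _ _ _ _ _ (fun t => M * expR (gam * t))); last first.
  by rewrite -[X in _ --> X](mulr0 M); apply: cvgM; [exact: cvg_cst|exact: cvg_exp_ninfty].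
apply: filterS near_lt_ninfty => t tT; rewrite /rest enc_diff_quot.
have E0 := expR_gt0 (gam * t).
rewrite -(ler_pM2l E0) -[X in X * `|_|](gtr0_norm E0) -normrM mulrBr mulrA divff ?gt_eqF // mul1r.
by apply: (le_trans (asym k tT)); rewrite expr2 mulrCA.
Qed.

Lemma unstable_lim a : mlim -oo (fun t => phi t a) (xu a).
Proof.
have h : mlim -oo (fun t => (expR (gam * t))%:C%C *: (rest t a + b a)) ((0 : R)%:C%C *: (0 + b a)).
  apply: mlimZr; first exact: cvg_exp_ninfty.
  by apply: mlimD; [exact: rest_lim|exact: mlim_cst].
have h2 : mlim -oo (fun t => (expR (gam * t))%:C%C *: (rest t a + b a) + xu a)
    ((0 : R)%:C%C *: (0 + b a) + xu a) by apply: mlimD => //; exact: mlim_cst.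
apply: mlim_ext h2 => [t|]; last by rewrite scale0r add0r.
by rewrite /rest subrK scalerA -rmorphM divff ?gt_eqF ?expR_gt0 // scale1r subrK.
Qed.

(** Relations are constant along the orbit and invariant under [rescale], and vanishing is a closed
    condition, so they pass to the limit [y]. *)
Lemma unstable_orbit_rel_le t0 : t0 < T -> rel_le inf y (phi t0).
Proof.
move=> t0T i L e.
pose E t := expR (gam * t).
have E0 t : E t != 0 by rewrite gt_eqF // expR_gt0.
have z t : t < T -> comb (phi t) L = 0.
  move=> tT; apply: (@flow_comb_eq0 _ _ inf w hw c phi (Num.min t0 t) (Num.max t0 t) t0) => //.
  - by rewrite ge_min le_max lexx.
  - by move=> u /andP[_ h]; apply: fl; apply: le_lt_trans h _; rewrite gt_max t0T.
  - by rewrite ge_min le_max lexx !orbT.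
have zr t : t < T -> comb (rescaled (E t) (rest t)) L = 0.
  move=> tT; have hom : is_hom (rescale (E t)) (phi t) (rescaled (E t) (rest t)).
    apply: rescale_hom => a; rewrite /rest scalerBr scalerA -rmorphM divff ?E0 // scale1r.
    by rewrite [X in _ + X]addrC subrK addrC subrK.
  have := hom_comb L hom; rewrite z // mulmx0 => /esym h.
  have uG : rescale (E t) i \in unitmx by case/mulmx1_unit: (rescale_inv i (E0 t)).
  by rewrite -[LHS](mulmxK uG) h mul0mx.
have cE : E t @[t --> -oo] --> 0 by exact: cvg_exp_ninfty.
have lr a : mlim -oo (fun t => rescaled (E t) (rest t) a) (y a).
  have rl m n (A : 'M[C]_(m, w (qhead a))) (B : 'M[C]_(w (qtail a), n)) :
      mlim -oo (fun t => A *m rest t a *m B) 0.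
    have h : mlim -oo (fun t => A *m rest t a *m B) (A *m 0 *m B).
      by apply: mlimM; [apply: mlimM; [exact: mlim_cst|exact: rest_lim]|exact: mlim_cst].
    by apply: mlim_ext h => //; rewrite mulmx0 mul0mx.
  have cEE : (E t * E t) @[t --> -oo] --> (0 * 0 : R) by exact: cvgM.
  have h : mlim -oo (fun t => rescaled (E t) (rest t) a)
      (y a + ((0 : R)%:C%C *: 0 + 0 + ((0 * 0 : R)%:C%C *: 0 + (0 : R)%:C%C *: 0))).
    apply: mlimD; first exact: mlim_cst.
    apply: mlimD; apply: mlimD; try exact: rl; apply: mlimZr => //; exact: rl.
  by apply: mlim_ext h => //; rewrite !scaler0 !addr0.
have lc : mlim -oo (fun t => comb (rescaled (E t) (rest t)) L) (comb y L) by exact: mlim_comb.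
have uq := @mlim_unique R (-oo) _ _ _ _ _ 0 lc.
apply: uq; apply: mlim_near (mlim_cst _ 0).
by apply: filterS near_lt_ninfty => t tT; rewrite zr.
Qed.

End UnstableOrbit.

(** * Critical points obtained by splitting and by extension by zero *)

Section CriticalExtensions.
Variables (R : realType) (Q : quiver) (inf : Q).
Notation C := R[i].

(** Independence goes the opposite way to relations: a basis of functionals for [y] is one for
    [x]. *)
Lemma rel_le_cogen (w : dimvec Q) (y x : rep R w) : w inf = 1%N ->
  cogen inf y -> rel_le inf y x -> cogen inf x.
Proof.
move=> hw cy yx; have [ps u] := cogen_basis hw cy.
apply: (@pmx_cogen _ _ _ _ hw _ ps) => i.
rewrite -row_free_unit; apply/inj_row_free => c h.
pose L := [seq (c 0 j, ps i j) | j <- enum 'I_(w i)].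
have LE (z : rep R w) : crow hw z L = c *m pmx hw z ps i.
  rewrite crowE big_map big_enum /= mulmx_sum_row; apply: eq_bigr => j _.
  by rewrite rowK.
have e : c *m pmx hw y ps i = 0.
  by rewrite -LE; apply/crow_eq0; apply: yx; apply/(crow_eq0 hw); rewrite LE.
by apply: (can_inj (mulmxK (u i))); rewrite e mul0mx.
Qed.

Section Splitting.
Variables (v v1 v2 : dimvec Q) (J1 : forall i, 'M[C]_(v i, v1 i)) (J2 : forall i, 'M[C]_(v i, v2 i)).
Hypotheses (J11 : forall i, adj (J1 i) *m J1 i = 1%:M) (J22 : forall i, adj (J2 i) *m J2 i = 1%:M)
  (J12 : forall i, adj (J1 i) *m J2 i = 0)
  (Jsum : forall i, J1 i *m adj (J1 i) + J2 i *m adj (J2 i) = 1%:M).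
Hypotheses (hv : v inf = 1%N) (hv1 : v1 inf = 1%N).
Variables (x : rep R v) (x1 : rep R v1) (gam : R).
Hypotheses (hom1 : is_hom J1 x1 x)
  (cohom1 : forall a, adj (J1 (qhead a)) *m x a = x1 a *m adj (J1 (qtail a))).
Hypothesis BE : forall i, Bf (fun j => (can_stab inf v j)%:~R) x i
  = 1%:M - gam%:C%C *: (J1 i *m adj (J1 i)).

Lemma critical_intro rels : nu_zero rels x -> critical rels (can_stab inf v) x.
Proof.
move=> nx; split=> // a.
have i0 : 'i%C != 0 :> C.
  by apply/eqP => h; have := sqr_i R; rewrite h expr0n => /eqP; rewrite eq_sym oppr_eq0 oner_eq0.
have : 'i%C *: inf_act x (shifted_moment (can_stab inf v) x) a = 0.
  rewrite /inf_act scalerBr scalemxAl scalemxAr !Bf_shifted_moment !BE.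
  rewrite mulmxBl mulmxBr mul1mx mulmx1 -scalemxAl -scalemxAr -mulmxA cohom1 !mulmxA hom1.
  by rewrite subrr.
by move/eqP; rewrite scaler_eq0 (negPf i0) => /eqP.
Qed.

Hypotheses (gam0 : gam != 0) (cx1 : cogen inf x1).

(** The compression [x2] to the complement has [Bf] equal to 1, so its moment map vanishes where
    alpha is 1, and at [inf] it has dimension 0. That [gam] is non-zero makes the image of [J1] the
    full eigenspace. *)
Lemma crit_splitting_intro : exists x2 : rep R v2, crit_splitting inf (can_stab inf v) x x1 x2.
Proof.
pose x2 : rep R v2 := fun a => adj (J2 (qhead a)) *m x a *m J2 (qtail a).
have xE a : x a = J1 (qhead a) *m x1 a *m adj (J1 (qtail a))
                    + J2 (qhead a) *m x2 a *m adj (J2 (qtail a)).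
  apply: (cancel_orth Jsum).
    by rewrite mulmxDl -!mulmxA J11 (orth21 J12) !mulmx0 addr0 mulmx1 hom1.
  rewrite mulmxDl -!mulmxA J12 J22 !mulmx0 add0r mulmx1 /x2 !mulmxA.
  rewrite -[x a in LHS]mul1mx -(Jsum (qhead a)) !mulmxDl -!mulmxA.
  by rewrite [adj (J1 _) *m _]mulmxA cohom1 -mulmxA J12 !mulmx0 add0r.
have e2 i : Bf (fun j => (can_stab inf v j)%:~R) x2 i = 1%:M.
  have := congr1 (fun A => adj (J2 i) *m A *m J2 i) (orth_Bf J11 J22 J12 Jsum xE (fun j => (can_stab inf v j)%:~R) i).
  rewrite BE mulmxDr mulmxBr mulmx1 mulmxDl mulmxBl J22 -scalemxAr -scalemxAl !mulmxA.
  rewrite (orth21 J12) J22 !mul0mx scaler0 subr0 add0r mul1mx => ->.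
  by rewrite -mulmxA J22 mulmx1.
have d2 : v2 inf = 0%N by have := orth_dim J11 J22 Jsum inf; rewrite hv hv1 add1n => -[].
exists x2, J1, J2; split=> //.
- exists ((1 - gam)%:C%C) => i c; rewrite Bf_shifted_moment BE mulmxBl mul1mx -scalemxAl.
  rewrite rmorphB scalerBl scale1r; split=> [[b ->]|].
    by rewrite mulmxA -[J1 i *m _ *m J1 i]mulmxA J11 mulmx1.
  move/addrI/oppr_inj => e; exists (adj (J1 i) *m c); rewrite mulmxA.
  apply: (@scalerI _ _ (gam%:C%C)) => //; first by rewrite fmorph_eq0.
- by apply/(stable_cogen x1 hv1).
move=> i; apply/moment_eq0; have [->|ne] := eqVneq i inf; first exact: matrix0_rows.
have := e2 i; rewrite /Bf /can_stab (negPf ne) mulr1z rmorph1 -[RHS]add0r => /addIr/eqP.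
by rewrite scaler_eq0 fmorph_eq0 invr_eq0 pnatr_eq0 /= => /eqP.
Qed.

End Splitting.

Section ZeroExtension.
Variables (w v : dimvec Q) (wv : forall i, (w i <= v i)%N).
Local Notation I1 i := (inc1 R (w i) (v i)).
Local Notation I2 i := (inc2 R (w i) (v i)).

Definition extend_rep (x : rep R w) : rep R v := fun a =>
  I1 (qhead a) *m x a *m adj (I1 (qtail a)).

Let I11 i : adj (I1 i) *m I1 i = 1%:M := inc11 R (wv i).
Let I22 i : adj (I2 i) *m I2 i = 1%:M := inc22 R (wv i).
Let I12 i : adj (I1 i) *m I2 i = 0 := inc12 R (w i) (v i).
Let I21 i : adj (I2 i) *m I1 i = 0 := orth21 I12 i.
Let Isum i : I1 i *m adj (I1 i) + I2 i *m adj (I2 i) = 1%:M := inc_sum R (wv i).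

Lemma Bf_extend c (x : rep R w) i : Bf c (extend_rep x) i =
  I1 i *m Bf c x i *m adj (I1 i) + (c i)%:C%C *: (I2 i *m adj (I2 i)).
Proof.
pose z : rep R (fun j => v j - w j)%N := fun a => 0.
have xE a : extend_rep x a = I1 (qhead a) *m x a *m adj (I1 (qtail a))
    + I2 (qhead a) *m z a *m adj (I2 (qtail a)).
  by rewrite mulmx0 mul0mx addr0.
rewrite (orth_Bf I11 I22 I12 Isum xE) /=; congr (_ + _).
have h0 : hmu z i = 0.
  by rewrite /hmu /hmu2 big1 // => a _; rewrite mul0mx mulmx0 !put0 subrr.
by rewrite /Bf h0 scaler0 add0r mul_mx_scalar -scalemxAl.
Qed.

Lemma extend_hom (x : rep R w) : is_hom (fun i => I1 i) x (extend_rep x).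
Proof. by move=> a; rewrite -mulmxA I11 mulmx1. Qed.

Lemma extend_cohom (x : rep R w) a :
  adj (I1 (qhead a)) *m extend_rep x a = x a *m adj (I1 (qtail a)).
Proof. by rewrite /extend_rep !mulmxA I11 mul1mx. Qed.

Lemma bfield_extend c (x : rep R w) a :
  bfield c (extend_rep x) a = extend_rep (bfield c x) a.
Proof.
have h1 : Bf c (extend_rep x) (qhead a) *m extend_rep x a =
    I1 (qhead a) *m (Bf c x (qhead a) *m x a) *m adj (I1 (qtail a)).
  have e : adj (I2 (qhead a)) *m extend_rep x a = 0 by rewrite /extend_rep !mulmxA I21 !mul0mx.
  by rewrite Bf_extend mulmxDl -!mulmxA extend_cohom -scalemxAl -mulmxA e mulmx0 scaler0 addr0.
have h2 : extend_rep x a *m Bf c (extend_rep x) (qtail a) =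
    I1 (qhead a) *m (x a *m Bf c x (qtail a)) *m adj (I1 (qtail a)).
  have e : extend_rep x a *m I2 (qtail a) = 0 by rewrite /extend_rep -mulmxA I12 mulmx0.
  by rewrite Bf_extend mulmxDr -scalemxAr !mulmxA -extend_hom e mul0mx scaler0 addr0.
rewrite /bfield /inf_act h1 h2 {1}/extend_rep mulmxN mulNmx mulmxBr mulmxBl.
by [].
Qed.

Lemma isflow_extend c phi t : isflow c phi t -> isflow c (fun s => extend_rep (phi s)) t.
Proof.
move=> h a.
apply: mder_ext (mderM (mderM (mder_cst (I1 (qhead a)) t) (h a)) (mder_cst (adj (I1 (qtail a))) t)) => //.
by rewrite bfield_extend mul0mx add0r mulmx0 addr0.
Qed.

Lemma mlim_extend (F : set_system R) (FF : ProperFilter F) (phi : R -> rep R w) (x : rep R w) a :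
  mlim F (fun t => phi t a) (x a) -> mlim F (fun t => extend_rep (phi t) a) (extend_rep x a).
Proof. by move=> h; apply: mlimM; [apply: mlimM => //|]; apply: mlim_cst. Qed.

Lemma extend_path_eval (x : rep R w) s d (p : qpath s d) : (0 < plength p)%N ->
  path_eval (extend_rep x) p = I1 d *m path_eval x p *m adj (I1 s).
Proof.
case: p => // a p _ /=.
have e d' (q : qpath s d') : adj (I1 d') *m path_eval (extend_rep x) q = path_eval x q *m adj (I1 s).
  elim: q => [|b q ih] /=; first by rewrite mulmx1 mul1mx.
  by rewrite mulmxA extend_cohom -mulmxA ih mulmxA.
by rewrite {1}/extend_rep -[LHS]mulmxA e !mulmxA.
Qed.

(** A trivial path evaluates to the identity of the larger space, so the factorisation through [w]
    holds for paths of positive length; those in relations have length at least 2. *)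
Lemma extend_nu_zero rels (x : rep R w) : nu_zero rels x -> nu_zero rels (extend_rep x).
Proof.
apply: sub_all => r /eqP e; apply/eqP.
have -> : rel_eval (extend_rep x) r = I1 (rel_head r) *m rel_eval x r *m adj (I1 (rel_tail r)).
  rewrite /rel_eval; elim: (rel_terms r) (rel_length r) => [_|t L ih /= /andP[t2 hL]].
    by rewrite !big_nil mulmx0 mul0mx.
  rewrite !big_cons ih // mulmxDr mulmxDl -scalemxAr -scalemxAl extend_path_eval //.
  exact: ltnW.
by rewrite e mulmx0 mul0mx.
Qed.

End ZeroExtension.
End CriticalExtensions.

Section ConnectingOrbits.
Variables (R : realType) (Q : quiver) (inf : Q).
Notation C := R[i].

Lemma nu_zero_iso_class (w : dimvec Q) (x y : rep R w) rels :
  iso_class x = iso_class y -> nu_zero rels y -> nu_zero rels x.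
Proof. by move=> /iso_class_hom [J [h m]]; exact: hom_nu_zero h m. Qed.

Lemma cogen_iso_class (w : dimvec Q) (x y : rep R w) :
  iso_class x = iso_class y -> cogen inf y -> cogen inf x.
Proof. by move=> /iso_class_hom [J [h m]]; exact: hom_cogen h m. Qed.

Lemma iso_to_subrep_iso_class (w1 w : dimvec Q) (z x : rep R w1) (y : rep R w) :
  iso_class z = iso_class x -> iso_to_subrep x y -> iso_to_subrep z y.
Proof.
move=> /iso_class_hom [g [hg mg]] [U [J [_ _ inj hJ]]].
apply: (@hom_iso_to_subrep _ _ _ _ (fun i => J i *m g i)).
  by move=> a; rewrite -mulmxA hg !mulmxA hJ.
by move=> i b b'; rewrite -!mulmxA => /inj/mg.
Qed.

Lemma Bf_shift (c c' : Q -> R) k (w : dimvec Q) (x : rep R w) i : (forall i, c i = c' i + k) ->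
  Bf c x i = Bf c' x i + (k%:C%C)%:M.
Proof. by move=> h; rewrite /Bf h rmorphD [(_ + _)%:M]raddfD addrA. Qed.

Lemma isflow_bfield_shift (c c' : Q -> R) k (w : dimvec Q) (phi : R -> rep R w) t :
  (forall i, c i = c' i + k) -> isflow c' phi t -> isflow c phi t.
Proof. by move=> h fl a; rewrite (bfield_shift _ _ h). Qed.

Section Unstable.
Variables (w w1 w2 : dimvec Q) (j1 : forall i, 'M[C]_(w i, w1 i)) (j2 : forall i, 'M[C]_(w i, w2 i)).
Hypotheses (j11 : forall i, adj (j1 i) *m j1 i = 1%:M) (j22 : forall i, adj (j2 i) *m j2 i = 1%:M)
  (j12 : forall i, adj (j1 i) *m j2 i = 0)
  (jsum : forall i, j1 i *m adj (j1 i) + j2 i *m adj (j2 i) = 1%:M).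
Variables (k : Q) (hw : w inf = 1%N).
Hypotheses (kinf : k != inf) (w2k : w2 k = 1%N) (w20 : forall i, i != k -> w2 i = 0%N).
Variables (c : Q -> R) (gam : R) (x1 : rep R w1) (y : rep R w).
Hypotheses (gam0 : 0 < gam) (c1 : forall i, i != inf -> c i = 1).
Hypotheses (Bx1 : forall i, Bf c x1 i = ((1 - gam)%:C%C)%:M).
Hypotheses (cy : cogen inf y) (homy : is_hom j1 x1 y).

Lemma unstable_orbit : exists (phi : R -> rep R w) T,
  [/\ forall t, t < T -> isflow c phi t,
      forall a, mlim -oo (fun t => phi t a) (diag_rep j1 j2 x1 y a) &
      forall t, t < T -> iso_class (phi t) = iso_class y].
Proof.
have cx1 : cogen inf x1 := hom_cogen homy (orth_mono1 j11) cy.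
pose xu := diag_rep j1 j2 x1 y.
have xuE a : xu a = j1 (qhead a) *m x1 a *m adj (j1 (qtail a))
    + j2 (qhead a) *m quot_rep j2 y a *m adj (j2 (qtail a)) by [].
have ub0 : upper j1 j2 (off_diag j1 j2 x1 y).
  move=> a; rewrite (off_diagE j11 j22 j12 jsum homy).
  transitivity (j1 (qhead a) *m (adj (j1 (qhead a)) *m j1 (qhead a)) *m adj (j1 (qhead a)) *m y a
      *m j2 (qtail a) *m (adj (j2 (qtail a)) *m j2 (qtail a)) *m adj (j2 (qtail a))).
    by rewrite j11 j22 !mulmx1.
  by rewrite !mulmxA.
have yE0 a : y a = xu a + off_diag j1 j2 x1 y a by rewrite addrC subrK.
have [z [b [iz ub zE hb]]] := harmonic_gauge j11 j22 j12 jsum xuE kinf w20 cx1 ub0 yE0.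
have cz : cogen inf z := cogen_iso_class iz cy.
have [f hf] := bfield_pexp w c.
have xu0 := split_bfield j11 j22 j12 jsum xuE kinf w2k w20 Bx1 c1.
have bE := dbfield_harmonic j11 j22 j12 jsum xuE kinf w2k w20 Bx1 c1 ub hb.
have coer := dbfield_coercive j11 j22 j12 jsum xuE kinf w2k w20 Bx1 c1 gam0.
have [phi [T [M [fl asym]]]] := unstable_flow hf gam0 xu0 bE coer.
exists phi, T; split=> // [a|t tT].
  exact: (unstable_lim (xu := xu) (b := b) gam0 asym).
have le : rel_le inf z (phi t).
  exact: (unstable_orbit_rel_le j11 j22 j12 jsum xuE ub zE hw gam0 fl asym tT).
by rewrite -iz; apply/esym/(rel_le_iso_class hw cz (rel_le_cogen hw cz le) le).
Qed.

End Unstable.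

Lemma cvg_shift_ninfty (s : R) : (fun t : R => t - s) @ -oo --> -oo.
Proof.
move=> A [M [_ hM]]; exists (M + s); split; first by rewrite num_real.
by move=> t /= tM; apply: hM; rewrite ltrBlDr.
Qed.

Section Gluing.
Variables (w : dimvec Q) (hw : w inf = 1%N) (N kap : R) (N0 : 0 < N) (c : Q -> R).
Hypothesis cE : forall i, c i = traceless_shift inf w N i + kap.
Variables (phi : R -> rep R w) (T : R) (xu : rep R w).
Hypotheses (fl : forall t, t < T -> isflow c phi t)
  (lim : forall a, mlim -oo (fun t => phi t a) (xu a))
  (cphi : forall t, t < T -> cogen inf (phi t)).

(** The orbit leaving [xu] is known only before [T]; it is prolonged by the forward flow from one of
    its points, which is stable. *)
Lemma orbit_completion : exists (psi : R -> rep R w) (z : rep R w) t1,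
  [/\ forall t, isflow c psi t, t1 < T /\ psi 0 = phi t1,
      forall a, mlim -oo (fun t => psi t a) (xu a),
      forall a, mlim +oo (fun t => psi t a) (z a) &
      [/\ forall i, Bf c z i = (kap%:C%C)%:M, cogen inf z & iso_class z = iso_class (psi 0)]].
Proof.
pose t1 := T - 1; have t1T : t1 < T by rewrite gtrBl.
have [phi2 [h [z [h0 p0 fl2 lim2 [Bz [cz iz]]]]]] := forward_flow hw N0 (cphi t1T).
(* At time 0 both pieces must solve the equation on a two-sided neighbourhood: the shifted [phi]
   does so up to time [T - t1 = 1], and [phi2] from [- h] on. *)
pose psi (t : R) := if t <= 0 then phi (t - - t1) else phi2 t.
have psi0 : psi 0 = phi t1 by rewrite /psi lexx opprK add0r.
exists psi, z, t1; split=> [t||a|a|].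
- apply: isflow_glue => [|t0|t0].
  + by rewrite opprK add0r p0.
  + by apply: isflow_shift; apply: fl; rewrite opprK (le_lt_trans _ t1T) // gerDr.
  + apply: (isflow_bfield_shift cE); apply: fl2.
    by apply: lt_le_trans t0; rewrite oppr_lt0.
- by split.
- have h2 : mlim -oo (fun t => phi (t - - t1) a) (xu a).
    move=> p q; have [l1 l2] := @lim a p q.
    by split; [apply: cvg_comp (cvg_shift_ninfty (- t1)) l1|apply: cvg_comp (cvg_shift_ninfty (- t1)) l2].
  apply: mlim_near h2.
  by exists 0; split=> // t /= t0; rewrite /psi ltW.
- apply: mlim_near (@lim2 a).
  by exists 0; split=> // t /= t0; rewrite /psi leNgt t0.
split=> // [i|]; last by rewrite psi0.
by rewrite (Bf_shift _ _ cE) Bz add0r.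
Qed.

End Gluing.

Section Hecke.
Variables (rels : seq (relation R Q)) (v w : dimvec Q) (k : Q).
Hypotheses (hv : v inf = 1%N) (hk : k <> inf) (wv : forall i, (w i <= v i)%N)
  (hw : w inf = 1%N) (wk : (0 < w k)%N).
Local Notation alpha := (can_stab inf v).
Local Notation c := (fun i => (can_stab inf v i)%:~R : R).
Local Notation I1 i := (inc1 R (w i) (v i)).
Local Notation I2 i := (inc2 R (w i) (v i)).

Lemma Bf_extend_sub (x : rep R w) (A : forall i, 'M[C]_(w i)) i :
  Bf c x i = 1%:M - A i -> Bf c (extend_rep v x) i = 1%:M - I1 i *m A i *m adj (I1 i).
Proof.
move=> e; rewrite (Bf_extend wv) e mulmxBr mulmxBl mulmx1 -(inc_sum R (wv i)) [RHS]addrAC.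
congr (_ + _); have [->|ne] := eqVneq i inf.
  by rewrite (matrix0_cols (I2 inf)) ?mul0mx ?scaler0 // hv hw subnn.
by rewrite /can_stab (negPf ne) mulr1z rmorph1 scale1r.
Qed.

Lemma hecke_flow_moduli :
  hecke inf k rels w `<=` flow_moduli inf rels v (dim_sub_basis w k) w.
Proof.
move=> cl [[[u1 [nu1 su1] c1] [u2 [nu2 su2] c2]] [x1 [x2 [clE sub]]]].
pose w1 := dim_sub_basis w k.
have kinf : k != inf by apply/eqP.
have hw1 : w1 inf = 1%N by rewrite /w1 /dim_sub_basis hw eq_sym (negPf kinf).
have w1w i : (w1 i <= w i)%N by exact: leq_subr.
have w1v i : (w1 i <= v i)%N := leq_trans (w1w i) (wv i).
have i1 : iso_class x1 = iso_class u1 by rewrite c1 clE.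
have i2 : iso_class x2 = iso_class u2 by rewrite c2 clE.
have cx1 : cogen inf x1 by apply: cogen_iso_class i1 _; apply/(stable_cogen u1 hw1).
have cx2 : cogen inf x2 by apply: cogen_iso_class i2 _; apply/(stable_cogen u2 hw).
have nx2 := nu_zero_iso_class i2 nu2.
have N0 : 0 < wsize R v := wsize_gt0 R hv.
have cE (u : dimvec Q) i : c i = traceless_shift inf u (wsize R v) i + (1 - slope_gap u (wsize R v)).
  by rewrite /= (sum_c_can_stab R i hv) /traceless_shift; ring.
pose gam := slope_gap w1 (wsize R v); have gam0 : 0 < gam := gamma_gt0 R hw1 hv.
pose gaml := slope_gap w (wsize R v); have gaml0 : 0 < gaml := gamma_gt0 R hw hv.
(* [xa] is the point of the class of [x1] where the moment map equation holds; it will be the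
   summand x_1^u. *)
have [_ [_ [xa [_ _ _ _ [Bxa [cxa ixa]]]]]] := forward_flow hw1 N0 cx1.
have Ba i : Bf c xa i = ((1 - gam)%:C%C)%:M by rewrite (Bf_shift _ _ (cE w1)) Bxa add0r.
pose j1 i := inc1 R (w1 i) (w i); pose j2 i := inc2 R (w1 i) (w i).
have j11 i : adj (j1 i) *m j1 i = 1%:M := inc11 R (w1w i).
have j22 i : adj (j2 i) *m j2 i = 1%:M := inc22 R (w1w i).
have j12 i : adj (j1 i) *m j2 i = 0 := inc12 R (w1 i) (w i).
have jsum i : j1 i *m adj (j1 i) + j2 i *m adj (j2 i) = 1%:M := inc_sum R (w1w i).
have [y [iy homy]] := triangularise j11 (iso_to_subrep_iso_class ixa sub).
have cy : cogen inf y := cogen_iso_class iy cx2.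
have ny := nu_zero_iso_class iy nx2.
have w2k : (w k - w1 k)%N = 1%N by rewrite /w1 /dim_sub_basis eqxx subKn.
have w20 i : i != k -> (w i - w1 i)%N = 0%N.
  by rewrite /w1 /dim_sub_basis => /negPf ->; rewrite subn0 subnn.
have cone i : i != inf -> c i = 1 by rewrite /= /can_stab => /negPf ->.
have [phi [T [fl limu iphi]]] := @unstable_orbit w w1 (fun i => w i - w1 i)%N j1 j2 j11 j22 j12 jsum
  k hw kinf w2k w20 c gam xa y gam0 cone Ba cy homy.
have cphi t : t < T -> cogen inf (phi t) by move=> /iphi e; exact: cogen_iso_class e cy.
have [psi [z [t1 [flp [t1T psi0] limp limz [Bz cz iz]]]]] :=
  orbit_completion hw N0 (cE w) fl limu cphi.
set xu := diag_rep j1 j2 xa y in limu limp.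
have nxu : nu_zero rels xu := diag_nu_zero j11 j22 j12 jsum homy ny.
have izx2 : iso_class z = iso_class x2 by rewrite iz psi0 iphi.
have nz : nu_zero rels z := nu_zero_iso_class izx2 nx2.
(* The complement of [xa] in [v] combines the one-dimensional quotient at [k] with the coordinates
   added by zero. *)
pose J1 i := inc1 R (w1 i) (v i); pose J2 i := inc2 R (w1 i) (v i).
have J1E i : J1 i = I1 i *m j1 i by rewrite /J1 /j1 inc1_trans.
have hxu : is_hom j1 xa xu := orth_hom1 j11 j12 (fun a => erefl).
have homu : is_hom J1 xa (extend_rep v xu).
  by move=> a; rewrite !J1E -mulmxA hxu mulmxA (extend_hom wv) -!mulmxA.
have cohxu a : adj (j1 (qhead a)) *m xu a = xa a *m adj (j1 (qtail a)).
  by rewrite /xu /diag_rep mulmxDr !mulmxA j11 j12 !mul0mx addr0 mul1mx.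
have cohomu a : adj (J1 (qhead a)) *m extend_rep v xu a = xa a *m adj (J1 (qtail a)).
  by rewrite !J1E !adjM -mulmxA (extend_cohom wv) !mulmxA cohxu.
have Bu i : Bf c (extend_rep v xu) i = 1%:M - gam%:C%C *: (J1 i *m adj (J1 i)).
  have e := @split_Bf1 _ _ _ _ _ _ _ _ j11 j22 j12 jsum _ _ xu (fun a => erefl) _ kinf w2k w20 _ _ Ba cone i.
  rewrite (Bf_extend_sub (A := fun i => gam%:C%C *: (j1 i *m adj (j1 i))) e).
  by rewrite -scalemxAr -scalemxAl J1E adjM !mulmxA.
have Bl i : Bf c (extend_rep v z) i = 1%:M - gaml%:C%C *: (I1 i *m adj (I1 i)).
  have e : Bf c z i = 1%:M - (gaml%:C%C)%:M by rewrite Bz -/gaml rmorphB raddfB rmorph1.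
  by rewrite (Bf_extend_sub (A := fun i => (gaml%:C%C)%:M) e) mul_mx_scalar -scalemxAl.
have gn : gam != 0 by rewrite gt_eqF.
have gln : gaml != 0 by rewrite gt_eqF.
have [x2u su] := crit_splitting_intro (J2 := J2) (fun i => inc11 R (w1v i)) (fun i => inc22 R (w1v i))
  (fun i => inc12 R _ _) (fun i => inc_sum R (w1v i)) hv hw1 homu cohomu Bu gn cxa.
have [x2l sl] := crit_splitting_intro (J2 := fun i => I2 i) (fun i => inc11 R (wv i))
  (fun i => inc22 R (wv i)) (fun i => inc12 R _ _) (fun i => inc_sum R (wv i)) hv hw
  (extend_hom wv z) (extend_cohom wv z) Bl gln cz.
exists (extend_rep v xu, extend_rep v z); last first.
  by exists (fun i => v i - w1 i)%N, (fun i => v i - w i)%N, xa, x2u, z, x2l; rewrite ixa izx2 clE.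
split; first split.
- split; first exact: critical_intro homu cohomu Bu _ (extend_nu_zero wv nxu).
  by exists (fun i => v i - w1 i)%N, xa, x2u.
- split; first exact: critical_intro (extend_hom wv z) (extend_cohom wv z) Bl _ (extend_nu_zero wv nz).
  by exists (fun i => v i - w i)%N, z, x2l.
have npsi : nu_zero rels (psi 0) by rewrite psi0; exact: nu_zero_iso_class (iphi t1 t1T) ny.
exists (extend_rep v (psi 0)); first exact: (extend_nu_zero wv npsi).
exists (fun t => extend_rep v (psi t)); split.
- by apply/gradient_flowE; split=> [|t]; [reflexivity|exact: (isflow_extend wv (flp t))].
- by move=> a; exact: (mlim_extend _ (@limp a)).
- by move=> a; exact: (mlim_extend _ (@limz a)).
Qed.

End Hecke.
End ConnectingOrbits.

Theorem theorem1p3 (R : realType) (Q : quiver) (rels : seq (relation R Q))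
    (v : dimvec Q) (inf k : Q) (v1l : dimvec Q)
    (hv : v inf = 1%N) (hk : k <> inf)
    (hlt : dim_lt v1l v) (hinf : v1l inf = 1%N) (hpos : (0 < v1l k)%N) :
  flow_moduli inf rels v (dim_sub_basis v1l k) v1l = hecke inf k rels v1l.
Proof.
have [wv _] := hlt.
apply/seteqP; split; first exact: flow_moduli_hecke.
exact: hecke_flow_moduli.
Qed.
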